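(* Let $\alpha,s_1\in\mathbb{R}$, $0<s\le\infty$, $1<r,q<\infty$ and $0\le\alpha<n-\frac{n}{q}$. Suppose that $$\frac{n}{s}-s_1=\alpha+\frac{n}{q}.$$ Assume that one of the following four conditions holds: (1) $q<s\le\infty$, $q\le r$ and $\alpha>0$; (2) $q<s\le\infty$, $q\le r\le s$ and $\alpha=0$; (3) $0<s\le q<\infty$ and $\alpha>\frac{n}{s}-\frac{n}{q}$; (4) $0<s\le q<\infty$, $q\le r\le s$, $\alpha=\frac{n}{s}-\frac{n}{q}$ and $r=2$. Then $$\dot{K}_{q}^{\alpha,r}\hookrightarrow B_{s,r}^{s_1}.$$
   Context: All spaces are on $\mathbb{R}^n$, and $n/\infty=0$. For $k\in\mathbb{Z}$ let $C_k=\{x\in\mathbb{R}^n:2^{k-1}\le|x|<2^k\}$ and let $\chi_k$ be the characteristic function of $C_k$. For $\alpha\in\mathbb{R}$, $0<p,q\le\infty$, the homogeneous Herz space $\dot{K}_q^{\alpha,p}$ is the set of all $f\in L^q_{\mathrm{loc}}(\mathbb{R}^n\setminus\{0\})$ with $$\|f\|_{\dot{K}_q^{\alpha,p}}=\Big(\sum_{k=-\infty}^{\infty}2^{k\alpha p}\|f\chi_k\|_{L^q}^p\Big)^{1/p}<\infty,$$ with the usual modifications if $p=\infty$ and/or $q=\infty$. Under the hypotheses of the claim, elements of the Herz space are identified with regular tempered distributions. The Fourier transform is $\mathcal{F}f(\xi)=(2\pi)^{-n/2}\int_{\mathbb{R}^n}e^{-ix\cdot\xi}f(x)\,dx$, extended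 to the space of tempered distributions $\mathcal{S}'(\mathbb{R}^n)$. Fix $\phi_0\in\mathcal{S}(\mathbb{R}^n)$ with $\phi_0(x)=1$ for $|x|\le1$ and $\phi_0(x)=0$ for $|x|\ge2$, and put $\phi_j(x)=\phi_0(2^{-j}x)-\phi_0(2^{1-j}x)$ for $j\ge1$. For $\sigma\in\mathbb{R}$ and $0<p,\beta\le\infty$ the Besov space $B_{p,\beta}^{\sigma}$ is the set of all $f\in\mathcal{S}'(\mathbb{R}^n)$ with $$\|f\|_{B_{p,\beta}^{\sigma}}=\Big(\sum_{j=0}^\infty2^{j\sigma\beta}\|\mathcal{F}^{-1}\phi_j*f\|_{L^p}^\beta\Big)^{1/\beta}<\infty$$ (supremum if $\beta=\infty$). $X\hookrightarrow Y$ means that $X\subset Y$ and the natural inclusion is continuous, i.e. $\|f\|_Y\le c\|f\|_X$ for all $f\in X$ with a constant $c$ independent of $f$. *)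

(* Defs.v *)
From HB Require Import structures.
From mathcomp Require Import all_boot all_order all_algebra.
From mathcomp Require Import all_classical all_reals all_analysis.
From mathcomp Require Import complex.

Set Implicit Arguments.
Unset Strict Implicit.
Unset Printing Implicit Defensive.
Import Order.TTheory GRing.Theory Num.Theory.
Import numFieldNormedType.Exports.

Local Open Scope classical_set_scope.
Local Open Scope ring_scope.

Definition rV_display : measure_display -> measure_display.
Proof. exact. Qed.

(* The sigma-algebra generated by the coordinates, as the library does for
   tuples; for [T = R] these are the Borel sets. *)
Section measurable_rV.
Context {d} {T : sigmaRingType d}.
Variable n : nat.

Let coors : 'I_n -> 'rV[T]_n -> T := fun i x => x ord0 i.

Let rV_set0 : g_sigma_preimage coors set0.
Proof. exact: sigma_algebra0. Qed.

Let rV_setC A : g_sigma_preimage coors A -> g_sigma_preimage coors (~` A).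
Proof. exact: sigma_algebraC. Qed.

Let rV_bigcup (F : _^nat) : (forall i, g_sigma_preimage coors (F i)) ->
  g_sigma_preimage coors (\bigcup_i (F i)).
Proof. exact: sigma_algebra_bigcup. Qed.

HB.instance Definition _ := @isMeasurable.Build (rV_display d)
  'rV[T]_n (g_sigma_preimage coors) rV_set0 rV_setC rV_bigcup.

End measurable_rV.
Lemma measurable_rV_coord d (T : sigmaRingType d) n (i : 'I_n) :
  measurable_fun [set: 'rV[T]_n] (fun x : 'rV[T]_n => x ord0 i).
Proof.
move=> _ Y mY; rewrite setTI; apply: sub_sigma_algebra => /=.
rewrite -bigcup_seq/=; exists i => /=; first by rewrite mem_index_enum.
by exists Y => //; rewrite setTI.
Qed.

Lemma measurable_fun_rV d d' (T : measurableType d) (T' : measurableType d') n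
    (f : T' -> 'rV[T]_n) :
  (forall i, measurable_fun setT (fun x => f x ord0 i)) ->
  measurable_fun setT f.
Proof.
move=> mf _ Y mY; rewrite setTI.
suff : g_sigma_preimage (fun i (x : 'rV[T]_n) => x ord0 i) `<=`
    [set B | measurable (f @^-1` B)] by exact.
apply: smallest_sub.
  split => /=.
  - by rewrite preimage_set0; exact: measurable0.
  - by move=> A mA; rewrite setTD preimage_setC; exact: measurableC.
  - by move=> F mF; rewrite preimage_bigcup; exact: bigcup_measurable.
rewrite -bigcup_seq => _ /= [i _ [B mB <-]]/=.
by rewrite setTI -[X in measurable X]setTI; exact: mf.
Qed.

Section lebesgue_step.
Context {R : realType} {n : nat}.

Definition rV_cons (x : measurableTypeR R * 'rV[R]_n) : 'rV[R]_n.+1 :=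
  \row_i (if unlift ord0 i is Some j then x.2 ord0 j else x.1).

Definition rV_uncons (x : 'rV[R]_n.+1) : measurableTypeR R * 'rV[R]_n :=
  (x ord0 ord0, \row_i x ord0 (lift ord0 i)).

Lemma rV_consK : cancel rV_cons rV_uncons.
Proof.
move=> [a x]; congr (_, _); first by rewrite mxE unlift_none.
by apply/rowP => i; rewrite !mxE liftK.
Qed.

Lemma measurable_rV_cons : measurable_fun setT rV_cons.
Proof.
apply: measurable_fun_rV => i.
case: (unliftP ord0 i) => [j ->|->].
  under eq_fun do rewrite mxE liftK.
  exact: (measurableT_comp (measurable_rV_coord j) measurable_snd).
under eq_fun do rewrite mxE unlift_none.
exact: measurable_fst.
Qed.

Lemma measurable_rV_uncons : measurable_fun setT rV_uncons.
Proof.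
apply: measurable_fun_pair.
  by move=> _ Y mY; exact: (measurable_rV_coord _ measurableT mY).
apply: measurable_fun_rV => i /=.
under eq_fun do rewrite mxE.
exact: measurable_rV_coord.
Qed.

Variable m : {sigma_finite_measure set 'rV[R]_n -> \bar R}.

Let prod_measure :
    {measure set (measurableTypeR R * 'rV[R]_n)%type -> \bar R} :=
  product_measure1 (@lebesgue_measure R) m.

Definition lebesgue_step : set 'rV[R]_n.+1 -> \bar R :=
  pushforward (@lebesgue_measure R \x m)%E rV_cons.

Let lebesgue_step0 : lebesgue_step set0 = 0%E.
Proof. by rewrite /lebesgue_step /pushforward preimage_set0 measure0. Qed.

Let lebesgue_step_ge0 A : (0 <= lebesgue_step A)%E.
Proof. exact: (measure_ge0 prod_measure). Qed.

Let lebesgue_step_sigma_additive : semi_sigma_additive lebesgue_step.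
Proof.
move=> F mF tF mUF; rewrite /lebesgue_step /pushforward preimage_bigcup.
apply: (@measure_semi_sigma_additive _ _ _ prod_measure).
- by move=> k; rewrite -[X in measurable X]setTI; exact: measurable_rV_cons.
- apply/trivIsetP => /= i j _ _ ij; rewrite -preimage_setI.
  by move/trivIsetP : tF => /(_ _ _ _ _ ij) ->//; rewrite preimage_set0.
- rewrite -preimage_bigcup -[X in measurable X]setTI.
  exact: measurable_rV_cons.
Qed.

HB.instance Definition _ := isMeasure.Build _ _ _ lebesgue_step
  lebesgue_step0 lebesgue_step_ge0 lebesgue_step_sigma_additive.

Let lebesgue_step_sigma_finite : sigma_finite setT lebesgue_step.
Proof.
have /sigma_finiteP[F [TF ndF Foo]] := sigma_finiteT (@lebesgue_measure R).
have /sigma_finiteP[G [TG ndG Goo]] := sigma_finiteT m.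
exists (fun k => rV_uncons @^-1` (F k `*` G k)).
  rewrite -preimage_bigcup -[LHS](preimage_setT rV_uncons); congr (_ @^-1` _).
  rewrite -setXTT TF TG predeqE => -[x y]; split.
    move=> [/= [i _ Fx] [j _ Gy]]; exists (maxn i j) => //; split.
    - by move: x Fx; exact/subsetPset/ndF/leq_maxl.
    - by move: y Gy; exact/subsetPset/ndG/leq_maxr.
  by move=> [k _ []/= ? ?]; split; exists k.
move=> k; have [mF Fk] := Foo k; have [mG Gk] := Goo k; split.
  rewrite -[X in measurable X]setTI.
  by apply: measurable_rV_uncons => //; exact: measurableX.
rewrite /lebesgue_step /pushforward -comp_preimage.
rewrite (_ : rV_uncons \o rV_cons = id); last exact/funext/rV_consK.
by rewrite preimage_id product_measure1E// lte_mul_pinfty// ge0_fin_numE.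
Qed.

HB.instance Definition _ := @Measure_isSigmaFinite.Build _ _ _ lebesgue_step
  lebesgue_step_sigma_finite.

End lebesgue_step.

(* Lebesgue measure on R^n; [lebesgue_rV_box] below characterizes it. *)
Fixpoint lebesgue_rV (R : realType) (n : nat) :
    {sigma_finite_measure set 'rV[R]_n -> \bar R} :=
  if n is n'.+1 then
    [the {sigma_finite_measure set _ -> \bar R}
      of lebesgue_step (lebesgue_rV R n')]
  else [the {sigma_finite_measure set _ -> \bar R} of \d_(0 : 'rV[R]_0)].

Lemma lebesgue_rV_box (R : realType) (n : nat) (a b : 'rV[R]_n) :
  (forall i, a ord0 i <= b ord0 i) ->
  lebesgue_rV R n [set x : 'rV[R]_n | forall i, a ord0 i < x ord0 i <= b ord0 i] =
  (\prod_i (b ord0 i - a ord0 i))%:E.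
Proof.
elim: n a b => [|n IHn] a b ab.
  rewrite big_ord0 /= diracE mem_set//=; by case.
pose tl (x : 'rV[R]_n.+1) := (rV_uncons x).2.
have tlE x i : tl x ord0 i = x ord0 (lift ord0 i) by rewrite mxE.
have mbox m (u v : 'rV[R]_m) :
    measurable [set x : 'rV[R]_m | forall i, u ord0 i < x ord0 i <= v ord0 i].
  rewrite (_ : mkset _ = \bigcap_(i in [set: 'I_m])
    ((fun x : 'rV[R]_m => x ord0 i) @^-1` `]u ord0 i, v ord0 i])); last first.
    apply/seteqP; split => [x xuv i _ /=|x xuv i]; first by rewrite in_itv/=.
    by have := xuv i Logic.I; rewrite /= in_itv.
  apply: fin_bigcap_measurable => // i _.
  by rewrite -[X in measurable X]setTI; exact: measurable_rV_coord.
rewrite big_ord_recl /=.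
transitivity ((@lebesgue_measure R \x lebesgue_rV R n)%E
    (`]a ord0 ord0, b ord0 ord0]%classic `*`
     [set x : 'rV[R]_n | forall i, tl a ord0 i < x ord0 i <= tl b ord0 i])).
  rewrite /lebesgue_step /pushforward; congr product_measure1.
  apply/seteqP; split => [[x y]/= xy|[x y]/= [+ xy] i].
    split; first by have := xy ord0; rewrite mxE unlift_none in_itv.
    by move=> i; have := xy (lift ord0 i); rewrite !tlE mxE liftK.
  rewrite in_itv/= => x0; rewrite mxE; case: unliftP => [j ->|->//].
  by have := xy j; rewrite !tlE.
rewrite product_measure1E//=; last exact: mbox.
rewrite lebesgue_measure_itv/= lte_fin IHn; last by move=> i; rewrite !tlE.
under eq_bigr do rewrite !tlE.
case: ltP => [_|]; first by rewrite -EFinD -EFinM.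
rewrite le_eqVlt ltNge ab orbF => /eqP ->.
by rewrite subrr mul0r mul0e.
Qed.

Section spaces.
Context {R : realType} {n : nat}.
Local Notation C := R[i].
Local Notation E := 'rV[R]_n.
Local Notation mu := (lebesgue_rV R n).
Implicit Types (f g phi psi : E -> C) (x xi : E) (p q : \bar R).

(* The library norm of ['rV[R]_n] is the sup norm. *)
Definition eucl_norm x : R := Num.sqrt (\sum_i x ord0 i ^+ 2).

Definition dotp x xi : R := \sum_i x ord0 i * xi ord0 i.

Definition cmod (z : C) : R := ComplexField.Normc.normc z.

Definition expi (t : R) : C := (cos t +i* sin t)%C.

Definition cmeasurable f :=
  measurable_fun [set: E] (fun x => complex.Re (f x)) /\
  measurable_fun [set: E] (fun x => complex.Im (f x)).

Definition cintegrable f :=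
  mu.-integrable [set: E] (fun x => (complex.Re (f x))%:E) /\
  mu.-integrable [set: E] (fun x => (complex.Im (f x))%:E).

Definition cintegral f : C :=
  ((\int[mu]_x complex.Re (f x))%R +i* (\int[mu]_x complex.Im (f x))%R)%C.

Definition Lp_norm p f : \bar R := Lnorm mu p (fun x => (cmod (f x))%:E).

(* [f] times the characteristic function of [A]. *)
Definition restrict_to (A : set E) f : E -> C :=
  fun x => f x * (\1_A x : R)%:C%C.

(* Intended for [0 < p]; the default branch is [p = +oo]. *)
Definition ell_norm (I : choiceType) p (a : I -> \bar R) : \bar R :=
  if p is t%:E then ((\esum_(i in [set: I]) (a i `^ t)) `^ t^-1)%E
  else ereal_sup (range a).

Definition dyadic_annulus (k : int) : set E :=
  [set x | (2 : R) ^ (k - 1) <= eucl_norm x < (2 : R) ^ k].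

Definition herz_norm (alpha : R) p q f : \bar R :=
  ell_norm p (fun k : int =>
    ((2 `^ (k%:~R * alpha))%:E * Lp_norm q (restrict_to (dyadic_annulus k) f))%E).

Definition Lq_loc_punctured q f :=
  cmeasurable f /\
  forall K : set E, compact K -> ~ K 0 -> (Lp_norm q (restrict_to K f) < +oo)%E.

Definition herz_space (alpha : R) p q : set (E -> C) :=
  [set f | Lq_loc_punctured q f /\ (herz_norm alpha p q f < +oo)%E].

Definition partial (i : 'I_n) f : E -> C :=
  fun x => ('D_(delta_mx ord0 i) (fun y => complex.Re (f y)) x +i*
            'D_(delta_mx ord0 i) (fun y => complex.Im (f y)) x)%C.

(* [s] lists the directions of differentiation, with multiplicity. *)
Definition partials (s : seq 'I_n) f : E -> C := foldr partial f s.

Definition smooth f := forall (s : seq 'I_n) x,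
  differentiable (fun y => complex.Re (partials s f y)) x /\
  differentiable (fun y => complex.Im (partials s f y)) x.

Definition schwartz_seminorm (N : nat) f : \bar R :=
  ereal_sup [set y | exists (s : seq 'I_n) x, (size s <= N)%N /\
    y = ((1 + eucl_norm x) ^+ N * cmod (partials s f x))%:E].

Definition schwartz : set (E -> C) :=
  [set f | smooth f /\ forall N, (schwartz_seminorm N f < +oo)%E].

(* A tempered distribution is encoded as a total functional on functions, of
   which only the values on Schwartz functions are meaningful.  The increasing
   family [schwartz_seminorm N] generates the topology of the Schwartz space. *)
Definition tempered_distribution : set ((E -> C) -> C) :=
  [set T |
    (forall (a : C) phi psi, schwartz phi -> schwartz psi ->
       T (fun x => a * phi x + psi x) = a * T phi + T psi) /\
    (forall phi, schwartz phi -> forall e : R, 0 < e ->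
       exists N (d : R), 0 < d /\ forall psi, schwartz psi ->
         (schwartz_seminorm N (fun x => (psi x - phi x)%R) < d%:E)%E ->
         cmod (T psi - T phi) < e)].

Definition distribution_of f : (E -> C) -> C :=
  fun phi => cintegral (fun x => f x * phi x).

Definition regular_tempered f :=
  [/\ forall K : set E, compact K -> cintegrable (restrict_to K f),
      forall phi, schwartz phi -> cintegrable (fun x => f x * phi x) &
      tempered_distribution (distribution_of f)].

(* Normalized so as to invert
   phi |-> (2 pi)^(-n/2) \int e^(-i x.xi) phi(x) dx on Schwartz functions. *)
Definition inv_fourier phi : E -> C := fun x =>
  ((2 * pi) `^ (- (n%:R / 2)))%:C%C *
  cintegral (fun xi => expi (dotp x xi) * phi xi).

Definition convolution psi (T : (E -> C) -> C) : E -> C :=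
  fun x => T (fun y => psi (x - y)).

Definition is_resolution_generator (phi0 : E -> C) :=
  [/\ schwartz phi0,
      forall x, eucl_norm x <= 1 -> phi0 x = 1 &
      forall x, 2 <= eucl_norm x -> phi0 x = 0].

Definition resolution (phi0 : E -> C) (j : nat) : E -> C :=
  if j is j'.+1 then fun x => phi0 (2 ^- j *: x) - phi0 (2 ^- j' *: x)
  else phi0.

Definition besov_norm (phi0 : E -> C) (sigma : R) p q (T : (E -> C) -> C) :
    \bar R :=
  ell_norm q (fun j : nat =>
    ((2 `^ (j%:R * sigma))%:E *
     Lp_norm p (convolution (inv_fourier (resolution phi0 j)) T))%E).

Definition besov_space (phi0 : E -> C) (sigma : R) p q :
    set ((E -> C) -> C) :=
  [set T | tempered_distribution T /\ (besov_norm phi0 sigma p q T < +oo)%E].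

(* The embedding sends [f] to the tempered distribution it generates. *)
Definition herz_embeds_in_besov (alpha : R) p q (phi0 : E -> C) (sigma : R)
    (p' beta : \bar R) :=
  (forall f, herz_space alpha p q f -> regular_tempered f /\
     besov_space phi0 sigma p' beta (distribution_of f)) /\
  (exists c : R, forall f, herz_space alpha p q f ->
     (besov_norm phi0 sigma p' beta (distribution_of f) <=
      c%:E * herz_norm alpha p q f)%E).

End spaces.

(* [n / s] with [n / oo = 0]. *)
Definition dim_over {R : realType} (n : nat) (s : \bar R) : R :=
  if s is t%:E then n%:R / t else 0.

(* Main.v *)
Require Import Defs.
From HB Require Import structures.
From mathcomp Require Import all_boot all_order all_algebra.
From mathcomp Require Import all_classical all_reals all_analysis.
From mathcomp Require Import measurable_realfun ess_sup_inf complex ring lra zify.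

Set Implicit Arguments.
Unset Strict Implicit.
Unset Printing Implicit Defensive.
Import Order.TTheory GRing.Theory Num.Theory.
Import numFieldNormedType.Exports.
Local Open Scope classical_set_scope.
Local Open Scope ring_scope.

(** Why the embedding holds. Let psi_j be the inverse Fourier transform of the
    j-th piece of the resolution, so that the Besov norm of f is the l^r norm
    over j of 2^(j s1) ||psi_j * f||_s. The whole argument takes place on the
    physical side and uses three facts about psi_j: it is bounded by a
    multiple of w_j(z) = 2^(jn) (1 + 2^j |z|)^(-N), for every N; for j >= 1 it
    is the L^1-normalized dilation by 2^j of one fixed profile; this profile
    has integral zero (resolution_kernel, Rintegral_halve). The decay comes
    from the compact support of phi0: translating by h = pi / |x_i| in the
    direction e_i changes the sign of a trigonometric factor, so the transform
    of u is 2^(-N) times that of its N-th difference, which is of size h^N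
    (trigt_decay).

    In the first three cases the cancellation of psi_j is irrelevant: |f| and
    w_j replace f and psi_j. Let f_k be the part of |f| in the annulus C_k.
    The kernel w_j(x - y) either is dominated by a product of weights in x and
    in y, or x lies in a neighbour of the annulus C_k of y and k > -j
    (near_far). The product part has rank one, and 0 <= alpha < n - n/q gives
    it a bound by geometric factors 2^(-delta |j + k|) in front of the Herz
    terms (far_sum). This bound at j = 0 also shows that f is integrable
    against (1 + |y|)^(-2n), hence is a regular tempered distribution
    (herz_regular). The diagonal part at a point x has boundedly many terms,
    so its s-th power is a sum over k of integrals of (w_j * f_k)^s. Young's
    inequality if alpha > 0 (near_high), or Hoelder's inequality on the
    annulus if s <= q (near_low), again yields a geometric factor 2^(-e (j +
    k)), and a discrete convolution with a geometric kernel preserves l^r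
    (esum_geometric_conv).

    In the second case alpha = 0 and nothing is left to sum in k: r <= s makes
    the sum over k subadditive, and each piece needs the embedding of L^q into
    the Besov space with q < s and q <= r, of Jawerth and Franke
    (jawerth_franke). The function is cut into layers {2^(m-1) <= g < 2^m},
    which are grouped according to the dyadic size 2^i of their measure; a
    group interacts with the frequency j through a geometric factor in |jn +
    i|. For s = oo one first lowers s to a finite exponent, since w_j * |f| is
    essentially constant at scale 2^(-j) (convw_sup_le).

    The fourth case forces s = q = r = 2 and alpha = s1 = 0. The claim is then
    the square function estimate sum_j ||psi_j * f||^2 <= c ||f||^2, which
    does need the mean zero property: the operators T_j T_k^t have norm
    O(2^(-|j-k|/2)), because one factor is smooth at the scale where the other
    one oscillates (ckern_orthogonal), and almost orthogonality follows by
    expanding a square (littlewood_paley). *)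

(** * Affine changes of variables *)

Section affine_1d.
Context {R : realType}.
Local Notation leb := (@lebesgue_measure R).

(** Both sides are measures in A which agree on half-open intervals. *)
Lemma lebesgue_measure_affine (c a : R) (A : set (measurableTypeR R)) : c != 0 -> measurable A ->
  leb A = (`|c|%:E * leb ((fun t : R => (c * t + a)%R) @^-1` A))%E.
Proof.
move=> c0 mA.
pose g : measurableTypeR R -> measurableTypeR R := fun t => c * t + a.
have mg : measurable_fun setT g.
  by apply: measurable_funD => //; exact: measurable_funM.
have n0 : 0 <= `|c| by [].
pose nu := mscale (NngNum n0) (pushforward leb g).
rewrite (_ : _ * _ = nu mg A)%E //.
apply: lebesgue_measure_unique => //= _ [[x y] _ <-] /=.
rewrite /mscale/= /pushforward/= /g.
have [xy|yx] := ltP x y; last first.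
  rewrite set_itv_ge ?bnd_simp -?leNgt// preimage_set0 !measure0 mule0//.
have [cgt|clt] := ltP 0 c.
  rewrite (_ : _ @^-1` _ = `](x - a) / c, (y - a) / c]%classic); last first.
    by apply/seteqP; split => t /=; rewrite !in_itv/= ler_pdivlMr// ltr_pdivrMr// ltrBlDr lerBrDr mulrC.
  rewrite !lebesgue_measure_itv/= !lte_fin xy ltr_pM2r ?invr_gt0// ltrD2r xy.
  rewrite gtr0_norm// -!EFinD -EFinM; congr EFin.
  by field.
have {}clt : c < 0 by rewrite lt_neqAle c0.
rewrite (_ : _ @^-1` _ = `[(y - a) / c, (x - a) / c[%classic); last first.
  by apply/seteqP; split => t /=; rewrite !in_itv/= ler_ndivrMr// ltr_ndivlMr// ltrBlDr lerBrDr mulrC andbC.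
rewrite !lebesgue_measure_itv/= !lte_fin xy ltr_nM2r ?invr_lt0// ltrD2r xy.
rewrite ltr0_norm// -!EFinD -EFinM; congr EFin.
by field.
Qed.

Lemma ge0_integral_affine1 (c a : R) (f : measurableTypeR R -> \bar R) : c != 0 ->
  measurable_fun setT f -> (forall x, 0 <= f x)%E ->
  (\int[leb]_x f x = `|c|%:E * \int[leb]_x f (c * x + a)%R)%E.
Proof.
move=> c0 mf f0.
pose g : measurableTypeR R -> measurableTypeR R := fun t => c * t + a.
have mg : measurable_fun setT g.
  by apply: measurable_funD => //; exact: measurable_funM.
have n0 : 0 <= `|c| by [].
pose nu := mscale (NngNum n0) (pushforward leb g).
rewrite (eq_measure_integral (nu mg)); last first.
  move=> A mA _; exact: (lebesgue_measure_affine a c0 mA).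
rewrite ge0_integral_mscale//=; congr (_ * _)%E.
by rewrite (ge0_integral_pushforward mg).
Qed.

End affine_1d.

Section rV_measure.
Context {R : realType}.
Local Notation leb := (@lebesgue_measure R).
Local Notation mu := (lebesgue_rV R).

Lemma ge0_integral_rVS n (f : 'rV[R]_n.+1 -> \bar R) :
  measurable_fun setT f -> (forall x, 0 <= f x)%E ->
  (\int[mu n.+1]_x f x = \int[leb]_t \int[mu n]_y f (rV_cons (t, y)))%E.
Proof.
move=> mf f0.
have mfc := measurableT_comp mf (@measurable_rV_cons R n).
transitivity (\int[(leb \x mu n)%E]_z f (rV_cons z))%E.
  exact: (ge0_integral_pushforward (@measurable_rV_cons R n)).
by rewrite fubini_tonelli1.
Qed.

Lemma measurable_rV_affine n (c : R) (a : 'rV[R]_n) :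
  measurable_fun setT (fun x : 'rV[R]_n => c *: x + a).
Proof.
apply: measurable_fun_rV => i; under eq_fun do rewrite !mxE.
apply: measurable_funD => //; apply: measurable_funM => //.
exact: measurable_rV_coord.
Qed.

(** By induction on the dimension, one coordinate being split off by Tonelli's
    theorem. *)
Lemma ge0_integral_rV_affine n (c : R) (a : 'rV[R]_n) (f : 'rV[R]_n -> \bar R) :
  c != 0 -> measurable_fun setT f -> (forall x, 0 <= f x)%E ->
  (\int[mu n]_x f x = (`|c| ^+ n)%:E * \int[mu n]_x f (c *: x + a)%R)%E.
Proof.
move=> c0; elim: n a f => [|n IH] a f mf f0.
  rewrite expr0 mul1e; apply: eq_integral => x _; congr f.
  by apply/rowP => -[].
have mg := measurableT_comp mf (measurable_rV_affine c a).
rewrite !ge0_integral_rVS//.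
have mfc := measurableT_comp mf (@measurable_rV_cons R n).
have E t : (\int[mu n]_y f (rV_cons (t, y)) = (`|c| ^+ n)%:E * \int[mu n]_y
    f (rV_cons (t, (c *: y + (rV_uncons a).2)%R)))%E.
  have mt : measurable_fun [set: 'rV[R]_n] (fun y => f (rV_cons (t, y))).
    exact: (measurableT_comp mfc (@measurable_pair1 _ _ _ _ _)).
  by rewrite (IH (rV_uncons a).2).
pose H (t : measurableTypeR R) := (\int[mu n]_y f (rV_cons (t, (c *: y + (rV_uncons a).2)%R)))%E.
have mH : measurable_fun setT H.
  apply: (measurable_fun_fubini_tonelli_F (m2 := mu n)
     (fun z : measurableTypeR R * 'rV[R]_n => f (rV_cons (z.1, (c *: z.2 + (rV_uncons a).2)%R)))) => //.
  apply: (measurableT_comp mfc); apply: measurable_fun_pair => //=.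
  apply: (measurableT_comp (measurable_rV_affine c _)) => //.
have H0 t : (0 <= H t)%E by apply: integral_ge0 => ? _.
under eq_integral => t _ do rewrite E -/(H t).
rewrite ge0_integralZl ?lee_fin ?exprn_ge0//.
rewrite (ge0_integral_affine1 (a ord0 ord0) c0 mH H0) muleA -EFinM -exprSr.
congr (_ * _)%E; apply: eq_integral => t _; apply: eq_integral => y _.
congr f; apply/rowP => i; rewrite !mxE.
by case: (unliftP ord0 i) => [j ->|->]; rewrite ?mxE ?liftK ?unlift_none.
Qed.

End rV_measure.

Section signed_change_of_variables.
Context {R : realType} {n : nat}.
Local Notation E := 'rV[R]_n.
Local Notation mu := (lebesgue_rV R n).
Implicit Types (x y a : E) (u f : E -> R).

Lemma integrable_rV_affine (c : R) a (F : E -> \bar R) : c != 0 ->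
  mu.-integrable setT F -> mu.-integrable setT (fun x => F (c *: x + a)).
Proof.
move=> c0 /integrableP[mF Foo]; apply/integrableP; split.
  by apply: measurableT_comp => //; exact: measurable_rV_affine.
have cn0 : 0 < `|c| ^+ n by rewrite exprn_gt0// normr_gt0.
move: Foo; rewrite (ge0_integral_rV_affine a c0)//; last exact: measurableT_comp.
by rewrite !ltey; apply: contraNN => /eqP ->; rewrite gt0_muley.
Qed.

Lemma integral_rV_affine (c : R) a (F : E -> \bar R) : c != 0 ->
  mu.-integrable setT F ->
  (\int[mu]_x F x = (`|c| ^+ n)%:E * \int[mu]_x F (c *: x + a)%R)%E.
Proof.
move=> c0 iF; have iF' := integrable_rV_affine a c0 iF.
have mF := measurable_int _ iF.
pose G x := F (c *: x + a).
have pE : (\int[mu]_x F^\+ x = (`|c| ^+ n)%:E * \int[mu]_x G^\+ x)%E.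
  rewrite (ge0_integral_rV_affine a c0 (measurable_funepos mF) (funepos_ge0 F)).
  by rewrite (funepos_comp F (fun x => c *: x + a)).
have nE : (\int[mu]_x F^\- x = (`|c| ^+ n)%:E * \int[mu]_x G^\- x)%E.
  rewrite (ge0_integral_rV_affine a c0 (measurable_funeneg mF) (funeneg_ge0 F)).
  by rewrite (funeneg_comp F (fun x => c *: x + a)).
rewrite integralE pE nE -muleBr//; first by rewrite -integralE.
by apply: fin_num_adde_defr; exact: (integrable_pos_fin_num measurableT iF').
Qed.

Lemma Rintegral_rV_affine (c : R) a f : c != 0 ->
  mu.-integrable setT (EFin \o f) ->
  \int[mu]_x f x = `|c| ^+ n * \int[mu]_x f (c *: x + a).
Proof.
move=> c0 iF; have iF' := integrable_rV_affine a c0 iF.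
rewrite /Rintegral (integral_rV_affine a c0 iF) fineM//.
exact: integrable_fin_num.
Qed.

End signed_change_of_variables.

(** * Borel sets and continuous functions on R^n *)

Section borel.
Context {R : realType}.

Lemma measurable_rV_ball n (c : 'rV[R]_n) (e : R) :
  measurable (ball c e : set 'rV[R]_n).
Proof.
rewrite (_ : ball c e = if 0 < e then
   \bigcap_(i in [set: 'I_n]) ((fun x : 'rV[R]_n => x ord0 i) @^-1` ball (c ord0 i) e) else set0); last first.
  case: ifPn => e0; apply/seteqP; split => x //=.
  - by case=> _ xe i _; exact: xe.
  - by move=> xe; split=> // i j; rewrite (ord1 i); exact: xe.
  - by case => e1; rewrite e1 in e0.
case: ifPn => // _; apply: fin_bigcap_measurable => // i _.
rewrite -[X in measurable X]setTI; apply: measurable_rV_coord => //.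
exact: measurable_ball.
Qed.

(** The measurable sets are generated by the coordinates, so that boxes are
    measurable; an open set is the union of the countably many sup-norm balls
    it contains which have a rational centre and a radius 1/(k+1). *)
Lemma open_rV_measurable n (U : set 'rV[R]_n) : open U -> measurable U.
Proof.
move=> oU.
pose c (q : 'rV[rat]_n) : 'rV[R]_n := map_mx ratr q.
pose F (m : nat) : set 'rV[R]_n :=
  if unpickle m is Some qk then
    let: (q, k) := (qk : 'rV[rat]_n * nat) in
    if `[< ball (c q) (k.+1%:R^-1 : R) `<=` U >] then ball (c q) (k.+1%:R^-1 : R) else set0
  else set0.
rewrite (_ : U = \bigcup_m F m); last first.
  apply/seteqP; split => [x Ux|x [m _]]; last first.
    rewrite /F; case: unpickle => // -[q k]; case: ifPn => // /asboolP; exact.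
  have /nbhs_ballP[e /= e0 xeU] := open_nbhs_nbhs (conj oU Ux).
  have [k ke] : exists k, k.+1%:R^-1 < e / 2.
    have e20 : 0 < e / 2 by rewrite divr_gt0.
    by have [k _ /(_ _ (leqnn k))] := near_infty_natSinv_lt (PosNum e20); exists k.
  have k0 : (0 : R) < k.+1%:R^-1 by rewrite invr_gt0.
  have H (i : 'I_n) : exists q : rat, x ord0 i - k.+1%:R^-1 < ratr q < x ord0 i + k.+1%:R^-1.
    have lt : x ord0 i - k.+1%:R^-1 < x ord0 i + k.+1%:R^-1.
      by rewrite ltrBlDr -addrA ltrDl addr_gt0.
    by have [q] := rat_in_itvoo lt; rewrite in_itv/= => xq; exists q.
  have /choice[g Hg] := H.
  pose q : 'rV[rat]_n := \row_i g i.
  have qx : ball (c q) (k.+1%:R^-1) x.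
    split => // i j; rewrite (ord1 i : i = ord0) /ball/= !mxE.
    move: (k.+1%:R^-1) (Hg j) => d /andP[h1 h2].
    by rewrite ltr_norml; apply/andP; split; lra.
  exists (pickle (q, k)) => //; rewrite /F pickleK; case: ifPn => // /asboolP; case.
  move=> y qy; apply: xeU.
  apply: (@le_ball _ _ _ (k.+1%:R^-1 + k.+1%:R^-1)); first by move: (k.+1%:R^-1) ke => d ke; lra.
  apply: ball_triangle qy; exact: ball_sym.
apply: bigcup_measurable => m _; rewrite /F.
case: unpickle => // -[q k]; case: ifPn => // _; exact: measurable_rV_ball.
Qed.

Lemma continuous_rV_measurable n (f : 'rV[R]_n -> R) : continuous f ->
  measurable_fun setT f.
Proof.
move=> cf; apply: (measurability _ (RGenOpens.measurableE R)) => _ [_ [a [b ->]] <-].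
rewrite setTI; apply: open_rV_measurable.
by move/continuousP : cf; apply; exact: interval_open.
Qed.

Lemma compact_rV_measurable n (K : set 'rV[R]_n) : compact K -> measurable K.
Proof.
move=> cK; have /closed_openC/open_rV_measurable : closed K.
  by apply: compact_closed => //; exact: norm_hausdorff.
by move/measurableC; rewrite setCK.
Qed.

Lemma measurable_rV_set1 n (x : 'rV[R]_n) : measurable [set x].
Proof. by apply: compact_rV_measurable; exact: compact_set1. Qed.

End borel.

(** * The Euclidean norm and the integrability of its inverse powers *)

Section eucl_norm_theory.
Context {R : realType} {n : nat}.
Implicit Types x y : 'rV[R]_n.
Local Notation mu := (lebesgue_rV R n).

Lemma eucl_norm_ge0 x : 0 <= eucl_norm x.
Proof. exact: sqrtr_ge0. Qed.
Hint Resolve eucl_norm_ge0 : core.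

Lemma sumsq_ge0 x : 0 <= \sum_i x ord0 i ^+ 2.
Proof. by apply: sumr_ge0 => i _; exact: sqr_ge0. Qed.
Hint Resolve sumsq_ge0 : core.

Lemma eucl_norm_sqr x : eucl_norm x ^+ 2 = \sum_i x ord0 i ^+ 2.
Proof. by rewrite sqr_sqrtr. Qed.

Lemma eucl_normZ c x : eucl_norm (c *: x) = `|c| * eucl_norm x.
Proof.
rewrite /eucl_norm; under eq_bigr do rewrite mxE exprMn.
by rewrite -mulr_sumr sqrtrM ?sqr_ge0// sqrtr_sqr.
Qed.

Lemma eucl_normN x : eucl_norm (- x) = eucl_norm x.
Proof. by rewrite -scaleN1r eucl_normZ normrN1 mul1r. Qed.

Lemma eucl_norm0 : eucl_norm (0 : 'rV[R]_n) = 0.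
Proof. by rewrite -[X in eucl_norm X](scale0r 0) eucl_normZ normr0 mul0r. Qed.

Lemma abs_coord_le x i : `|x ord0 i| <= eucl_norm x.
Proof.
rewrite -sqrtr_sqr ler_wsqrtr// (bigD1 i)//= lerDl.
by apply: sumr_ge0 => j _; exact: sqr_ge0.
Qed.

Lemma eucl_norm_eq0 x : eucl_norm x = 0 -> x = 0.
Proof.
move=> x0; apply/rowP => i; rewrite mxE; apply/eqP.
by rewrite -normr_le0 -x0 abs_coord_le.
Qed.

Lemma eucl_norm_le_sum x : eucl_norm x <= \sum_i `|x ord0 i|.
Proof.
have s0 : 0 <= \sum_i `|x ord0 i| by apply: sumr_ge0.
rewrite -(ger0_norm s0) -sqrtr_sqr ler_wsqrtr// expr2 mulr_suml.
apply: ler_sum => i _; rewrite -real_normK ?num_real// expr2 ler_wpM2l//.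
by rewrite (bigD1 i)//= lerDl sumr_ge0.
Qed.

(** Lagrange's identity: twice the difference of the squares is the sum of the
    squares (x_i y_j - x_j y_i)^2. *)
Lemma dotp_le x y : `|dotp x y| <= eucl_norm x * eucl_norm y.
Proof.
rewrite -(ger0_norm (mulr_ge0 (eucl_norm_ge0 x) (eucl_norm_ge0 y))) -!sqrtr_sqr.
rewrite ler_wsqrtr// exprMn !eucl_norm_sqr /dotp expr2.
suff : 2 * ((\sum_i x ord0 i * y ord0 i) * (\sum_i x ord0 i * y ord0 i)) <=
  2 * ((\sum_i x ord0 i ^+ 2) * (\sum_i y ord0 i ^+ 2)) by rewrite ler_pM2l.
rewrite mulr2n !mulrDl !mul1r [X in _ <= X + _]mulrC.
rewrite !big_distrlr/=.
rewrite -!big_split/=; apply: ler_sum => i _; rewrite -!big_split/=.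
apply: ler_sum => j _; rewrite -subr_ge0.
rewrite (_ : _ - _ = (x ord0 i * y ord0 j - x ord0 j * y ord0 i)^+2) ?sqr_ge0//.
by ring.
Qed.

Lemma eucl_norm_triangle x y : eucl_norm (x + y) <= eucl_norm x + eucl_norm y.
Proof.
rewrite -(ger0_norm (addr_ge0 (eucl_norm_ge0 x) (eucl_norm_ge0 y))) -sqrtr_sqr.
rewrite ler_wsqrtr// sqrrD !eucl_norm_sqr.
under eq_bigr do rewrite mxE sqrrD.
rewrite !big_split/= lerD2r lerD2l.
by rewrite lerD// (le_trans (ler_norm _) (dotp_le x y)).
Qed.

Lemma measurable_eucl_norm : measurable_fun setT (eucl_norm : 'rV[R]_n -> R).
Proof.
apply: (measurableT_comp (f := @Num.sqrt R)).
  apply: continuous_measurable_fun; exact: sqrt_continuous.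
apply: measurable_sum => i; apply: measurable_funX; exact: measurable_rV_coord.
Qed.

Lemma measurable_eucl_ball (r : R) : measurable [set x : 'rV[R]_n | eucl_norm x < r].
Proof.
rewrite (_ : [set x | _] = setT `&` eucl_norm @^-1` `]-oo, r[%classic).
  exact: measurable_eucl_norm.
by rewrite setTI; apply/seteqP; split => x /=; rewrite in_itv.
Qed.

Lemma lebesgue_rV_eucl_ball (r : R) : 0 <= r ->
  (mu [set x | eucl_norm x < r]%R <= ((2 * r) ^+ n)%:E)%E.
Proof.
move=> r0.
have /= := @lebesgue_rV_box R n (const_mx (- r) : 'rV_n) (const_mx r : 'rV_n).
rewrite (_ : \prod_i _ = (2 * r) ^+ n); last first.
  rewrite -[n in RHS](card_ord n) -prodr_const; apply: eq_bigr => i _.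
  by rewrite !mxE opprK mulrDl mul1r.
move=> <-; last by move=> i; rewrite !mxE ge0_cp.
apply: le_measure; rewrite ?inE.
- exact: measurable_eucl_ball.
- rewrite (_ : mkset _ = \bigcap_(i in [set: 'I_n])
    ((fun x : 'rV[R]_n => x ord0 i) @^-1` `]- r, r])); last first.
    apply/seteqP; split => [x xuv i _ /=|x xuv i]; first by have := xuv i; rewrite in_itv/= !mxE.
    by have := xuv i Logic.I; rewrite /= in_itv !mxE.
  apply: fin_bigcap_measurable => // i _.
  by rewrite -[X in measurable X]setTI; exact: measurable_rV_coord.
- move=> x /= xr i; have := le_lt_trans (abs_coord_le x i) xr.
  by rewrite !mxE ltr_norml => /andP[-> /ltW].
Qed.

End eucl_norm_theory.
#[global] Hint Extern 0 (is_true (0 <= eucl_norm _)) => solve [exact: eucl_norm_ge0] : core.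
#[global] Hint Extern 0 (is_true (0 <= 1 + eucl_norm _)) => solve [exact: addr_ge0 ler01 (eucl_norm_ge0 _)] : core.

Section tail.
Context {R : realType}.
Variable n : nat.
Local Notation mu := (lebesgue_rV R n).

(** The smallest k works; it lets the series of the indicators of the balls of
    radius 2^k stand for a function of |x|. *)
Lemma eucl_dyadic_cover (x : 'rV[R]_n) :
  exists k : nat, eucl_norm x < 2 ^+ k /\ 2 ^+ k <= 2 * (1 + eucl_norm x).
Proof.
have [x1|x1] := ltP (eucl_norm x) 1.
  by exists 0%N; rewrite expr0; split => //; have := eucl_norm_ge0 x; lra.
have [m mx] : exists m, eucl_norm x < 2 ^+ m.
  exists (Num.bound (eucl_norm x)).
  apply: lt_le_trans (_ : (Num.bound (eucl_norm x))%:R <= _).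
    by apply: archi_boundP; exact: eucl_norm_ge0.
  by rewrite -[leRHS]/(2%:R ^+ _) -natrX ler_nat ltnW// ltn_expl.
have [k xk km] := ex_minnP (ex_intro (fun m => eucl_norm x < 2 ^+ m) m mx).
exists k; split => //; case: k xk km => [|k] xk km.
  by rewrite expr0 in xk; lra.
rewrite exprS ler_pM2l//; have [h|h] := ltP (eucl_norm x) (2 ^+ k).
  by have := km _ h; rewrite ltnn.
by lra.
Qed.

Lemma measurable_tail (N : nat) :
  measurable_fun setT (fun x : 'rV[R]_n => ((1 + eucl_norm x) ^- N)).
Proof.
pose h (t : R) := (1 + `|t|) ^- N.
rewrite (_ : (fun _ => _) = h \o eucl_norm); last first.
  by apply/funext => x; rewrite /h/= ger0_norm.
apply: measurableT_comp; last exact: measurable_eucl_norm.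
apply: continuous_measurable_fun => t; apply: cvgV.
  by rewrite expf_neq0// gt_eqF// ltr_wpDr.
apply: (@cvg_comp _ _ _ (fun t : R => 1 + `|t|) (fun t => t ^+ N)).
  by apply: cvgD; [exact: cvg_cst|exact: norm_continuous].
exact: exprn_continuous.
Qed.

(** The integrand is at most the sum over k of 2^(-(k-1)(n+1)) on the ball of
    radius 2^k, whose measure is at most 2^((k+1)n): the k-th term contributes
    O(2^(-k)). *)
Lemma integral_tail_fin : exists2 C : R, 0 < C &
  (\int[mu]_x ((1 + eucl_norm x) ^- n.+1)%:E <= C%:E)%E.
Proof.
exists (2 ^+ n.+1 * 2 ^+ n * 2) => //.
pose g k (x : 'rV[R]_n) : \bar R := (2 ^+ n.+1 * 2 ^- (k * n.+1) * \1_[set x | eucl_norm x < 2 ^+ k] x)%:E.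
have g0 k x : (0 <= g k x)%E.
  by rewrite lee_fin !mulr_ge0 ?invr_ge0 ?exprn_ge0.
have mg k : measurable_fun setT (g k).
  apply/measurable_EFinP/measurable_funM => //.
  by apply: measurable_indic; exact: measurable_eucl_ball.
apply: (@le_trans _ _ (\int[mu]_x (\sum_(0 <= k <oo) g k x)))%E.
  apply: ge0_le_integral => //.
  - by move=> x _; rewrite lee_fin invr_ge0 exprn_ge0// addr_ge0.
  - by apply/measurable_EFinP; exact: measurable_tail.
  - by apply: ge0_emeasurable_sum.
  move=> x _; have [k [xk kx]] := eucl_dyadic_cover x.
  rewrite (@nneseriesD1 _ _ k xpredT)//; apply: (@le_trans _ _ (g k x)); last first.
    by rewrite leeDl// nneseries_ge0.
  rewrite lee_fin indicE mem_set//= mulr1 -exprVn exprM -exprVn -exprMn.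
  rewrite lerXn2r ?nnegrE ?mulr_ge0 ?invr_ge0 ?exprn_ge0 ?addr_ge0// exprVn.
  rewrite -[leRHS]invrK invfM invrK lef_pV2 ?posrE.
  - by rewrite ler_pdivrMl.
  - by rewrite ltr_wpDr.
  - by rewrite mulr_gt0 ?invr_gt0 ?exprn_gt0.
rewrite integral_nneseries//.
apply: (@le_trans _ _ (\sum_(0 <= k <oo) (2 ^+ n.+1 * 2 ^+ n * (2^-1)^+k)%:E))%E.
  apply: lee_nneseries => [k *|k *]; first exact: integral_ge0.
  rewrite /g; under eq_integral do rewrite EFinM.
  rewrite ge0_integralZl//=.
  - rewrite integral_indic// ?setIT; last exact: measurable_eucl_ball.
    apply: (le_trans (lee_wpmul2l _ (@lebesgue_rV_eucl_ball _ _ (2^+k) _))).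
      by rewrite lee_fin mulr_ge0 ?invr_ge0 ?exprn_ge0.
      by rewrite exprn_ge0.
    rewrite -EFinM lee_fin exprMn -(exprM 2 k n) -exprVn exprVn.
    rewrite mulnS exprD invfM.
    have h : (2 : R) ^+ (k * n) != 0 by rewrite expf_neq0// pnatr_eq0.
    have h2 : (2 : R) ^+ k != 0 by rewrite expf_neq0// pnatr_eq0.
    rewrite le_eqVlt; apply/orP; left; apply/eqP.
    by rewrite exprVn; move: (2 ^+ (k * n)) (2 ^+ k) h h2 => a b a0 b0; field; rewrite a0 b0.
  - apply/measurable_EFinP; apply: measurable_indic; exact: measurable_eucl_ball.
apply: lime_le => //.
  by apply: is_cvg_nneseries => k _ _; rewrite lee_fin !mulr_ge0 ?invr_ge0 ?exprn_ge0.
apply: nearW => m; rewrite sumEFin lee_fin.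
have h2 : `|2^-1 : R| < 1 by rewrite ger0_norm ?invr_ge0// invf_lt1// ltr1n.
have := @geometric_le_lim R m (2 ^+ n.+1 * 2 ^+ n) 2^-1 _ _ h2.
rewrite /series/= (_ : (1 - 2^-1)^-1 = 2); last by field.
by apply; rewrite ?mulr_ge0 ?exprn_ge0 ?invr_gt0.
Qed.
End tail.

(** * Powers and sums of extended reals *)

Local Open Scope ereal_scope.

Section poweR_extra.
Context {R : realType}.
Implicit Types (x y : \bar R) (t : R).

Lemma le_poweR t x y : (0 <= t)%R -> 0 <= x -> x <= y -> x `^ t <= y `^ t.
Proof.
move=> t0 x0 xy; apply: gt0_ler_poweR => //; rewrite in_itv/= leey andbT//.
exact: le_trans xy.
Qed.

Lemma poweRVK t x : (0 < t)%R -> 0 <= x -> (x `^ t^-1) `^ t = x.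
Proof. by move=> t0 x0; rewrite -poweRrM mulVf ?gt_eqF// poweRe1. Qed.

Lemma poweRKV t x : (0 < t)%R -> 0 <= x -> (x `^ t) `^ t^-1 = x.
Proof. by move=> t0 x0; rewrite -poweRrM mulfV ?gt_eqF// poweRe1. Qed.

Lemma poweR_le_inv t x y : (0 < t)%R -> 0 <= x -> x `^ t <= y -> x <= y `^ t^-1.
Proof.
by move=> t0 x0 xy; rewrite -(poweRKV t0 x0) le_poweR ?invr_ge0 ?(ltW t0) ?poweR_ge0.
Qed.

(** The quasi-triangle inequality; the constant 2^t covers the exponents below
    one as well. *)
Lemma poweRD_le t x y : (0 < t)%R -> 0 <= x -> 0 <= y ->
  (x + y) `^ t <= (2 `^ t)%:E * (x `^ t + y `^ t).
Proof.
move=> t0.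
wlog xy : x y / x <= y => [H x0 y0|x0 y0].
  have [xy|/ltW yx] := leP x y; first exact: H.
  by rewrite addeC [X in _ * X]addeC H.
apply: (@le_trans _ _ ((2%:E * y) `^ t)).
  apply: le_poweR; [exact: ltW|exact: adde_ge0|].
  by rewrite mule_natl mule2n leeD2r.
by rewrite poweRM ?lee_fin// poweR_EFin lee_wpmul2l ?lee_fin ?powR_ge0// leeDr// poweR_ge0.
Qed.

End poweR_extra.

Section esum_extra.
Context {R : realType}.

Lemma esum_ge_term (I : choiceType) (a : I -> \bar R) i :
  (forall i, 0 <= a i) -> a i <= \esum_(i in [set: I]) a i.
Proof.
move=> a0; rewrite (esumID [set i])//= setTI esum_set1//.
by rewrite leeDl// esum_ge0.
Qed.

Lemma esumZ_le (I : choiceType) (c : R) (a : I -> \bar R) : (0 <= c)%R ->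
  (forall i, 0 <= a i) ->
  \esum_(i in [set: I]) (c%:E * a i) <= c%:E * \esum_(i in [set: I]) a i.
Proof.
move=> c0 a0; apply: ub_ereal_sup => _ [X [fX _] <-].
rewrite -ge0_mule_fsumr//; apply: lee_wpmul2l; first by rewrite lee_fin.
by apply: ereal_sup_ubound; exists X.
Qed.

Lemma esumZ (I : choiceType) (c : R) (a : I -> \bar R) : (0 <= c)%R ->
  (forall i, 0 <= a i) ->
  \esum_(i in [set: I]) (c%:E * a i) = c%:E * \esum_(i in [set: I]) a i.
Proof.
rewrite le_eqVlt => /predU1P[<- a0|c0 a0].
  by rewrite mul0e esum1// => i _; rewrite mul0e.
apply/le_anti/andP; split; first by rewrite esumZ_le// ltW.
rewrite -lee_pdivlMl//.
apply: le_trans (esumZ_le _ _); last 2 first.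
- by rewrite invr_ge0 ltW.
- by move=> i; rewrite mule_ge0// lee_fin ltW.
by apply: le_esum => i _; rewrite muleA -EFinM mulVf ?gt_eqF// mul1e.
Qed.

Lemma exchange_esum (I J : choiceType) (a : I -> J -> \bar R) :
  (forall i j, 0 <= a i j) ->
  \esum_(i in [set: I]) \esum_(j in [set: J]) a i j =
  \esum_(j in [set: J]) \esum_(i in [set: I]) a i j.
Proof.
move=> a0; rewrite !esum_esum//.
rewrite (reindex_esum ([set: J] `*`` (fun=> [set: I])) _ (fun ji => (ji.2, ji.1)))//.
split=> //=; first by move=> [i j] [j' i'] _ _ /= [-> ->].
by move=> [i j] _; exists (j, i).
Qed.

Lemma esum_le_inj (J I : choiceType) (phi : J -> I) (a : I -> \bar R) : injective phi ->
  (forall i, 0 <= a i) ->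
  \esum_(j in [set: J]) a (phi j) <= \esum_(i in [set: I]) a i.
Proof.
move=> iphi a0; rewrite -(@esum_image _ _ _ setT phi a); last by move=> x y _ _; exact: iphi.
by rewrite [leRHS](esumID (phi @` setT))//= setTI leeDl// esum_ge0.
Qed.

Let cnt (I : countType) (i0 : I) (m : nat) : I := odflt i0 (pickle_inv m).
Let cntP (I : countType) (m : nat) : bool := isSome (@pickle_inv I m).

(** Transfers to sums over a countable type the theorems on series, such as
    measurability and monotone convergence. *)
Lemma esum_count (I : countType) (i0 : I) (a : I -> \bar R) :
  (forall i, 0 <= a i) ->
  \esum_(i in [set: I]) a i = \sum_(0 <= m <oo | cntP I m) a (cnt i0 m).
Proof.
move=> a0; rewrite -esum_pred_image//; last first.
  move=> m1 m2; rewrite !inE /cntP /cnt/= => h1 h2.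
  have := @pickle_invK I m1; have := @pickle_invK I m2.
  by case: pickle_inv h2 => // i2 _; case: pickle_inv h1 => //= i1 _ /= <- <- ->.
congr esum; apply/esym/seteqP; split => // i _ /=.
by exists (pickle i); rewrite /cntP /cnt/= pickleK_inv.
Qed.

Section integral_esum.
Context d (T : measurableType d) (mu : {measure set T -> \bar R}).
Variables (I : countType) (h : I -> T -> \bar R).
Hypothesis mh : forall i, measurable_fun setT (h i).
Hypothesis h0 : forall i x, 0 <= h i x.

Lemma measurable_fun_esum : measurable_fun setT (fun x => \esum_(i in [set: I]) h i x).
Proof.
have [i0|noI] := pselect (exists i0 : I, True); last first.
  rewrite (_ : (fun _ => _) = cst 0) //; apply/funext => x.
  by apply: esum1 => i; case: noI; exists i.
case: i0 => i0 _.
under eq_fun do rewrite (esum_count i0)// eseries_mkcond.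
apply: (@ge0_emeasurable_sum _ _ _ _ (fun m x => if cntP I m then h (cnt i0 m) x else 0) xpredT) => [m x _ _|m _]; by case: (cntP I m).
Qed.

Lemma integral_esum : \int[mu]_x (\esum_(i in [set: I]) h i x) =
  \esum_(i in [set: I]) \int[mu]_x h i x.
Proof.
have [i0|noI] := pselect (exists i0 : I, True); last first.
  rewrite esum1; last by move=> i; case: noI; exists i.
  rewrite (eq_integral (cst 0)) ?integral0// => x _.
  by apply: esum1 => i; case: noI; exists i.
case: i0 => i0 _.
under eq_integral do rewrite (esum_count i0)// eseries_mkcond.
rewrite integral_nneseries//; last 2 first.
- by move=> m; case: (cntP I m).
- by move=> m x _; case: (cntP I m).
rewrite (esum_count i0); last by move=> i; exact: integral_ge0.
rewrite [RHS]eseries_mkcond; apply: eq_eseriesr => m _.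
by case: ifPn => // _; rewrite integral0.
Qed.
End integral_esum.

End esum_extra.

Section power_sums.
Context {R : realType}.

(** Divide by S, the sum of the y_i: then y_i^t <= S^(t-1) y_i. *)
Lemma esum_poweR_le (I : choiceType) (t : R) (y : I -> \bar R) : (1 <= t)%R ->
  (forall i, 0 <= y i) ->
  \esum_(i in [set: I]) (y i `^ t) <= (\esum_(i in [set: I]) y i) `^ t.
Proof.
move=> t1 y0; have t0 : (0 < t)%R by rewrite (lt_le_trans _ t1).
set S := \esum_(i in [set: I]) y i; have S0 : 0 <= S by apply: esum_ge0.
have [->|Soo] := eqVneq S +oo; first by rewrite poweRyr ?gt_eqF// leey.
have yS i : y i <= S by exact: esum_ge_term.
case ES : S S0 Soo => [s| |]// s0 _.
have fy i : y i \is a fin_num by rewrite ge0_fin_numE// (le_lt_trans (yS i))// ES ltry.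
have tm1 : (0 <= t - 1)%R by rewrite subr_ge0.
apply: (@le_trans _ _ (\esum_(i in setT) ((s `^ (t - 1))%:E * y i))).
  apply: le_esum => i _; have := yS i; rewrite ES -(fineK (fy i)) lee_fin => h.
  rewrite poweR_EFin -EFinM lee_fin -(mulr_powRB1 _ t0) ?fine_ge0// mulrC.
  rewrite ler_wpM2r ?fine_ge0// ge0_ler_powR// ?nnegrE ?fine_ge0//.
rewrite esumZ ?powR_ge0// -/S ES poweR_EFin -EFinM lee_fin mulrC mulr_powRB1//.
Qed.

Lemma esum_poweR_ge (I : choiceType) (t : R) (y : I -> \bar R) : (0 < t <= 1)%R ->
  (forall i, 0 <= y i) ->
  (\esum_(i in [set: I]) y i) `^ t <= \esum_(i in [set: I]) (y i `^ t).
Proof.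
move=> /andP[t0 t1] y0.
have ti : (1 <= t^-1)%R by rewrite invf_ge1.
have H := esum_poweR_le ti (fun i => poweR_ge0 (y i) t).
rewrite -[leRHS](@poweRVK _ t); [|by []|by apply: esum_ge0 => *; exact: poweR_ge0].
apply: le_poweR; [exact: ltW|exact: esum_ge0|].
by apply: le_trans H; apply: le_esum => i _; rewrite poweRKV.
Qed.

(** If M is the sum on the right then u_i <= (M / k_i)^(1/t). A summable loss
    k_i^(-1/t) thus plays the part of the Hoelder or subadditivity argument,
    for all t > 0 at once. *)
Lemma esum_weighted (I : choiceType) (t W : R) (k : I -> R) (u : I -> \bar R) :
  (0 < t)%R -> (0 < W)%R -> (forall i, 0 < k i)%R -> (forall i, 0 <= u i) ->
  \esum_(i in [set: I]) (k i `^ (- t^-1))%:E <= W%:E ->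
  (\esum_(i in [set: I]) u i) `^ t <=
    (W `^ t)%:E * \esum_(i in [set: I]) ((k i)%:E * u i `^ t).
Proof.
move=> t0 W0 k0 u0 kW.
set M := esum _ (fun i => _ * _).
have ku0 i : 0 <= (k i)%:E * u i `^ t by rewrite mule_ge0 ?poweR_ge0// lee_fin ltW.
have M0 : 0 <= M by rewrite esum_ge0.
case EM : M M0 => [m| |]// m0; last first.
  by rewrite gt0_muley ?leey// lte_fin powR_gt0.
have uM i : u i <= ((k i `^ (- t^-1)) * m `^ t^-1)%:E.
  have : (k i)%:E * u i `^ t <= m%:E by rewrite -EM; exact: esum_ge_term.
  rewrite -lee_pdivlMl// -EFinM => /(poweR_le_inv t0 (u0 i)) h.
  apply: (le_trans h); rewrite poweR_EFin lee_fin powRM ?invr_ge0 ?(ltW (k0 i))//.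
  by rewrite -(powR_inv1 (ltW (k0 i))) -powRrM mulN1r.
rewrite -[leRHS](@poweRVK _ t)//; last by rewrite mule_ge0// lee_fin powR_ge0.
apply: le_poweR; [exact: ltW|exact: esum_ge0|].
rewrite -EFinM poweR_EFin powRM ?powR_ge0// -powRrM mulfV ?gt_eqF// powRr1 ?(ltW W0)//.
apply: (@le_trans _ _ (\esum_(i in setT) ((m `^ t^-1)%:E * (k i `^ (- t^-1))%:E))).
  by apply: le_esum => i _; rewrite -EFinM mulrC.
rewrite esumZ ?powR_ge0//; last by move=> i; rewrite lee_fin powR_ge0.
by rewrite mulrC EFinM lee_wpmul2l// lee_fin powR_ge0.
Qed.

Lemma esum_geometric_nat (c : R) : (0 < c < 1)%R ->
  \esum_(k in [set: nat]) (c ^+ k)%:E <= ((1 - c)^-1)%:E.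
Proof.
move=> /andP[c0 c1]; rewrite -nneseries_esumT; last by move=> k; rewrite lee_fin exprn_ge0// ltW.
apply: lime_le.
  by apply: is_cvg_nneseries => k _ _; rewrite lee_fin exprn_ge0// ltW.
apply: nearW => m; rewrite sumEFin lee_fin.
have h2 : (`|c| < 1)%R by rewrite ger0_norm// ltW.
have := @geometric_le_lim R m 1 c ler01 c0 h2.
by rewrite mul1r /series/=; under eq_bigr do rewrite mul1r.
Qed.

Lemma esum_geometric_int (c : R) : (0 < c < 1)%R ->
  exists2 W : R, (0 < W)%R & forall i0 : int,
  \esum_(i in [set: int]) (c ^+ absz (i - i0)%R)%:E <= W%:E.
Proof.
move=> c01; have /andP[c0 c1] := c01.
exists (2 * (1 - c)^-1)%R => [|i0]; first by rewrite mulr_gt0// invr_gt0 subr_gt0.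
have p0 k : 0 <= (c ^+ k)%:E by rewrite lee_fin exprn_ge0// ltW.
rewrite (reindex_esum [set: int] _ (fun i => i + i0)%R); last first.
  split=> //=; first by move=> i j _ _; exact: addIr.
  by move=> i _; exists (i - i0)%R => //; rewrite subrK.
under eq_esum do rewrite addrK.
rewrite (esumID (range Posz))// mulr2n mulrDl mul1r EFinD !setTI; apply: leeD.
  rewrite esum_image; last by move=> i j _ _ [].
  exact: esum_geometric_nat.
rewrite (_ : ~` _ = range Negz); last first.
  by apply/seteqP; split => [[k|k]/= h|_ [k _ <-] [m _]]//; [case: h; exists k|exists k].
rewrite esum_image; last by move=> i j _ _ [].
apply: le_trans (esum_geometric_nat c01); apply: le_esum => k _ /=.
by rewrite lee_fin exprS ger_pMl ?exprn_gt0// ltW.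
Qed.

(** The kernel is used twice: its half power pays for esum_weighted, the other
    half is summed over j. *)
Lemma esum_geometric_conv (J : choiceType) (phi : J -> int) (t c : R) :
  injective phi -> (0 < t)%R -> (0 < c < 1)%R ->
  exists2 C : R, (0 < C)%R & forall A : int -> \bar R, (forall k, 0 <= A k) ->
  \esum_(j in [set: J]) ((\esum_(k in [set: int]) ((c ^+ absz (phi j - k)%R)%:E * A k)) `^ t)
    <= C%:E * \esum_(k in [set: int]) (A k `^ t).
Proof.
move=> iphi t0 c01; have /andP[c0 c1] := c01.
pose c' := (c `^ (t / 2))%R.
have tt : (0 < t / 2)%R by rewrite divr_gt0.
have pc (s : R) : (0 < s)%R -> (0 < c `^ s < 1)%R.
  move=> s0; rewrite powR_gt0//=.
  have := @gt0_ltr_powR R s s0 c 1%R; rewrite powR1; apply; rewrite ?nnegrE// ltW//.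
have c'01 : (0 < c' < 1)%R by exact: pc.
have c''01 : (0 < c `^ (1 / 2) < 1)%R by apply: pc; rewrite divr_gt0.
have [W W0 HW] := esum_geometric_int c''01.
have [V V0 HV] := esum_geometric_int c'01.
exists (W `^ t * V)%R => [|A A0]; first by rewrite mulr_gt0// powR_gt0.
have cE (s : R) m : ((c ^+ m) `^ s = (c `^ s) ^+ m)%R.
  by rewrite -(powR_mulrn m (ltW c0)) -(powR_mulrn m (powR_ge0 c s)) -!powRrM mulrC.
pose w j k : R := ((c `^ (- t / 2)) ^+ absz (phi j - k)%R)%R.
have w0 j k : (0 < w j k)%R by rewrite exprn_gt0// powR_gt0.
have u0 j k : 0 <= (c ^+ absz (phi j - k)%R)%:E * A k.
  by rewrite mule_ge0// lee_fin exprn_ge0// ltW.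
apply: (@le_trans _ _ (\esum_(j in [set: J]) ((W `^ t)%:E * \esum_(k in [set: int]) ((c' ^+ absz (phi j - k)%R)%:E * A k `^ t)))).
  apply: le_esum => j _.
  apply: le_trans (@esum_weighted _ t W (w j) _ t0 W0 (w0 j) (u0 j) _) _.
    apply: le_trans (HW (phi j)); apply: le_esum => k _; rewrite lee_fin /w.
    rewrite -[X in (X `^ _)%R]powR_mulrn ?powR_ge0// -!powRrM -[leRHS]powR_mulrn ?powR_ge0// -powRrM.
    rewrite distnC le_eqVlt; apply/orP; left; apply/eqP; congr (_ `^ _)%R.
    by field; rewrite gt_eqF.
  rewrite lee_wpmul2l ?lee_fin ?powR_ge0//; apply: le_esum => k _.
  rewrite poweRM//; last by rewrite lee_fin exprn_ge0// ltW.
  rewrite muleA poweR_EFin -EFinM cE /w -exprMn -powRD; last by rewrite (gt_eqF c0) implybT.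
  rewrite (_ : (- t / 2 + t = t / 2)%R)//; by field.
have v0 j k : 0 <= (c' ^+ absz (phi j - k)%R)%:E * A k `^ t.
  by rewrite mule_ge0 ?poweR_ge0// lee_fin exprn_ge0// ltW// powR_gt0.
rewrite esumZ ?powR_ge0//; last by move=> j; rewrite esum_ge0.
rewrite EFinM -muleA lee_wpmul2l ?lee_fin ?powR_ge0//.
rewrite exchange_esum// -esumZ ?(ltW V0)//; last by move=> k; exact: poweR_ge0.
apply: le_esum => k _.
case EA : (A k `^ t) (poweR_ge0 (A k) t) => [a| |]// a0; last first.
  by rewrite gt0_muley// leey.
under eq_esum do rewrite muleC.
rewrite esumZ//; last by move=> j; rewrite lee_fin exprn_ge0// ltW// powR_gt0.
rewrite muleC lee_wpmul2r//.
apply: le_trans (HV k).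
apply: (@esum_le_inj _ _ _ phi (fun i => (c' ^+ absz (i - k)%R)%:E)) => // i.
by rewrite lee_fin exprn_ge0// ltW// powR_gt0.
Qed.

End power_sums.

(** * Convolution with the majorants w_j *)

Section power_mean.
Context d (T : measurableType d) {R : realType} (mu : {measure set T -> \bar R}).

(** Hoelder's inequality for the measure w mu, up to a factor. Pointwise g <=
    l + l^(1-p) g^p for every level l > 0; integrate and choose l optimally.
    *)
Lemma power_mean (p W : R) (w : T -> R) (g : T -> \bar R) : (1 <= p)%R -> (0 < W)%R ->
  measurable_fun setT w -> (forall x, 0 <= w x)%R ->
  measurable_fun setT g -> (forall x, 0 <= g x) ->
  \int[mu]_x (w x)%:E <= W%:E ->
  (\int[mu]_x ((w x)%:E * g x)) `^ p <=
    (2 `^ p * W `^ (p - 1))%:E * \int[mu]_x ((w x)%:E * g x `^ p).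
Proof.
move=> p1 W0 mw w0 mg g0 wW.
have p0 : (0 < p)%R by rewrite (lt_le_trans _ p1).
have mwE : measurable_fun setT (fun x => (w x)%:E) by exact/measurable_EFinP.
have mgp : measurable_fun setT (fun x => g x `^ p).
  exact: (measurableT_comp (measurable_poweR p) mg).
have I0 : 0 <= \int[mu]_x ((w x)%:E * g x `^ p).
  by apply: integral_ge0 => x _; rewrite mule_ge0 ?lee_fin ?poweR_ge0.
have cst0 : (0 < 2 `^ p * W `^ (p - 1))%R by rewrite mulr_gt0// powR_gt0.
case E : (\int[mu]_x ((w x)%:E * g x `^ p)) I0 => [G| |]// G0; last first.
  by rewrite gt0_muley// leey.
rewrite lee_fin in G0.
suff H (G' : R) : (G < G')%R -> \int[mu]_x ((w x)%:E * g x) <=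
    (2 * (W `^ (1 - p^-1) * G' `^ p^-1))%:E.
  apply/lee_addgt0Pr => e e0.
  pose e' := (e / (2 `^ p * W `^ (p - 1)))%R.
  have e'0 : (0 < e')%R by rewrite divr_gt0.
  have GG' : (G < G + e')%R by rewrite ltrDl.
  have G'0 : (0 <= G + e')%R by rewrite addr_ge0// ltW.
  apply: (@le_trans _ _ ((2 * (W `^ (1 - p^-1) * (G + e') `^ p^-1))%:E `^ p)).
    apply: le_poweR (H _ GG'); [exact: ltW|].
    by apply: integral_ge0 => x _; rewrite mule_ge0 ?lee_fin.
  rewrite poweR_EFin -EFinM -EFinD lee_fin !powRM ?mulr_ge0 ?powR_ge0//.
  rewrite -!powRrM mulVf ?gt_eqF// powRr1// mulrBl mul1r mulVf ?gt_eqF//.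
  rewrite mulrA mulrDr lerD2l /e' mulrC divfK// gt_eqF//.
move=> GG'; have G'0 : (0 < G')%R by rewrite (le_lt_trans G0).
pose l := ((G' / W) `^ p^-1)%R.
have l0 : (0 < l)%R by rewrite powR_gt0// divr_gt0.
have gl x : g x <= l%:E + (l `^ (1 - p))%:E * g x `^ p.
  have := g0 x; case: (g x) => [y| |]// y0; last first.
    by rewrite poweRyr ?gt_eqF// gt0_muley ?leey// lte_fin powR_gt0.
  rewrite lee_fin in y0; rewrite poweR_EFin -EFinM -EFinD lee_fin.
  have [yl|ly] := leP y l; first by rewrite ler_wpDr// mulr_ge0 ?powR_ge0.
  have yy0 : (0 < y)%R by rewrite (lt_trans l0).
  rewrite ler_wpDl ?(ltW l0)//.
  rewrite -[leLHS](@powRr1 _ y)// (_ : y `^ 1 = y `^ (1 - p) * y `^ p)%R; last first.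
    by rewrite -powRD ?subrK// (gt_eqF yy0) implybT.
  rewrite ler_wpM2r ?powR_ge0// -opprB !powRN lef_pV2 ?posrE ?(powR_gt0 _ l0) ?(powR_gt0 _ yy0)//.
  by rewrite ge0_ler_powR ?subr_ge0 ?nnegrE ?(ltW l0)// ltW.
apply: (@le_trans _ _ (\int[mu]_x (l%:E * (w x)%:E + (l `^ (1 - p))%:E * ((w x)%:E * g x `^ p)))).
  apply: ge0_le_integral => //.
  - by move=> x _; rewrite mule_ge0 ?lee_fin.
  - exact: emeasurable_funM.
  - apply: emeasurable_funD; apply: emeasurable_funM => //.
    exact: emeasurable_funM.
  move=> x _; rewrite [l%:E * _]muleC muleCA -ge0_muleDr//.
  - by rewrite lee_wpmul2l ?lee_fin.
  - by rewrite lee_fin ltW.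
  - by rewrite mule_ge0 ?poweR_ge0// lee_fin powR_ge0.
rewrite ge0_integralD//; last 4 first.
- by move=> x _; rewrite mule_ge0 ?lee_fin// ltW.
- exact: emeasurable_funM.
- by move=> x _; rewrite mule_ge0 ?lee_fin ?powR_ge0// mule_ge0 ?poweR_ge0// lee_fin.
- by apply: emeasurable_funM => //; exact: emeasurable_funM.
rewrite !ge0_integralZl//; last 5 first.
- exact: emeasurable_funM.
- by move=> x _; rewrite mule_ge0 ?poweR_ge0// lee_fin.
- by rewrite lee_fin powR_ge0.
- by move=> x _; rewrite lee_fin.
- by rewrite lee_fin ltW.
rewrite E mulr2n mulrDl mul1r EFinD; apply: leeD.
  apply: (@le_trans _ _ (l%:E * W%:E)); first by rewrite lee_wpmul2l// lee_fin ltW.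
  rewrite -EFinM lee_fin /l powRM ?invr_ge0 ?(ltW W0) ?(ltW G'0)//.
  rewrite -(powR_inv1 (ltW W0)) -powRrM mulN1r mulrC [leLHS]mulrCA mulrC ler_wpM2r ?powR_ge0//.
  by rewrite -{1}(powRr1 (ltW W0)) -powRD ?(gt_eqF W0) ?implybT// addrC.
rewrite -EFinM lee_fin; apply: (@le_trans _ _ (l `^ (1 - p) * G')%R).
  by rewrite ler_wpM2l ?powR_ge0// ltW.
rewrite /l -powRrM powRM ?invr_ge0 ?(ltW W0) ?(ltW G'0)//.
rewrite -(powR_inv1 (ltW W0)) -powRrM mulrAC mulrC.
rewrite (_ : -1 * (p^-1 * (1 - p)) = 1 - p^-1)%R; last by field; rewrite gt_eqF.
rewrite ler_wpM2l ?powR_ge0//.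
rewrite -{2}(powRr1 (ltW G'0)) -powRD ?(gt_eqF G'0) ?implybT//.
by rewrite le_eqVlt; apply/orP; left; apply/eqP; congr (_ `^ _)%R; field; rewrite gt_eqF.
Qed.

End power_mean.

Section kernels.
Context {R : realType} {n : nat}.
Local Notation E := 'rV[R]_n.
Local Notation mu := (lebesgue_rV R n).
Implicit Types (x y z : E) (j N : nat) (F G : E -> \bar R).
Local Open Scope ring_scope.

Definition bracket j x : R := 1 + 2 ^+ j * eucl_norm x.

Lemma bracket_ge1 j x : 1 <= bracket j x.
Proof. by rewrite lerDl mulr_ge0 ?exprn_ge0 ?eucl_norm_ge0. Qed.

Lemma bracket_gt0 j x : 0 < bracket j x.
Proof. exact: lt_le_trans (bracket_ge1 j x). Qed.

Lemma bracket_ge0 j x : 0 <= bracket j x.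
Proof. exact/ltW/bracket_gt0. Qed.

Lemma bracketE j x : bracket j x = 1 + eucl_norm (2 ^+ j *: x).
Proof. by rewrite eucl_normZ ger0_norm ?exprn_ge0. Qed.

Lemma bracketN j x : bracket j (- x) = bracket j x.
Proof. by rewrite /bracket eucl_normN. Qed.

(** Peetre's inequality: translating a weight costs a factor that depends on
    the translation alone. *)
Lemma bracket_peetre j x y : bracket j (x + y) <= bracket j x * bracket j y.
Proof.
rewrite !bracketE scalerDr.
apply: (@le_trans _ _ (1 + (eucl_norm (2 ^+ j *: x) + eucl_norm (2 ^+ j *: y)))).
  by rewrite lerD2l eucl_norm_triangle.
have := eucl_norm_ge0 (2 ^+ j *: x); have := eucl_norm_ge0 (2 ^+ j *: y).
by move: (eucl_norm _) (eucl_norm _) => a b a0 b0; rewrite mulrDl mul1r mulrDr mulr1; nra.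
Qed.

Lemma measurable_bracketX j N : measurable_fun setT (fun x => bracket j x ^- N).
Proof.
under eq_fun do rewrite bracketE.
rewrite (_ : (fun _ => _) = (fun x : E => (1 + eucl_norm x) ^- N) \o (fun x => 2 ^+ j *: x + 0)); last first.
  by apply/funext => x /=; rewrite addr0.
apply: measurableT_comp; [exact: measurable_tail|exact: measurable_rV_affine].
Qed.

Lemma bracketVX_ge0 j N x : 0 <= bracket j x ^- N.
Proof. by rewrite invr_ge0 exprn_ge0 ?bracket_ge0. Qed.

Lemma le_bracketVX j N M x : (M <= N)%N -> bracket j x ^- N <= bracket j x ^- M.
Proof.
move=> MN; rewrite lef_pV2 ?posrE ?exprn_gt0 ?bracket_gt0//.
by rewrite ler_weXn2l// bracket_ge1.
Qed.

Lemma integral_bracket_le : exists2 C : R, 0 < C & forall j N, (n < N)%N ->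
  (\int[mu]_x (bracket j x ^- N)%:E <= (C * 2 ^- (j * n))%:E)%E.
Proof.
have [C C0 HC] := @integral_tail_fin R n.
exists C => // j N nN.
have p2 : (0 : R) < 2 ^+ (j * n) by rewrite exprn_gt0.
rewrite mulrC EFinM -lee_pdivrMl ?invr_gt0// invrK.
apply: le_trans HC.
have mt : measurable_fun setT (fun x : E => ((1 + eucl_norm x) ^- n.+1)%:E).
  by apply/measurable_EFinP; exact: measurable_tail.
have h0 : (2 : R) ^+ j != 0 by rewrite expf_neq0// pnatr_eq0.
rewrite [leRHS](ge0_integral_rV_affine 0 h0 mt); last first.
  by move=> x; rewrite lee_fin invr_ge0 exprn_ge0.
rewrite ger0_norm ?exprn_ge0// -exprM lee_wpmul2l ?lee_fin ?(ltW p2)//.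
apply: ge0_le_integral => //.
- by move=> x _; rewrite lee_fin bracketVX_ge0.
- by apply/measurable_EFinP; exact: measurable_bracketX.
- exact: (measurableT_comp mt (measurable_rV_affine _ _)).
by move=> x _; rewrite addr0 -bracketE lee_fin le_bracketVX.
Qed.

(** The majorant of the kernels at frequency 2^j; the normalization makes its
    integral bounded independently of j. *)
Definition wker N j z : R := 2 ^+ (j * n) * bracket j z ^- N.

Lemma wker_ge0 N j z : 0 <= wker N j z.
Proof. by rewrite mulr_ge0 ?exprn_ge0 ?bracketVX_ge0. Qed.

Lemma wker_le N j z : wker N j z <= 2 ^+ (j * n).
Proof.
rewrite -[leRHS]mulr1 ler_wpM2l ?exprn_ge0//.
by have := @le_bracketVX j N 0 z isT; rewrite expr0 invr1.
Qed.

Lemma measurable_wker N j : measurable_fun setT (wker N j).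
Proof. by apply: measurable_funM => //; exact: measurable_bracketX. Qed.

Lemma measurable_rV_sub : measurable_fun setT (fun z : E * E => z.1 - z.2).
Proof.
apply: measurable_fun_rV => i; under eq_fun do rewrite !mxE.
apply: measurable_funB.
- exact: (measurableT_comp (measurable_rV_coord i) measurable_fst).
- exact: (measurableT_comp (measurable_rV_coord i) measurable_snd).
Qed.

Lemma ge0_integral_subl x F : measurable_fun setT F -> (forall y, 0 <= F y)%E ->
  (\int[mu]_y F (x - y)%R = \int[mu]_y F y)%E.
Proof.
move=> mF F0; have m10 : (-1 : R) != 0 by rewrite oppr_eq0 oner_eq0.
rewrite [RHS](ge0_integral_rV_affine x m10 mF F0) normrN1 expr1n mul1e.
by apply: eq_integral => y _; rewrite scaleN1r addrC.
Qed.

Lemma ge0_integral_subr x F : measurable_fun setT F -> (forall y, 0 <= F y)%E ->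
  (\int[mu]_y F (y - x)%R = \int[mu]_y F y)%E.
Proof.
move=> mF F0.
rewrite [RHS](ge0_integral_rV_affine (- x) (oner_neq0 R) mF F0) normr1 expr1n mul1e.
by apply: eq_integral => y _; rewrite scale1r.
Qed.

Definition convw N j F x : \bar R := (\int[mu]_y ((wker N j (x - y)%R)%:E * F y))%E.

Section convw_theory.
Variables (N j : nat) (F : E -> \bar R).
Hypothesis mF : measurable_fun setT F.
Hypothesis F0 : forall y, (0 <= F y)%E.

Lemma convw_ge0 x : (0 <= convw N j F x)%E.
Proof. by apply: integral_ge0 => y _; rewrite mule_ge0 ?lee_fin ?wker_ge0. Qed.

Lemma measurable_wker_sub x : measurable_fun setT (fun y => wker N j (x - y)).
Proof.
apply: (measurableT_comp (measurable_wker N j)).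
exact: (measurableT_comp measurable_rV_sub (@measurable_pair1 _ _ _ _ x)).
Qed.

Lemma measurable_convw_integrand :
  measurable_fun setT (fun z : E * E => ((wker N j (z.1 - z.2)%R)%:E * F z.2)%E).
Proof.
apply: emeasurable_funM.
  apply/measurable_EFinP; apply: (measurableT_comp (measurable_wker N j)).
  exact: measurable_rV_sub.
exact: (measurableT_comp mF measurable_snd).
Qed.

Lemma convw_integrand_ge0 (z : E * E) : (0 <= (wker N j (z.1 - z.2)%R)%:E * F z.2)%E.
Proof. by rewrite mule_ge0 ?lee_fin ?wker_ge0. Qed.

Lemma measurable_convw : measurable_fun setT (convw N j F).
Proof.
apply: (measurable_fun_fubini_tonelli_F (m2 := mu)
  (fun z : E * E => ((wker N j (z.1 - z.2)%R)%:E * F z.2)%E)) => //.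
- exact: measurable_convw_integrand.
- exact: convw_integrand_ge0.
Qed.

Lemma convw_le_sup x : (convw N j F x <= (2 ^+ (j * n))%:E * \int[mu]_y F y)%E.
Proof.
rewrite -ge0_integralZl//.
apply: ge0_le_integral => //.
- by move=> y _; rewrite mule_ge0 ?lee_fin ?wker_ge0.
- by apply: emeasurable_funM => //; apply/measurable_EFinP; exact: measurable_wker_sub.
- exact: emeasurable_funM.
- by move=> y _; rewrite lee_wpmul2r// lee_fin wker_le.
Qed.

(** By Peetre's inequality: a convolution with w_j is essentially constant on
    balls of radius 2^(-j). *)
Lemma convw_shift x x' : (convw N j F x <= (bracket j (x' - x) ^+ N)%:E * convw N j F x')%E.
Proof.
have mk z : measurable_fun setT (fun y => ((wker N j (z - y))%:E * F y)%E).
  by apply: emeasurable_funM => //; apply/measurable_EFinP; exact: measurable_wker_sub.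
rewrite -ge0_integralZl//; last 2 first.
- by move=> y _; rewrite mule_ge0 ?lee_fin ?wker_ge0.
- by rewrite lee_fin exprn_ge0 ?bracket_ge0.
apply: ge0_le_integral => //.
- by move=> y _; rewrite mule_ge0 ?lee_fin ?wker_ge0.
- by apply: emeasurable_funM => //.
move=> y _; rewrite muleA lee_wpmul2r// -EFinM lee_fin /wker mulrCA ler_wpM2l ?exprn_ge0//.
rewrite -ler_pdivrMl ?exprn_gt0 ?bracket_gt0// -invfM lef_pV2 ?posrE ?mulr_gt0 ?exprn_gt0 ?bracket_gt0//.
rewrite -exprMn lerXn2r ?nnegrE ?mulr_ge0 ?bracket_ge0//.
by rewrite (_ : x' - y = (x' - x) + (x - y)) ?bracket_peetre// addrA subrK.
Qed.

End convw_theory.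

Lemma integral_wker_le : exists2 C : R, 0 < C & forall j N, (n < N)%N -> forall x,
  (\int[mu]_y (wker N j (x - y))%:E <= C%:E)%E /\ (\int[mu]_y (wker N j (y - x))%:E <= C%:E)%E.
Proof.
have [C C0 HC] := integral_bracket_le.
exists C => // j N nN x.
have mw : measurable_fun setT (EFin \o wker N j).
  by apply/measurable_EFinP; exact: measurable_wker.
have w0 y : (0 <= (wker N j y)%:E)%E by rewrite lee_fin wker_ge0.
rewrite (ge0_integral_subl x mw)// (ge0_integral_subr x mw)//.
suff : (\int[mu]_x0 (wker N j x0)%:E <= C%:E)%E by [].
rewrite /wker; under eq_integral do rewrite EFinM.
have mb : measurable_fun setT (fun x => (bracket j x ^- N)%:E).
  by apply/measurable_EFinP; exact: measurable_bracketX.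
rewrite ge0_integralZl//; last by move=> y _; rewrite lee_fin bracketVX_ge0.
apply: (le_trans (lee_wpmul2l _ (HC j N nN))); first by rewrite lee_fin exprn_ge0.
by rewrite -EFinM lee_fin mulrCA mulfV ?mulr1// expf_neq0// pnatr_eq0.
Qed.

Lemma convw_L1 : exists2 C : R, 0 < C & forall j N F, (n < N)%N ->
  measurable_fun setT F -> (forall y, 0 <= F y)%E ->
  (\int[mu]_x convw N j F x <= C%:E * \int[mu]_y F y)%E.
Proof.
have [C C0 HC] := integral_wker_le; exists C => // j N F nN mF F0.
rewrite /convw (fubini_tonelli (m1 := mu) (m2 := mu) (fun z : E * E => ((wker N j (z.1 - z.2)%R)%:E * F z.2)%E)); last 2 first.
- exact: measurable_convw_integrand.
- exact: convw_integrand_ge0.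
have mw y : measurable_fun setT (fun x => (wker N j (x - y))%:E).
  apply/measurable_EFinP; apply: (measurableT_comp (measurable_wker N j)).
  exact: (measurableT_comp measurable_rV_sub (@measurable_pair2 _ _ _ _ y)).
rewrite -ge0_integralZl//; last by rewrite lee_fin ltW.
apply: ge0_le_integral => //.
- by move=> y _; apply: integral_ge0 => x _; rewrite mule_ge0 ?lee_fin ?wker_ge0.
- apply: (measurable_fun_fubini_tonelli_G (m1 := mu)
    (fun z : E * E => ((wker N j (z.1 - z.2)%R)%:E * F z.2)%E)) => //.
    exact: measurable_convw_integrand.
  exact: convw_integrand_ge0.
- exact: emeasurable_funM.
move=> y _ /=.
under eq_integral do rewrite muleC.
rewrite ge0_integralZl//.
  by rewrite muleC lee_wpmul2r//; have [] := HC j N nN y.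
by move=> x _; rewrite lee_fin wker_ge0.
Qed.

(** The kernel w_j has bounded mass, so the power mean inequality applies. *)
Lemma convw_power q : 1 <= q -> exists2 C : R, 0 < C & forall j N F x, (n < N)%N ->
  measurable_fun setT F -> (forall y, 0 <= F y)%E ->
  (convw N j F x `^ q <= C%:E * convw N j (fun y => F y `^ q) x)%E.
Proof.
move=> q1; have [C C0 HC] := integral_wker_le.
exists (2 `^ q * C `^ (q - 1)) => [|j N F x nN mF F0].
  by rewrite mulr_gt0// powR_gt0.
apply: power_mean => //.
- exact: measurable_wker_sub.
- by move=> y; exact: wker_ge0.
- exact: (HC j N nN x).1.
Qed.

End kernels.

(** * Annuli and the splitting of the kernel *)

Section annuli.
Context {R : realType} {n : nat}.
Local Notation E := 'rV[R]_n.
Local Notation mu := (lebesgue_rV R n).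
Implicit Types (x y z : E) (j N M : nat) (k l : int) (F G : E -> \bar R).
Local Open Scope ring_scope.

Lemma ltr_pow2 (a b : R) : (2 `^ a < 2 `^ b) = (a < b).
Proof. by rewrite /powR pnatr_eq0/= ltr_expR ltr_pM2r// ln_gt0// ltr1n. Qed.

Lemma pow2N_itv (a : R) : 0 < a -> 0 < (2 : R) `^ (- a) < 1.
Proof. by move=> a0; rewrite powR_gt0//= -[ltRHS](powRr0 2) ltr_pow2 oppr_lt0. Qed.

Lemma exists_dyadic (t : R) : 0 < t -> exists k : int, (2 : R) ^ (k - 1) <= t < (2 : R) ^ k.
Proof.
move=> t0; pose v := ln t / ln 2.
have l2 : 0 < ln (2 : R) by rewrite ln_gt0// ltr1n.
have tE : t = 2 `^ v.
  by rewrite /powR pnatr_eq0/= /v divfK ?gt_eqF// lnK.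
exists (Num.floor v + 1); rewrite addrK -!powR_intmul// tE.
have /andP[f1 f2] := floor_itv v.
by rewrite ler_powR ?ler1n//= ltr_pow2.
Qed.

Lemma expz2_gt0 k : 0 < (2 : R) ^ k.
Proof. by rewrite exprz_gt0. Qed.

Lemma lt_expz2 k l : ((2 : R) ^ k < (2 : R) ^ l) = (k < l).
Proof. by rewrite ltr_eXz2l// ltr1n. Qed.

Lemma le_expz2 k l : ((2 : R) ^ k <= (2 : R) ^ l) = (k <= l).
Proof. by rewrite ler_eXz2l// ltr1n. Qed.

Lemma expz2S k : (2 : R) ^ (k + 1) = 2 * 2 ^ k.
Proof. by rewrite expfzDr ?pnatr_eq0// expr1z mulrC. Qed.

(** The annulus C_k and its two neighbours. *)
Definition fat_annulus k : set E :=
  [set x | (2 : R) ^ (k - 1 - 1) <= eucl_norm x < (2 : R) ^ (k + 1)].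

Lemma measurable_shell (a b : R) : measurable [set x : E | a <= eucl_norm x < b].
Proof.
rewrite (_ : [set x | _] = setT `&` eucl_norm @^-1` `[a, b[%classic).
  exact: measurable_eucl_norm.
by rewrite setTI; apply/seteqP; split => x /=; rewrite in_itv.
Qed.

Lemma measurable_annulus k : measurable (dyadic_annulus k : set E).
Proof. exact: measurable_shell. Qed.

Lemma measurable_fat k : measurable (fat_annulus k).
Proof. exact: measurable_shell. Qed.

Lemma lebesgue_fat k : (mu (fat_annulus k) <= ((4 * 2 ^ k) ^+ n)%:E)%E.
Proof.
apply: (@le_trans _ _ (mu [set x | eucl_norm x < 2 ^ (k + 1)])).
  apply: le_measure; rewrite ?inE//; [exact: measurable_fat|exact: measurable_eucl_ball|].
  by move=> x /andP[].
apply: le_trans (lebesgue_rV_eucl_ball _) _; first exact/ltW/expz2_gt0.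
by rewrite expz2S mulrA -natrM.
Qed.

Lemma annulus_sub_fat k : (dyadic_annulus k : set E) `<=` fat_annulus k.
Proof.
move=> x /andP[h1 h2]; apply/andP; split.
  by apply: le_trans h1; rewrite le_expz2 gerBl.
by apply: (lt_le_trans h2); rewrite le_expz2 lerDl.
Qed.

Lemma lebesgue_annulus k : (mu (dyadic_annulus k) <= ((4 * 2 ^ k) ^+ n)%:E)%E.
Proof.
apply: le_trans (lebesgue_fat k).
by apply: le_measure; rewrite ?inE//; [exact: measurable_annulus|exact: measurable_fat|exact: annulus_sub_fat].
Qed.

Lemma annulus_inj x k l : dyadic_annulus k x -> dyadic_annulus l x -> k = l.
Proof.
move=> /andP[h1 h2] /andP[h3 h4]; apply/eqP; rewrite eq_le; apply/andP; split.
  by have := le_lt_trans h1 h4; rewrite lt_expz2 ltrBlDr ltzD1.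
by have := le_lt_trans h3 h2; rewrite lt_expz2 ltrBlDr ltzD1.
Qed.

Lemma annulus_fat x k l : dyadic_annulus k x -> fat_annulus l x -> (absz (l - k) <= 1)%N.
Proof.
move=> /andP[h1 h2] /andP[h3 h4].
have := le_lt_trans h1 h4; have := le_lt_trans h3 h2; rewrite !lt_expz2; lia.
Qed.

Lemma fat_neq0 x k : fat_annulus k x -> x != 0.
Proof.
move=> /andP[h _]; apply/eqP => x0; move: h; rewrite x0 eucl_norm0.
by rewrite leNgt expz2_gt0.
Qed.

Lemma exists_annulus x : x != 0 -> exists k, dyadic_annulus k x.
Proof.
move=> x0; have [|k kx] := @exists_dyadic (eucl_norm x); last by exists k.
rewrite lt_neqAle eucl_norm_ge0 andbT eq_sym; apply: contra x0 => /eqP h.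
by apply/eqP/eucl_norm_eq0.
Qed.

(** Put a = |x|, b = |y|, d = |x - y|. If d >= (a + b) / 8 or 2^j (a + b) <=
    8, both brackets are at most 9 times that of x - y. Otherwise a and b
    differ by a factor at most 9/7 and exceed 2^(-j). *)
Lemma near_far j M x y :
  wker (M + M) j (x - y) <= 9 ^+ (M + M) * 2 ^+ (j * n) * bracket j x ^- M * bracket j y ^- M
  \/ exists k, [/\ dyadic_annulus k y, - j%:Z < k & fat_annulus k x].
Proof.
pose a := eucl_norm x; pose b := eucl_norm y; pose d := eucl_norm (x - y).
have a0 : 0 <= a by exact: eucl_norm_ge0.
have b0 : 0 <= b by exact: eucl_norm_ge0.
have d0 : 0 <= d by exact: eucl_norm_ge0.
have ad : a <= b + d.
  by have := eucl_norm_triangle y (x - y); rewrite addrC subrK.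
have bd : b <= a + d.
  have := eucl_norm_triangle x (y - x); rewrite addrC subrK.
  by rewrite -[X in _ + eucl_norm X]opprB eucl_normN.
pose T : R := 2 ^+ j; have T0 : 0 < T by rewrite exprn_gt0.
have [h|/andP[h1 h2]] : ((a + b) / 8 <= d) || (T * (a + b) <= 8) \/ (d < (a + b) / 8) && (8 < T * (a + b)).
  by rewrite !ltNge -negb_or; case: (_ || _); [left|right].
  left.
  have hh : T * (a + b) <= 8 * (1 + T * d).
    case/orP: h => h; last by have := mulr_ge0 (ltW T0) d0; lra.
    have : T * (a + b) <= T * (8 * d) by rewrite ler_pM2l//; lra.
    by lra.
  have Td := mulr_ge0 (ltW T0) d0; have Ta := mulr_ge0 (ltW T0) a0; have Tb := mulr_ge0 (ltW T0) b0.
  have hx : bracket j x <= 9 * bracket j (x - y).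
    by rewrite /bracket -/a -/d -/T; rewrite mulrDr in hh; lra.
  have hy : bracket j y <= 9 * bracket j (x - y).
    by rewrite /bracket -/b -/d -/T; rewrite mulrDr in hh; lra.
  have px := bracket_gt0 j x; have py := bracket_gt0 j y; have pd := bracket_gt0 j (x - y).
  rewrite /wker; move: (bracket j x) (bracket j y) (bracket j (x - y)) px py pd hx hy => X Y D X0 Y0 D0 hx hy.
  have : X ^+ M * Y ^+ M <= 9 ^+ (M + M) * D ^+ (M + M).
    rewrite -[leRHS]exprMn exprD; apply: ler_pM; rewrite ?exprn_ge0 ?(ltW X0) ?(ltW Y0)//.
      by rewrite lerXn2r ?nnegrE ?(ltW X0)// mulr_ge0// ltW.
    by rewrite lerXn2r ?nnegrE ?(ltW Y0)// mulr_ge0// ltW.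
  move: (X ^+ M) (Y ^+ M) (D ^+ (M + M)) (9 ^+ (M + M)) (exprn_gt0 M X0) (exprn_gt0 M Y0) (exprn_gt0 (M + M) D0).
  have : (0 : R) < 2 ^+ (j * n) by rewrite exprn_gt0.
  move: (2 ^+ (j * n)) => t t0 P Q S K P0 Q0 S0 PQ.
  rewrite -subr_ge0 (_ : _ - _ = t * (K * S - P * Q) / (P * Q * S)); last first.
    by field; rewrite !gt_eqF.
  by rewrite divr_ge0 ?mulr_ge0 ?subr_ge0// ltW.
have Tba : 0 < T * (a + b) by apply: lt_trans h2.
rewrite pmulr_rgt0// in Tba.
have ab7 : 7 * a < 9 * b by lra.
have ba7 : 7 * b < 9 * a by lra.
have b1 : 0 < b by lra.
right; have [k /andP[k1 k2]] := exists_dyadic b1.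
exists k; split; first exact/andP.
  rewrite -lt_expz2 -exprnN; apply: lt_trans k2.
  rewrite -[X in X < _]mul1r ltr_pdivrMr// mulrC.
  have : T * (7 * a) < T * (9 * b) by rewrite ltr_pM2l.
  by rewrite -/T; rewrite mulrDr in h2; lra.
have k1' : (2 : R) ^ (k - 1 - 1) * 2 <= b by rewrite mulrC -expz2S subrK.
by apply/andP; rewrite -/a expz2S; split; lra.
Qed.

End annuli.

(** * The product part and the diagonal part *)

Section split.
Context {R : realType} {n : nat}.
Hypothesis n_gt0 : (0 < n)%N.
Local Notation E := 'rV[R]_n.
Local Notation mu := (lebesgue_rV R n).
Implicit Types (x y z : E) (j N M : nat) (k l : int) (F G : E -> \bar R).

Definition shell_cut k F : E -> \bar R := fun y => F y * (\1_(dyadic_annulus k) y)%:E.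

Lemma cut_ge0 k F y : (forall y, 0 <= F y) -> 0 <= shell_cut k F y.
Proof. by move=> F0; rewrite mule_ge0 // lee_fin. Qed.

Lemma measurable_cut k F : measurable_fun setT F -> measurable_fun setT (shell_cut k F).
Proof.
move=> mF; apply: emeasurable_funM => //; apply/measurable_EFinP.
by apply: measurable_indic; exact: measurable_annulus.
Qed.

Lemma cut_in k F y : dyadic_annulus k y -> shell_cut k F y = F y.
Proof. by move=> ky; rewrite /shell_cut indicE mem_set// mule1. Qed.

Lemma cut_out k F y : ~ dyadic_annulus k y -> shell_cut k F y = 0.
Proof. by move=> ky; rewrite /shell_cut indicE memNset// mule0. Qed.

(** As the dimension is positive, the origin has neighbourhoods of arbitrarily
    small measure. *)
Lemma lebesgue_rV_singleton0 : mu [set 0%R] = 0.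
Proof.
apply/eqP; rewrite eq_le measure_ge0 andbT; apply/lee_addgt0Pr => e e0; rewrite add0e.
pose r := (Num.min e 1 / 2)%R.
have m0 : (0 < Num.min e 1)%R by rewrite lt_min e0 ltr01.
have r0 : (0 < r)%R by rewrite divr_gt0.
apply: (@le_trans _ _ (mu [set x | (eucl_norm x < r)%R])).
  apply: le_measure; rewrite ?inE; last by move=> _ /= ->; rewrite eucl_norm0.
    exact: measurable_rV_set1.
  exact: measurable_eucl_ball.
apply: le_trans (lebesgue_rV_eucl_ball (ltW r0)) _.
rewrite lee_fin /r mulrC divfK//.
apply: (@le_trans _ _ (Num.min e 1)%R); last by rewrite ge_min lexx.
by case: (n) n_gt0 => // m _; rewrite exprS ger_pMr// exprn_ile1// ?(ltW m0)// ge_min lexx orbT.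
Qed.

Lemma esum_cut F y : (forall y, 0 <= F y) -> y != 0%R ->
  \esum_(k in [set: int]) shell_cut k F y = F y.
Proof.
move=> F0 y0; have [k ky] := exists_annulus y0.
rewrite (esumID [set k])//=; last by move=> l _; exact: cut_ge0.
rewrite setTI esum_set1 ?cut_ge0// cut_in// esum1 ?adde0// => l [_ lk].
by apply: cut_out => ly; apply: lk; rewrite /= (annulus_inj ly ky).
Qed.

Lemma integral_cut F : measurable_fun setT F -> (forall y, 0 <= F y) ->
  \int[mu]_y F y = \esum_(k in [set: int]) \int[mu]_y shell_cut k F y.
Proof.
move=> mF F0; rewrite -integral_esum; last 2 first.
- by move=> k; exact: measurable_cut.
- by move=> k x; exact: cut_ge0.
apply: ae_eq_integral => //.
  apply: measurable_fun_esum => [k|k x]; [exact: measurable_cut|exact: cut_ge0].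
exists [set 0%R]; split; [exact: measurable_rV_set1|exact: lebesgue_rV_singleton0|].
move=> x /= h; apply: contrapT => /eqP x0; apply: h => _.
by rewrite esum_cut.
Qed.

(** The contribution to w_j * F at x of the k-th annulus, when it belongs to
    the diagonal part. *)
Definition near_part N j F x k : \bar R :=
  if (- j%:Z < k)%R && (x \in (fat_annulus k : set E)) then convw N j (shell_cut k F) x else 0.

Lemma near_part_ge0 N j F x k : (forall y, 0 <= F y) -> 0 <= near_part N j F x k.
Proof.
by move=> F0; rewrite /near_part; case: ifPn => // _; apply: convw_ge0 => y; exact: cut_ge0.
Qed.

Lemma convw_split M j F x : measurable_fun setT F -> (forall y, 0 <= F y) ->
  convw (M + M) j F x <=
   (9 ^+ (M + M) * 2 ^+ (j * n) * bracket j x ^- M)%:E *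
      (\int[mu]_y ((bracket j y ^- M)%:E * F y))
   + \esum_(k in [set: int]) near_part (M + M) j F x k.
Proof.
move=> mF F0.
pose c := (9 ^+ (M + M) * 2 ^+ (j * n) * bracket j x ^- M)%R.
have c0 : (0 <= c)%R by rewrite !mulr_ge0 ?exprn_ge0 ?bracketVX_ge0.
pose u k y := if (- j%:Z < k)%R && (x \in (fat_annulus k : set E)) then (wker (M + M) j (x - y)%R)%:E * shell_cut k F y else 0.
have wF0 G y : (forall y, 0 <= G y) -> 0 <= (wker (M + M) j (x - y)%R)%:E * G y.
  by move=> G0; rewrite mule_ge0// lee_fin wker_ge0.
have u0 k y : 0 <= u k y.
  by rewrite /u; case: ifPn => // _; apply: wF0 => z; exact: cut_ge0.
have mu_ k : measurable_fun setT (u k).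
  rewrite /u; case: (_ && _) => //; apply: emeasurable_funM; last exact: measurable_cut.
  by apply/measurable_EFinP; exact: measurable_wker_sub.
have mb : measurable_fun setT (fun y : E => (bracket j y ^- M)%:E * F y).
  by apply: emeasurable_funM => //; apply/measurable_EFinP; exact: measurable_bracketX.
have b0 y : 0 <= (bracket j y ^- M)%:E * F y by rewrite mule_ge0// lee_fin bracketVX_ge0.
rewrite (_ : esum _ _ = \int[mu]_y \esum_(k in [set: int]) u k y); last first.
  rewrite integral_esum//; apply: eq_esum => k _; rewrite /near_part /u.
  by case: ifPn => // _; rewrite integral0.
rewrite -ge0_integralZl// -/c.
rewrite -ge0_integralD//; last 4 first.
- by move=> y _; rewrite mule_ge0.
- exact: emeasurable_funM.
- by move=> y _; exact: esum_ge0.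
- exact: measurable_fun_esum.
apply: ge0_le_integral => //.
- by move=> y _; exact: wF0.
- by apply: emeasurable_funM => //; apply/measurable_EFinP; exact: measurable_wker_sub.
- by apply: emeasurable_funD; [exact: emeasurable_funM|exact: measurable_fun_esum].
move=> y _; have [h|[k [ky jk xk]]] := near_far j M x y.
  apply: le_trans (leeDl _ _); last exact: esum_ge0.
  by rewrite muleA lee_wpmul2r// -EFinM lee_fin.
apply: (@le_trans _ _ (u k y)).
  by rewrite /u jk mem_set//= cut_in.
apply: le_trans (@esum_ge_term _ _ (u ^~ y) k (u0 ^~ y)) _.
by rewrite leeDr// mule_ge0.
Qed.

(** At each x at most three terms are not zero, those with |k - k0| <= 1 for
    the annulus k0 of x; the weights 2^|k-k0| express this within
    esum_weighted. *)
Lemma near_part_power s : (0 < s)%R -> exists2 C : R, (0 < C)%R &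
  forall N j F x, (forall y, 0 <= F y) ->
  (\esum_(k in [set: int]) near_part N j F x k) `^ s <=
    C%:E * \esum_(k in [set: int]) (near_part N j F x k `^ s).
Proof.
move=> s0.
have c01 : (0 < (2 : R) `^ (- s^-1) < 1)%R.
  by apply: pow2N_itv; rewrite invr_gt0.
have [W W0 HW] := esum_geometric_int c01.
exists (W `^ s * 2)%R => [|N j F x F0]; first by rewrite mulr_gt0// powR_gt0.
have N0 k : 0 <= near_part N j F x k by exact: near_part_ge0.
have Ns0 k : 0 <= near_part N j F x k `^ s by exact: poweR_ge0.
have [x0|x0] := eqVneq x 0%R.
  rewrite esum1 ?poweR0r ?gt_eqF// ?mule_ge0 ?esum_ge0 ?lee_fin ?mulr_ge0 ?powR_ge0//.
  move=> k _; rewrite /near_part; case: ifPn => // /andP[_ /set_mem/fat_neq0].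
  by rewrite x0 eqxx.
have [i0 xi0] := exists_annulus x0.
pose w k : R := (2 ^+ absz (k - i0)%R)%R.
have w0 k : (0 < w k)%R by rewrite exprn_gt0.
apply: le_trans (@esum_weighted _ _ s W w _ s0 W0 w0 N0 _) _.
  apply: le_trans (HW i0); apply: le_esum => k _; rewrite lee_fin /w.
  by rewrite -(powR_mulrn _ (powR_ge0 _ _)) -[X in (X `^ _ <= _)%R](powR_mulrn _ (ler0n R 2)) -!powRrM mulrC.
rewrite EFinM -muleA lee_wpmul2l ?lee_fin ?powR_ge0// -esumZ//.
apply: le_esum => k _; rewrite /near_part; case: ifPn => [/andP[_ /set_mem xk]|_]; last first.
  by rewrite poweR0r ?gt_eqF// !mule0.
rewrite lee_wpmul2r ?poweR_ge0// lee_fin /w.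
by have := annulus_fat xi0 xk; case: absz => [|[|]]// _; rewrite ?expr0 ?expr1 ?ler1n.
Qed.

Lemma bracket_power_le j M s x : (n.+1%:R <= M%:R * s)%R ->
  ((bracket j x ^- M) `^ s <= bracket j x ^- n.+1)%R.
Proof.
move=> h; have b1 := bracket_ge1 j x; have b0 := bracket_ge0 j x.
rewrite -[(_ ^- M)%R](powR_invn _ b0) -(powR_invn _ b0) -powRrM ler_powR//.
by rewrite mulNr lerN2.
Qed.

(** Integrate the s-th power of convw_split; the exponent M s > n makes the
    weight in x integrable at the scale 2^(-j). *)
Lemma convw_Ls_split s M : (0 < s)%R -> (n.+1%:R <= M%:R * s)%R ->
  exists2 C : R, (0 < C)%R & forall j F, measurable_fun setT F -> (forall y, 0 <= F y) ->
  \int[mu]_x (convw (M + M) j F x `^ s) <=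
   C%:E * ((2 `^ (j%:R * n%:R * (s - 1)))%:E *
      (\int[mu]_y ((bracket j y ^- M)%:E * F y)) `^ s
   + \esum_(k in [set: int]) (if (- j%:Z < k)%R then
        \int[mu]_x ((\1_(fat_annulus k) x)%:E * convw (M + M) j (shell_cut k F) x `^ s) else 0)).
Proof.
move=> s0 hM; have [A A0 HA] := near_part_power s0.
have [B B0 HB] := @integral_bracket_le R n.
pose K : R := ((9 ^+ (M + M)) `^ s * B)%R.
have K0 : (0 < K)%R by rewrite mulr_gt0// powR_gt0 ?exprn_gt0.
exists (2 `^ s * (K + A))%R => [|j F mF F0]; first by rewrite mulr_gt0 ?powR_gt0 ?addr_gt0.
set I := \int[mu]_y ((bracket j y ^- M)%:E * F y).
have I0 : 0 <= I by apply: integral_ge0 => y _; rewrite mule_ge0// lee_fin bracketVX_ge0.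
have mc k : measurable_fun setT (convw (M + M) j (shell_cut k F)).
  by apply: measurable_convw => [|y]; [exact: measurable_cut|exact: cut_ge0].
pose a x := (9 ^+ (M + M) * 2 ^+ (j * n) * bracket j x ^- M)%:E * I.
pose b x := \esum_(k in [set: int]) near_part (M + M) j F x k.
pose b' x := \esum_(k in [set: int]) (near_part (M + M) j F x k `^ s).
have np0 x k : 0 <= near_part (M + M) j F x k by exact: near_part_ge0.
have nps0 x k : 0 <= near_part (M + M) j F x k `^ s by exact: poweR_ge0.
have nE k x : near_part (M + M) j F x k `^ s = if (- j%:Z < k)%R then
   (\1_(fat_annulus k) x)%:E * convw (M + M) j (shell_cut k F) x `^ s else 0.
  rewrite /near_part indicE; case: (- j%:Z < k)%R; rewrite ?andTb ?andFb; last by rewrite poweR0r// gt_eqF.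
  by case: (_ \in _); rewrite ?mul1e// mul0e poweR0r// gt_eqF.
have mn k : measurable_fun setT (fun x => near_part (M + M) j F x k `^ s).
  rewrite (_ : (fun x => _) = if (- j%:Z < k)%R then
     (fun x => (\1_(fat_annulus k) x)%:E * convw (M + M) j (shell_cut k F) x `^ s) else cst 0); last first.
    by apply/funext => x; rewrite nE; case: (- j%:Z < k)%R.
  case: (- j%:Z < k)%R => //; apply: emeasurable_funM.
    by apply/measurable_EFinP; apply: measurable_indic; exact: measurable_fat.
  exact: (measurableT_comp (measurable_poweR s) (mc k)).
have mb' : measurable_fun setT b' by exact: measurable_fun_esum.
have mbx : measurable_fun setT (fun x : E => (bracket j x ^- n.+1)%:E).
  by apply/measurable_EFinP; exact: measurable_bracketX.
pose a' x := ((9 ^+ (M + M)) `^ s * 2 `^ (j%:R * n%:R * s))%:E * I `^ s * (bracket j x ^- n.+1)%:E.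
have k0 : 0 <= ((9 ^+ (M + M)) `^ s * 2 `^ (j%:R * n%:R * s))%:E * I `^ s.
  by rewrite mule_ge0 ?poweR_ge0// lee_fin mulr_ge0 ?powR_ge0.
have bx0 x : 0 <= (bracket j x ^- n.+1)%:E by rewrite lee_fin bracketVX_ge0.
have p2 (m : nat) : ((2 : R) ^+ m = 2 `^ m%:R)%R by rewrite powR_mulrn.
apply: (@le_trans _ _ (\int[mu]_x ((2 `^ s)%:E * (a' x + A%:E * b' x)))).
  apply: ge0_le_integral => //.
  - by move=> x _; exact: poweR_ge0.
  - by apply: (measurableT_comp (measurable_poweR s)); exact: measurable_convw.
  - apply: emeasurable_funM => //; apply: emeasurable_funD; exact: emeasurable_funM.
  move=> x _; apply: (@le_trans _ _ ((a x + b x) `^ s)).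
    apply: le_poweR; [exact: ltW|exact: convw_ge0|exact: convw_split].
  have a0 : 0 <= a x by rewrite mule_ge0// lee_fin !mulr_ge0 ?exprn_ge0 ?bracketVX_ge0.
  have b0 : 0 <= b x by exact: esum_ge0.
  apply: le_trans (poweRD_le s0 a0 b0) _.
  rewrite lee_wpmul2l ?lee_fin ?powR_ge0//; apply: leeD; last exact: HA.
  rewrite /a' /a poweRM ?lee_fin ?mulr_ge0 ?exprn_ge0 ?bracketVX_ge0//.
  rewrite muleAC lee_wpmul2r ?poweR_ge0// -EFinM poweR_EFin lee_fin.
  rewrite powRM ?mulr_ge0 ?exprn_ge0 ?bracketVX_ge0// powRM ?exprn_ge0//.
  rewrite p2 -powRrM natrM ler_wpM2l ?mulr_ge0 ?powR_ge0//.
  exact: bracket_power_le.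
have sum0 x : 0 <= a' x + A%:E * b' x.
  apply: adde_ge0; first by rewrite mule_ge0.
  by apply: mule_ge0; [rewrite lee_fin ltW|exact: esum_ge0].
rewrite ge0_integralZl//; last by apply: emeasurable_funD; exact: emeasurable_funM.
rewrite EFinM -muleA lee_wpmul2l ?lee_fin ?powR_ge0//.
rewrite ge0_integralD//; last 4 first.
- by move=> x _; rewrite mule_ge0.
- exact: emeasurable_funM.
- by move=> x _; apply: mule_ge0; [rewrite lee_fin ltW|exact: esum_ge0].
- exact: emeasurable_funM.
rewrite {1}/a' ge0_integralZl// ge0_integralZl//; last 2 first.
- by move=> x _; exact: esum_ge0.
- by rewrite lee_fin ltW.
rewrite integral_esum//.
have X0 : 0 <= (2 `^ (j%:R * n%:R * (s - 1)))%:E * I `^ s.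
  by rewrite mule_ge0 ?poweR_ge0 ?lee_fin ?powR_ge0.
have -> : \esum_(i in [set: int]) \int[mu]_x near_part (M + M) j F x i `^ s =
 \esum_(k in [set: int]) (if (- j%:Z < k)%R then
        \int[mu]_x ((\1_(fat_annulus k) x)%:E * convw (M + M) j (shell_cut k F) x `^ s) else 0).
  apply: eq_esum => k _; under eq_integral do rewrite nE.
  by case: (- j%:Z < k)%R => //; rewrite integral0.
set Y := esum _ _.
have Y0 : 0 <= Y.
  apply: esum_ge0 => k _; case: ifPn => // _; apply: integral_ge0 => x _.
  by rewrite mule_ge0 ?poweR_ge0// lee_fin.
rewrite EFinD ge0_muleDl ?lee_fin ?(ltW A0) ?(ltW K0)//.
have AY : A%:E * Y <= A%:E * ((2 `^ (j%:R * n%:R * (s - 1)))%:E * I `^ s + Y).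
  by rewrite lee_wpmul2l ?lee_fin ?(ltW A0)// leeDr.
apply: leeD => //; apply: (@le_trans _ _ (K%:E * ((2 `^ (j%:R * n%:R * (s - 1)))%:E * I `^ s))); last first.
  by rewrite lee_wpmul2l ?lee_fin ?(ltW K0)// leeDl.
apply: (le_trans (lee_wpmul2l k0 (HB j n.+1 (ltnSn n)))).
rewrite muleAC muleA lee_wpmul2r ?poweR_ge0// -!EFinM lee_fin /K.
rewrite -!mulrA ler_wpM2l ?powR_ge0// mulrCA ler_wpM2l ?(ltW B0)//.
by rewrite p2 -powRN -powRD ?pnatr_eq0 ?implybT// natrM !mulrBr mulr1 !mulrA.
Qed.

End split.

(** * Estimates in terms of the Herz norm *)

Section herz_estimates.
Context {R : realType} {n : nat}.
Hypothesis n_gt0 : (0 < n)%N.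
Local Notation E := 'rV[R]_n.
Local Notation mu := (lebesgue_rV R n).
Implicit Types (x y z : E) (j N M : nat) (k l : int) (F G : E -> \bar R).

Lemma pow2D (a b : R) : ((2 : R) `^ a * 2 `^ b = 2 `^ (a + b))%R.
Proof. by rewrite -powRD// pnatr_eq0 implybT. Qed.

Lemma pow2X (m : nat) : ((2 : R) ^+ m = 2 `^ m%:R)%R.
Proof. by rewrite powR_mulrn. Qed.

Lemma pow2Z k : ((2 : R) ^ k = 2 `^ k%:~R)%R.
Proof. by rewrite powR_intmul. Qed.

Lemma measurable_poweR_comp (G : E -> \bar R) (t : R) : measurable_fun setT G ->
  measurable_fun setT (fun y => G y `^ t).
Proof. exact: (measurableT_comp (measurable_poweR t)). Qed.

Lemma integral_indicM_le (D : set E) G : measurable D -> measurable_fun setT G ->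
  (forall y, 0 <= G y) ->
  \int[mu]_y ((\1_D y)%:E * G y) <= \int[mu]_y G y.
Proof.
move=> mD mG G0; apply: ge0_le_integral => //.
- by move=> y _; rewrite mule_ge0// lee_fin.
- by apply: emeasurable_funM => //; apply/measurable_EFinP; exact: measurable_indic.
- by move=> y _; rewrite indicE; case: (_ \in _); rewrite ?mul1e// mul0e.
Qed.

Lemma integral_indicE (D : set E) : measurable D -> \int[mu]_y (\1_D y)%:E = mu D.
Proof. by move=> mD; rewrite integral_indic// setIT. Qed.

(** Hoelder's inequality on a set of finite measure. *)
Lemma indic_power_mean (p W : R) (D : set E) G : (1 <= p)%R -> (0 < W)%R -> measurable D ->
  mu D <= W%:E -> measurable_fun setT G -> (forall y, 0 <= G y) ->
  \int[mu]_y ((\1_D y)%:E * G y) <=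
   (2 * W `^ (1 - p^-1))%:E * (\int[mu]_y ((\1_D y)%:E * G y `^ p)) `^ p^-1.
Proof.
move=> p1 W0 mD DW mG G0; have p0 : (0 < p)%R by rewrite (lt_le_trans _ p1).
have := @power_mean _ _ R mu p W (\1_D) G p1 W0 (measurable_indic mD) _ mG G0 _.
have i0 : 0 <= \int[mu]_y ((\1_D y)%:E * G y).
  by apply: integral_ge0 => y _; rewrite mule_ge0// lee_fin.
have i1 : 0 <= \int[mu]_y ((\1_D y)%:E * G y `^ p).
  by apply: integral_ge0 => y _; rewrite mule_ge0 ?poweR_ge0// lee_fin.
move=> /(_ _ _)/(poweR_le_inv p0 i0) h; apply: (le_trans (h _ _)) => //.
  by rewrite integral_indicE.
rewrite poweRM//; last by rewrite lee_fin mulr_ge0 ?powR_ge0.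
rewrite poweR_EFin lee_wpmul2r ?poweR_ge0// lee_fin powRM ?powR_ge0//.
rewrite -!powRrM mulfV ?gt_eqF// powRr1//.
by rewrite mulrBl mul1r mulfV ?gt_eqF.
Qed.

Lemma indic_cut k F y : (\1_(dyadic_annulus k) y)%:E * F y = shell_cut k F y.
Proof. by rewrite muleC. Qed.

Lemma cut_poweR k F t y : (0 < t)%R -> shell_cut k F y `^ t = (\1_(dyadic_annulus k) y)%:E * F y `^ t.
Proof.
move=> t0; rewrite /shell_cut indicE; case: (_ \in _); first by rewrite mule1 mul1e.
by rewrite mule0 mul0e poweR0r// gt_eqF.
Qed.

Lemma cut_L1 q k F : (1 <= q)%R -> measurable_fun setT F -> (forall y, 0 <= F y) ->
  \int[mu]_y shell_cut k F y <= (2 * (4 ^+ n * 2 `^ (k%:~R * n%:R)) `^ (1 - q^-1))%:E *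
      (\int[mu]_y (shell_cut k F y `^ q)) `^ q^-1.
Proof.
move=> q1 mF F0; have q0 : (0 < q)%R by rewrite (lt_le_trans _ q1).
have W0 : (0 < (4 ^+ n * 2 `^ (k%:~R * n%:R)) :> R)%R by rewrite mulr_gt0 ?exprn_gt0 ?powR_gt0.
have := @indic_power_mean q _ _ F q1 W0 (measurable_annulus k) _ mF F0.
under eq_integral do rewrite indic_cut.
rewrite (_ : \int[mu]_y (shell_cut k F y `^ q) =
  \int[mu]_y ((\1_(dyadic_annulus k) y)%:E * F y `^ q)); last first.
  by apply: eq_integral => y _; rewrite cut_poweR.
apply; apply: le_trans (lebesgue_annulus k) _.
by rewrite exprMn pow2Z -(powR_mulrn n (powR_ge0 _ _)) -powRrM.
Qed.

(** The k-th term of the Herz norm of a nonnegative function. *)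
Definition herz_term (alpha q : R) F k : \bar R :=
  (2 `^ (k%:~R * alpha))%:E * (\int[mu]_y (shell_cut k F y `^ q)) `^ q^-1.

Lemma cut_int_ge0 q k F : 0 <= \int[mu]_y (shell_cut k F y `^ q).
Proof. by apply: integral_ge0 => y _; exact: poweR_ge0. Qed.

Lemma herz_term_ge0 alpha q F k : 0 <= herz_term alpha q F k.
Proof. by rewrite mule_ge0 ?poweR_ge0// lee_fin powR_ge0. Qed.

Lemma herz_termK alpha q F k : (\int[mu]_y (shell_cut k F y `^ q)) `^ q^-1 =
  (2 `^ (- (k%:~R * alpha)))%:E * herz_term alpha q F k.
Proof. by rewrite muleA -EFinM pow2D addNr powRr0 mul1e. Qed.

(** On the k-th annulus Hoelder's inequality costs 2^(k n (1 - 1/q)) = 2^(k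
    (delta + alpha)), with delta = n - n/q - alpha > 0. If j + k <= 0 the
    factor 2^((j+k) delta) is already small; if j + k > 0 the weight gains
    2^(-(j+k) M), and M >= 2n >= 2 delta. *)
Lemma far_sum (alpha q : R) M : (1 <= q)%R -> (0 <= alpha)%R ->
  (alpha < n%:R - n%:R / q)%R -> (n + n <= M)%N ->
  exists2 C : R, (0 < C)%R & forall j F, measurable_fun setT F -> (forall y, 0 <= F y) ->
  (2 `^ (j%:R * (n%:R - n%:R / q - alpha)))%:E * \int[mu]_y ((bracket j y ^- M)%:E * F y) <=
   C%:E * \esum_(k in [set: int])
     (((2 `^ (- (n%:R - n%:R / q - alpha))) ^+ absz (- j%:Z - k)%R)%:E * herz_term alpha q F k).
Proof.
move=> q1 al0; have q0 : (0 < q)%R by rewrite (lt_le_trans _ q1).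
set d := (n%:R - n%:R / q - alpha)%R => /[dup] al1; rewrite -subr_gt0 -/d => d0 nM.
have dn : (d <= n%:R)%R.
  by rewrite /d -addrA gerDl -opprD oppr_le0 addr_ge0// divr_ge0// ltW.
pose K : R := (2 * (4 ^+ n) `^ (1 - q^-1))%R.
exists (2 ^+ M * K)%R => [|j F mF F0]; first by rewrite !mulr_gt0 ?exprn_gt0// powR_gt0 ?exprn_gt0.
have mb : measurable_fun setT (fun x : E => (bracket j x ^- M)%:E).
  by apply/measurable_EFinP; exact: measurable_bracketX.
have bx0 x : 0 <= (bracket j x ^- M)%:E by rewrite lee_fin bracketVX_ge0.
rewrite (integral_cut n_gt0); last 2 first.
- exact: emeasurable_funM.
- by move=> y; rewrite mule_ge0.
have i0 k : 0 <= \int[mu]_y shell_cut k (fun y => (bracket j y ^- M)%:E * F y) y.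
  by apply: integral_ge0 => y _; apply: cut_ge0 => z; rewrite mule_ge0.
have h0 k : 0 <= ((2 `^ (- d)) ^+ absz (- j%:Z - k)%R)%:E * herz_term alpha q F k.
  by rewrite mule_ge0 ?herz_term_ge0// lee_fin exprn_ge0// powR_ge0.
rewrite -!esumZ ?powR_ge0//; last by rewrite !mulr_ge0 ?exprn_ge0 ?powR_ge0.
apply: le_esum => k _.
pose m := (j%:Z + k)%R.
have rho y : dyadic_annulus k y ->
    (2 `^ (m%:~R * d) * bracket j y ^- M <= 2 ^+ M * (2 `^ (- d)) ^+ absz m)%R.
  move=> /andP[ky _].
  have [m0|m0] := leP m 0%R.
    rewrite (_ : (2 `^ (- d)) ^+ absz m = 2 `^ (m%:~R * d))%R; last first.
      rewrite -powR_mulrn ?powR_ge0// -powRrM; congr (_ `^ _)%R.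
      by rewrite natr_absz ler0_norm// rmorphN/= mulrNN mulrC.
    rewrite mulrC ler_wpM2r ?powR_ge0//; apply: (@le_trans _ _ 1%R).
      by have := @le_bracketVX R n j M 0 y isT; rewrite expr0 invr1.
    by rewrite exprn_ege1// ler1n.
  have hb : (2 `^ (m%:~R - 1) <= bracket j y)%R.
    apply: (@le_trans _ _ (2 ^+ j * eucl_norm y)%R); last by rewrite /bracket lerDr.
    rewrite (_ : 2 `^ (m%:~R - 1) = 2 ^+ j * 2 ^ (k - 1))%R ?ler_wpM2l ?exprn_ge0//.
    by rewrite pow2X pow2Z pow2D /m rmorphD rmorphB/= addrA.
  apply: (@le_trans _ _ (2 `^ (m%:~R * d) * 2 `^ (- ((m%:~R - 1) * M%:R)))%R).
    rewrite ler_wpM2l ?powR_ge0// powRN lef_pV2 ?posrE ?exprn_gt0 ?bracket_gt0 ?powR_gt0//.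
    by rewrite powRrM powR_mulrn ?powR_ge0// lerXn2r ?nnegrE ?powR_ge0 ?bracket_ge0.
  rewrite pow2D -(powR_mulrn _ (powR_ge0 2 (- d))) -powRrM pow2X pow2D ler_powR ?ler1n//.
  rewrite natr_absz gtr0_norm//.
  have m1 : (1 <= m%:~R :> R)%R by rewrite ler1z.
  have nM' : (n%:R + n%:R <= M%:R :> R)%R by rewrite -natrD ler_nat.
  have : (m%:~R * (d + d) <= m%:~R * M%:R :> R)%R.
    by rewrite ler_wpM2l ?(le_trans _ m1)//; lra.
  have G (m' d' M' : R) : (m' * (d' + d') <= m' * M' ->
      m' * d' - (m' - 1) * M' <= M' + - d' * m')%R by move=> h; nra.
  exact: G.
have mFk := measurable_cut k mF.
have Fk0 y : 0 <= shell_cut k F y by exact: cut_ge0.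
have mbF : measurable_fun setT (fun y => (bracket j y ^- M)%:E * F y) by exact: emeasurable_funM.
have bF0 y : 0 <= (bracket j y ^- M)%:E * F y by rewrite mule_ge0.
apply: (@le_trans _ _ (\int[mu]_y ((2 ^+ M * (2 `^ (- d)) ^+ absz m * 2 `^ (- (k%:~R * d)))%:E * shell_cut k F y))).
  rewrite -ge0_integralZl//; last 2 first.
  - exact: measurable_cut.
  - by move=> y _; exact: cut_ge0.
  apply: ge0_le_integral => //.
  - by move=> y _; rewrite mule_ge0 ?lee_fin ?powR_ge0//; exact: cut_ge0.
  - by apply: emeasurable_funM => //; exact: measurable_cut.
  - exact: emeasurable_funM.
  move=> y _; have [ky|ky] := pselect (dyadic_annulus k y); last by rewrite !cut_out// !mule0.
  rewrite !cut_in// muleA lee_wpmul2r// -EFinM lee_fin.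
  rewrite (_ : 2 `^ (j%:R * d) = 2 `^ (m%:~R * d) * 2 `^ (- (k%:~R * d)))%R; last first.
    by rewrite pow2D /m rmorphD/= mulrDl addrK.
  by rewrite mulrAC ler_wpM2r ?powR_ge0// rho.
have cst0 : (0 <= 2 ^+ M * (2 `^ (- d)) ^+ absz m * 2 `^ (- (k%:~R * d)) :> R)%R.
  by rewrite !mulr_ge0 ?exprn_ge0 ?powR_ge0.
rewrite ge0_integralZl//.
apply: (le_trans (lee_wpmul2l _ (cut_L1 k q1 mF F0))); first by rewrite lee_fin.
rewrite (herz_termK alpha); move: (herz_term_ge0 alpha q F k); move: (herz_term alpha q F k) => h hh.
rewrite !muleA -!EFinM; apply: lee_wpmul2r => //; rewrite lee_fin.
rewrite powRM ?exprn_ge0 ?powR_ge0// -powRrM distnC (_ : k - - j%:Z = m)%R; last by rewrite opprK addrC.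
rewrite le_eqVlt; apply/orP; left; apply/eqP.
rewrite (_ : 2 `^ (k%:~R * n%:R * (1 - q^-1)) = 2 `^ (k%:~R * d) * 2 `^ (k%:~R * alpha))%R; last first.
  by rewrite pow2D; congr (_ `^ _)%R; rewrite /d; ring.
rewrite /K !powRN; have := powR_gt0 (k%:~R * d) (ltr0n R 2); have := powR_gt0 (k%:~R * alpha) (ltr0n R 2).
move: (2 `^ (k%:~R * d))%R (2 `^ (k%:~R * alpha))%R (_ `^ (1 - q^-1))%R => a b c b0 a0.
by field; rewrite !gt_eqF.
Qed.

(** Young's inequality and, in the second half, the bound of the convolution
    of w_j and G^q by its supremum norm. *)
Lemma convw_Lq (q : R) N : (1 <= q)%R -> (n < N)%N ->
  exists2 C : R, (0 < C)%R & forall j G, measurable_fun setT G -> (forall y, 0 <= G y) ->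
  \int[mu]_x (convw N j G x `^ q) <= C%:E * \int[mu]_y (G y `^ q) /\
  forall x, convw N j G x `^ q <= (C * 2 `^ (j%:R * n%:R))%:E * \int[mu]_y (G y `^ q).
Proof.
move=> q1 nN; have [A A0 HA] := @convw_power R n q q1.
have [B B0 HB] := @convw_L1 R n.
exists (A * (B + 1))%R => [|j G mG G0]; first by rewrite mulr_gt0// addr_gt0.
have mGq := measurable_poweR_comp q mG.
have Gq0 y : 0 <= G y `^ q by exact: poweR_ge0.
have mc := measurable_convw N j mGq Gq0.
have c0 := convw_ge0 N j Gq0.
have i0 : 0 <= \int[mu]_y (G y `^ q) by exact: integral_ge0.
split => [|x]; last first.
  apply: (le_trans (HA j N G x nN mG G0)).
  rewrite EFinM EFinM -!muleA lee_wpmul2l ?lee_fin ?(ltW A0)//.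
  apply: (@le_trans _ _ ((2 `^ (j%:R * n%:R))%:E * \int[mu]_y (G y `^ q))).
    by rewrite -natrM -pow2X; exact: convw_le_sup.
  by rewrite lee_pemull// ?mule_ge0 ?lee_fin ?powR_ge0// lerDr ltW.
apply: (@le_trans _ _ (\int[mu]_x (A%:E * convw N j (fun y => G y `^ q) x))).
  apply: ge0_le_integral => //.
  - by move=> x _; exact: poweR_ge0.
  - by apply: measurable_poweR_comp; exact: measurable_convw.
  - exact: emeasurable_funM.
  - by move=> x _; exact: HA.
rewrite ge0_integralZl// ?lee_fin ?(ltW A0)//.
rewrite EFinM -muleA lee_wpmul2l ?lee_fin ?(ltW A0)//.
apply: (le_trans (HB j N _ nN mGq Gq0)).
by rewrite lee_wpmul2r// lee_fin lerDl.
Qed.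

(** Interpolation between the two halves of convw_Lq: the s-th power is the
    q-th power times a power of the supremum. *)
Lemma convw_Lq_Ls (q s : R) N : (1 <= q)%R -> (q <= s)%R -> (n < N)%N ->
  exists2 C : R, (0 < C)%R & forall j G, measurable_fun setT G -> (forall y, 0 <= G y) ->
  \int[mu]_x (convw N j G x `^ s) <=
    (C * 2 `^ (j%:R * n%:R * (s / q - 1)))%:E * (\int[mu]_y (G y `^ q)) `^ (s / q).
Proof.
move=> q1 qs nN; have [A A0 HA] := convw_Lq q1 nN.
have q0 : (0 < q)%R by rewrite (lt_le_trans _ q1).
have sq1 : (1 <= s / q)%R by rewrite ler_pdivlMr// mul1r.
have sq0 : (0 < s / q)%R by rewrite (lt_le_trans _ sq1).
have sqm : (0 <= s / q - 1)%R by rewrite subr_ge0.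
exists (A `^ (s / q))%R => [|j G mG G0]; first by rewrite powR_gt0.
have [H1 H2] := HA j G mG G0.
set I := \int[mu]_y (G y `^ q) in H1 H2 *.
have I0 : 0 <= I by apply: integral_ge0 => y _; exact: poweR_ge0.
case EI : I I0 H1 H2 => [v| |]// v0 H1 H2; last first.
  rewrite poweRyr ?gt_eqF// gt0_muley ?leey// lte_fin mulr_gt0// powR_gt0//.
rewrite lee_fin in v0.
pose S := (A * 2 `^ (j%:R * n%:R) * v)%R.
have S0 : (0 <= S)%R by rewrite !mulr_ge0 ?powR_ge0// ltW.
have mcq : measurable_fun setT (fun x => convw N j G x `^ q).
  by apply: measurable_poweR_comp; exact: measurable_convw.
apply: (@le_trans _ _ (\int[mu]_x ((S `^ (s / q - 1))%:E * (convw N j G x `^ q)))).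
  apply: ge0_le_integral => //.
  - by move=> x _; exact: poweR_ge0.
  - by apply: measurable_poweR_comp; exact: measurable_convw.
  - exact: emeasurable_funM.
  move=> x _; rewrite (_ : s = q * (s / q))%R; last by rewrite mulrC divfK// gt_eqF.
  rewrite poweRrM mulrAC mulfV ?gt_eqF// mul1r.
  have := H2 x; rewrite -EFinM -/S.
  have := poweR_ge0 (convw N j G x) q.
  case: (_ `^ q) => [t| |]//; rewrite !lee_fin => t0 tS.
  rewrite -(mulr_powRB1 t0 sq0) mulrC ler_wpM2r//.
  by rewrite ge0_ler_powR.
rewrite ge0_integralZl//; last 2 first.
- by move=> x _; exact: poweR_ge0.
- by rewrite lee_fin powR_ge0.
apply: (le_trans (lee_wpmul2l _ H1)); first by rewrite lee_fin powR_ge0.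
rewrite poweR_EFin -!EFinM lee_fin /S !powRM ?powR_ge0 ?mulr_ge0 ?powR_ge0 ?(ltW A0)//.
rewrite -powRrM -(mulr_powRB1 v0 sq0) -(mulr_powRB1 (ltW A0) sq0).
by rewrite le_eqVlt; apply/orP; left; apply/eqP; ring.
Qed.

(** For s <= q, Hoelder's inequality on the fat annulus followed by the L^q
    bound. *)
Lemma convw_low (q s : R) N : (1 <= q)%R -> (0 < s)%R -> (s <= q)%R -> (n < N)%N ->
  exists2 C : R, (0 < C)%R & forall j k G, measurable_fun setT G -> (forall y, 0 <= G y) ->
  \int[mu]_x ((\1_(fat_annulus k) x)%:E * convw N j G x `^ s) <=
    (C * 2 `^ (k%:~R * n%:R * (1 - s / q)))%:E * (\int[mu]_y (G y `^ q)) `^ (s / q).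
Proof.
move=> q1 s0 sq nN; have [A A0 HA] := convw_Lq q1 nN.
have q0 : (0 < q)%R by rewrite (lt_le_trans _ q1).
have qs1 : (1 <= q / s)%R by rewrite ler_pdivlMr// mul1r.
have sq0 : (0 < s / q)%R by rewrite divr_gt0.
exists (2 * (4 ^+ n) `^ (1 - s / q) * A `^ (s / q))%R => [|j k G mG G0].
  by rewrite !mulr_gt0 ?powR_gt0 ?exprn_gt0.
have [H1 _] := HA j G mG G0.
have mc : measurable_fun setT (convw N j G) by exact: measurable_convw.
have W0 : (0 < (4 ^+ n * 2 `^ (k%:~R * n%:R)) :> R)%R by rewrite mulr_gt0 ?exprn_gt0 ?powR_gt0.
apply: (le_trans (@indic_power_mean (q / s) _ _ (fun x => convw N j G x `^ s) qs1 W0 (measurable_fat k) _ _ _)).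
- apply: le_trans (lebesgue_fat k) _.
  by rewrite exprMn pow2Z -(powR_mulrn n (powR_ge0 _ _)) -powRrM.
- exact: measurable_poweR_comp.
- by move=> y; exact: poweR_ge0.
rewrite invf_div (powRM _ (exprn_ge0 _ _)) ?powR_ge0// -powRrM.
apply: (@le_trans _ _ ((2 * ((4 ^+ n) `^ (1 - s / q) * 2 `^ (k%:~R * n%:R * (1 - s / q))))%:E *
   (A%:E * \int[mu]_y (G y `^ q)) `^ (s / q))).
  rewrite lee_wpmul2l ?lee_fin ?mulr_ge0 ?powR_ge0//.
  apply: le_poweR; [exact: ltW| |].
    by apply: integral_ge0 => y _; rewrite mule_ge0 ?poweR_ge0// lee_fin.
  apply: le_trans H1.
  under eq_integral do rewrite -poweRrM mulrC divfK ?gt_eqF//.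
  apply: integral_indicM_le; [exact: measurable_fat|exact: measurable_poweR_comp|].
  by move=> y; exact: poweR_ge0.
rewrite poweRM ?lee_fin ?(ltW A0)//; last by apply: integral_ge0 => y _; exact: poweR_ge0.
rewrite poweR_EFin muleA -EFinM lee_wpmul2r ?poweR_ge0// lee_fin.
by rewrite le_eqVlt; apply/orP; left; apply/eqP; ring.
Qed.

End herz_estimates.

(** * Summation over the frequencies *)

Section assembly.
Context {R : realType} {n : nat}.
Hypothesis n_gt0 : (0 < n)%N.
Local Notation E := 'rV[R]_n.
Local Notation mu := (lebesgue_rV R n).
Implicit Types (x y z : E) (j N M : nat) (k l : int) (F G : E -> \bar R).
Variables (alpha q s s1 : R).
Hypothesis q1 : (1 <= q)%R.
Hypothesis s0 : (0 < s)%R.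
Hypothesis al0 : (0 <= alpha)%R.
Hypothesis al1 : (alpha < n%:R - n%:R / q)%R.
Hypothesis bal : (n%:R / s - s1 = alpha + n%:R / q)%R.

Let q0 : (0 < q)%R. Proof. exact: lt_le_trans q1. Qed.

Lemma herz_term_pow F k : (\int[mu]_y (shell_cut k F y `^ q)) `^ (s / q) =
  (2 `^ (- (k%:~R * alpha * s)))%:E * herz_term alpha q F k `^ s.
Proof.
rewrite mulrC poweRrM (herz_termK alpha) poweRM ?herz_term_ge0 ?lee_fin ?powR_ge0//.
by rewrite poweR_EFin -powRrM mulNr.
Qed.

(** The s-th power of the j-th term of the Besov norm, w_j * F replacing psi_j
    * f. *)
Definition besov_term N F j : \bar R :=
  (2 `^ (j%:R * s1 * s))%:E * \int[mu]_x (convw N j F x `^ s).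

(** The k-th piece of the diagonal part of the j-th term. *)
Definition near_int N F j k : \bar R :=
  (2 `^ (j%:R * s1 * s))%:E *
  \int[mu]_x ((\1_(fat_annulus k) x)%:E * convw N j (shell_cut k F) x `^ s).

Definition near_sum N F j : \bar R :=
  \esum_(k in [set: int]) (if (- j%:Z < k)%R then near_int N F j k else 0).

Lemma near_int_ge0 N F j k : 0 <= near_int N F j k.
Proof.
rewrite mule_ge0 ?lee_fin ?powR_ge0//; apply: integral_ge0 => x _.
by rewrite mule_ge0 ?poweR_ge0// lee_fin.
Qed.

Lemma near_sum_ge0 N F j : 0 <= near_sum N F j.
Proof. by apply: esum_ge0 => k _; case: ifPn => // _; exact: near_int_ge0. Qed.

Lemma besov_term_ge0 N F j : 0 <= besov_term N F j.
Proof.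
rewrite mule_ge0 ?lee_fin ?powR_ge0//; apply: integral_ge0 => x _; exact: poweR_ge0.
Qed.

Let opp_inj : injective (fun j : nat => - j%:Z)%R.
Proof. by move=> i j /oppr_inj []. Qed.

(** The product part is disposed of: by far_sum its j-th term is a discrete
    convolution of the Herz terms with the kernel 2^(-delta |j+k|), since n/s
    - s1 = alpha + n/q turns the powers of 2 into 2^(j delta). *)
Lemma total_split r M : (0 < r)%R -> (n.+1%:R <= M%:R * s)%R -> (n + n <= M)%N ->
  exists2 C : R, (0 < C)%R & forall F, measurable_fun setT F -> (forall y, 0 <= F y) ->
  \esum_(j in [set: nat]) (besov_term (M + M) F j `^ (r / s)) <=
   C%:E * (\esum_(k in [set: int]) (herz_term alpha q F k `^ r) +
           \esum_(j in [set: nat]) (near_sum (M + M) F j `^ (r / s))).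
Proof.
move=> r0 hM nM.
have [A A0 HA] := convw_Ls_split s0 hM.
have [B B0 HB] := far_sum n_gt0 q1 al0 al1 nM.
have rs0 : (0 < r / s)%R by rewrite divr_gt0.
set d := (n%:R - n%:R / q - alpha)%R in HB *.
have d0 : (0 < d)%R by rewrite subr_gt0.
have [D D0 HD] := esum_geometric_conv opp_inj r0 (pow2N_itv d0).
pose K := (A `^ (r / s) * 2 `^ (r / s))%R.
have K0 : (0 < K)%R by rewrite mulr_gt0 ?powR_gt0.
exists (K * (B `^ r * D + 1))%R => [|F mF F0].
  by rewrite mulr_gt0// addr_gt0// mulr_gt0// powR_gt0.
pose Z j := \esum_(k in [set: int]) (((2 `^ (- d)) ^+ absz (- j%:Z - k)%R)%:E * herz_term alpha q F k).
have Z0 j : 0 <= Z j.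
  by apply: esum_ge0 => k _; rewrite mule_ge0 ?herz_term_ge0// lee_fin exprn_ge0// powR_ge0.
have I0 j : 0 <= \int[mu]_y ((bracket j y ^- M)%:E * F y).
  by apply: integral_ge0 => y _; rewrite mule_ge0// lee_fin bracketVX_ge0.
have step j : besov_term (M + M) F j <= A%:E * ((B%:E * Z j) `^ s + near_sum (M + M) F j).
  apply: (@le_trans _ _ ((2 `^ (j%:R * s1 * s))%:E * (A%:E * ((2 `^ (j%:R * n%:R * (s - 1)))%:E *
      (\int[mu]_y ((bracket j y ^- M)%:E * F y)) `^ s
   + \esum_(k in [set: int]) (if (- j%:Z < k)%R then
        \int[mu]_x ((\1_(fat_annulus k) x)%:E * convw (M + M) j (shell_cut k F) x `^ s) else 0))))).
    by rewrite lee_wpmul2l ?lee_fin ?powR_ge0//; exact: HA.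
  rewrite muleCA lee_wpmul2l ?lee_fin ?(ltW A0)//.
  have e0 k : 0 <= (if (- j%:Z < k)%R then
        \int[mu]_x ((\1_(fat_annulus k) x)%:E * convw (M + M) j (shell_cut k F) x `^ s) else 0).
    by case: ifPn => // _; apply: integral_ge0 => x _; rewrite mule_ge0 ?poweR_ge0// lee_fin.
  rewrite ge0_muleDr; last 2 first.
  - by rewrite mule_ge0 ?poweR_ge0// lee_fin powR_ge0.
  - exact: esum_ge0.
  rewrite -esumZ ?powR_ge0//; apply: leeD; last first.
    by apply: le_esum => k _; rewrite /near_int; case: ifPn => // _; rewrite mule0.
  rewrite muleA -EFinM pow2D.
  (* The balance condition enters here. *)
  rewrite (_ : (j%:R * s1 * s + j%:R * n%:R * (s - 1) = j%:R * d * s)%R); last first.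
    rewrite /d; have -> : (s1 = n%:R / s - alpha - n%:R / q)%R by move: bal; lra.
    by field; rewrite !gt_eqF.
  rewrite powRrM -poweR_EFin -poweRM ?lee_fin ?powR_ge0//.
  apply: le_poweR; [exact: ltW|by rewrite mule_ge0// lee_fin powR_ge0|exact: HB].
have nn0 j := near_sum_ge0 (M + M) F j.
apply: (@le_trans _ _ (\esum_(j in [set: nat]) (K%:E * ((B `^ r)%:E * Z j `^ r + near_sum (M + M) F j `^ (r / s))))).
  apply: le_esum => j _.
  apply: (@le_trans _ _ ((A%:E * ((B%:E * Z j) `^ s + near_sum (M + M) F j)) `^ (r / s))).
    by apply: le_poweR (step j); [exact: ltW|exact: besov_term_ge0].
  rewrite poweRM ?lee_fin ?(ltW A0)//; last by rewrite adde_ge0// poweR_ge0.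
  rewrite poweR_EFin EFinM -muleA lee_wpmul2l ?lee_fin ?powR_ge0//.
  apply: (le_trans (poweRD_le rs0 (poweR_ge0 _ _) (nn0 j))).
  rewrite lee_wpmul2l ?lee_fin ?powR_ge0//; apply: leeD => //.
  rewrite -poweRrM mulrC divfK ?gt_eqF// poweRM ?lee_fin ?(ltW B0)//.
rewrite esumZ ?(ltW K0)//; last first.
  move=> j; rewrite adde_ge0 ?poweR_ge0// mule_ge0 ?poweR_ge0// lee_fin powR_ge0//.
rewrite (EFinM K) -muleA lee_wpmul2l ?lee_fin ?(ltW K0)//.
rewrite esumD; last 2 first.
- by move=> j _; rewrite mule_ge0 ?poweR_ge0// lee_fin powR_ge0.
- by move=> j _; exact: poweR_ge0.
rewrite esumZ ?powR_ge0//; last by move=> j; exact: poweR_ge0.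
set X := \esum_(k in [set: int]) _; set Y := \esum_(j in [set: nat]) (near_sum _ _ j `^ _).
have X0 : 0 <= X by apply: esum_ge0 => k _; exact: poweR_ge0.
have Y0 : 0 <= Y by apply: esum_ge0 => k _; exact: poweR_ge0.
have BD0 : (0 <= B `^ r * D)%R by rewrite mulr_ge0 ?powR_ge0// ltW.
rewrite EFinD ge0_muleDl ?lee_fin// mul1e; apply: leeD; last by rewrite leeDr.
apply: (@le_trans _ _ ((B `^ r * D)%:E * X)); last first.
  by rewrite lee_wpmul2l ?lee_fin// leeDl.
rewrite EFinM -muleA lee_wpmul2l ?lee_fin ?powR_ge0//.
by apply: HD => k; exact: herz_term_ge0.
Qed.

(** The diagonal part only contains indices with j + k > 0, so that a gain of
    2^(-e (j+k)) is a gain of 2^(-e |j+k|). *)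
Lemma near_geometric r N (C e : R) : (0 < r)%R -> (0 < C)%R -> (0 < e)%R ->
  (forall F j k, measurable_fun setT F -> (forall y, 0 <= F y) -> (- j%:Z < k)%R ->
    near_int N F j k <= (C * 2 `^ (- ((j%:R + k%:~R) * e)))%:E * herz_term alpha q F k `^ s) ->
  exists2 C' : R, (0 < C')%R & forall F, measurable_fun setT F -> (forall y, 0 <= F y) ->
  \esum_(j in [set: nat]) (near_sum N F j `^ (r / s)) <=
   C'%:E * \esum_(k in [set: int]) (herz_term alpha q F k `^ r).
Proof.
move=> r0 C0 e0 H; have rs0 : (0 < r / s)%R by rewrite divr_gt0.
have [D D0 HD] := esum_geometric_conv opp_inj rs0 (pow2N_itv e0).
exists (C `^ (r / s) * D)%R => [|F mF F0]; first by rewrite mulr_gt0// powR_gt0.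
pose Z j := \esum_(k in [set: int]) (((2 `^ (- e)) ^+ absz (- j%:Z - k)%R)%:E * herz_term alpha q F k `^ s).
have z0 j k : 0 <= ((2 `^ (- e)) ^+ absz (- j%:Z - k)%R)%:E * herz_term alpha q F k `^ s.
  by rewrite mule_ge0 ?poweR_ge0// lee_fin exprn_ge0// powR_ge0.
have Z0 j : 0 <= Z j by exact: esum_ge0.
apply: (@le_trans _ _ (\esum_(j in [set: nat]) ((C `^ (r / s))%:E * Z j `^ (r / s)))).
  apply: le_esum => j _; rewrite -poweR_EFin -poweRM ?lee_fin ?(ltW C0)//.
  apply: le_poweR; [exact: ltW|exact: near_sum_ge0|].
  rewrite -esumZ ?(ltW C0)//; apply: le_esum => k _.
  case: ifPn => [jk|_]; last by rewrite mule_ge0 ?lee_fin ?(ltW C0).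
  apply: (le_trans (H F j k mF F0 jk)).
  rewrite muleA -EFinM lee_wpmul2r ?poweR_ge0// lee_fin ler_wpM2l ?(ltW C0)//.
  rewrite -(powR_mulrn _ (powR_ge0 _ _)) -powRrM le_eqVlt; apply/orP; left; apply/eqP.
  congr (_ `^ _)%R; rewrite natr_absz ltr0_norm; last by lia.
  by rewrite opprB opprK rmorphD/= mulNr mulrC addrC.
rewrite esumZ ?powR_ge0//; last by move=> j; exact: poweR_ge0.
rewrite EFinM -muleA lee_wpmul2l ?lee_fin ?powR_ge0//.
apply: le_trans (HD (fun k => herz_term alpha q F k `^ s) _) _.
  by move=> k; exact: poweR_ge0.
rewrite lee_wpmul2l ?lee_fin ?(ltW D0)//; apply: le_esum => k _.
by rewrite -poweRrM mulrC divfK// gt_eqF.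
Qed.

(** If q <= s, Young's inequality gives the gain with e = alpha s. *)
Lemma near_high r N : (0 < r)%R -> (n < N)%N -> (q <= s)%R -> (0 < alpha)%R ->
  exists2 C' : R, (0 < C')%R & forall F, measurable_fun setT F -> (forall y, 0 <= F y) ->
  \esum_(j in [set: nat]) (near_sum N F j `^ (r / s)) <=
   C'%:E * \esum_(k in [set: int]) (herz_term alpha q F k `^ r).
Proof.
move=> r0 nN qs a0; have [C C0 HC] := convw_Lq_Ls q1 qs nN.
apply: (@near_geometric r N C (alpha * s)%R) => // [|F j k mF F0 jk].
  by rewrite mulr_gt0.
have mFk := measurable_cut k mF; have Fk0 y : 0 <= shell_cut k F y by exact: cut_ge0.
have mc := measurable_convw N j mFk Fk0.
apply: (@le_trans _ _ ((2 `^ (j%:R * s1 * s))%:E *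
  ((C * 2 `^ (j%:R * n%:R * (s / q - 1)))%:E * (\int[mu]_y (shell_cut k F y `^ q)) `^ (s / q)))).
  rewrite lee_wpmul2l ?lee_fin ?powR_ge0//; apply: le_trans (HC j _ mFk Fk0).
  apply: integral_indicM_le; [exact: measurable_fat|exact: measurable_poweR_comp|].
  by move=> y; exact: poweR_ge0.
rewrite herz_term_pow !muleA -!EFinM lee_wpmul2r ?poweR_ge0// lee_fin.
rewrite mulrCA -!mulrA !pow2D le_eqVlt; apply/orP; left; apply/eqP; congr (_ * (_ `^ _))%R.
have -> : (s1 = n%:R / s - alpha - n%:R / q)%R by move: bal; lra.
by field; rewrite !gt_eqF.
Qed.

(** If s <= q, Hoelder's inequality on the annulus gives the gain with e =
    (alpha - (n/s - n/q)) s. *)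
Lemma near_low r N : (0 < r)%R -> (n < N)%N -> (s <= q)%R -> (n%:R / s - n%:R / q < alpha)%R ->
  exists2 C' : R, (0 < C')%R & forall F, measurable_fun setT F -> (forall y, 0 <= F y) ->
  \esum_(j in [set: nat]) (near_sum N F j `^ (r / s)) <=
   C'%:E * \esum_(k in [set: int]) (herz_term alpha q F k `^ r).
Proof.
move=> r0 nN sq a0; have [C C0 HC] := convw_low q1 s0 sq nN.
apply: (@near_geometric r N C ((alpha - (n%:R / s - n%:R / q)) * s)%R) => // [|F j k mF F0 jk].
  by rewrite mulr_gt0 ?subr_gt0.
have mFk := measurable_cut k mF; have Fk0 y : 0 <= shell_cut k F y by exact: cut_ge0.
apply: (@le_trans _ _ ((2 `^ (j%:R * s1 * s))%:E *
  ((C * 2 `^ (k%:~R * n%:R * (1 - s / q)))%:E * (\int[mu]_y (shell_cut k F y `^ q)) `^ (s / q)))).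
  by rewrite lee_wpmul2l ?lee_fin ?powR_ge0//; exact: HC.
rewrite herz_term_pow !muleA -!EFinM lee_wpmul2r ?poweR_ge0// lee_fin.
rewrite mulrCA -!mulrA !pow2D le_eqVlt; apply/orP; left; apply/eqP; congr (_ * (_ `^ _))%R.
have -> : (s1 = n%:R / s - alpha - n%:R / q)%R by move: bal; lra.
by field; rewrite !gt_eqF.
Qed.

End assembly.

(** * The embedding of Jawerth and Franke *)

Section jawerth_franke.
Context {R : realType} {n : nat}.
Hypothesis n_gt0 : (0 < n)%N.
Local Notation E := 'rV[R]_n.
Local Notation mu := (lebesgue_rV R n).
Implicit Types (x y z : E) (j N M : nat) (k l m i : int) (F G : E -> \bar R).

(** A sum of distinct powers of two is at most twice the largest one. *)
Lemma esum_mem_pow2_le (q : R) : (0 < q)%R -> exists2 C : R, (0 < C)%R &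
  forall M : int -> bool,
  (\esum_(m in [set: int]) (if M m then (2 `^ m%:~R)%:E else 0)) `^ q <=
  C%:E * \esum_(m in [set: int]) (if M m then (2 `^ (m%:~R * q))%:E else 0).
Proof.
move=> q0; have c01 := @pow2N_itv R 1%R ltr01.
have [W W0 HW] := esum_geometric_int c01.
exists (W `^ q)%R => [|M]; first exact: powR_gt0.
set S := \esum_(m in [set: int]) (if M m then (2 `^ (m%:~R * q))%:E else 0).
have t0 m : 0 <= (if M m then (2 `^ (m%:~R * q))%:E else 0) :> \bar R.
  by case: ifPn => // _; rewrite lee_fin powR_ge0.
have u0 m : 0 <= (if M m then (2 `^ m%:~R)%:E else 0) :> \bar R.
  by case: ifPn => // _; rewrite lee_fin powR_ge0.
have tS m : (if M m then (2 `^ (m%:~R * q))%:E else 0) <= S by exact: esum_ge_term.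
have : 0 <= S by exact: esum_ge0.
case ES : S => [v| |]// v0; last by rewrite gt0_muley ?leey// lte_fin powR_gt0.
rewrite lee_fin in v0.
have Mv m : M m -> (2 `^ m%:~R <= v `^ q^-1)%R.
  move=> Mm; have := tS m; rewrite Mm ES lee_fin => h.
  have : ((2 `^ (m%:~R * q)) `^ q^-1 <= v `^ q^-1)%R.
    by rewrite ge0_ler_powR ?nnegrE ?powR_ge0 ?invr_ge0 ?(ltW q0).
  by rewrite -powRrM mulfK ?gt_eqF.
have [v_eq0|v_neq0] := eqVneq v 0%R.
  rewrite esum1 ?poweR0r ?gt_eqF// ?mule_ge0// ?lee_fin ?powR_ge0//.
  move=> m _; case: ifPn => // /Mv; rewrite v_eq0 powR0 ?invr_eq0 ?gt_eqF//.
  by rewrite leNgt powR_gt0.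
have vp : (0 < v `^ q^-1)%R by rewrite powR_gt0// lt_def v_neq0.
have [k /andP[k1 k2]] := exists_dyadic vp.
rewrite -[leRHS](@poweRVK _ q)//; last by rewrite mule_ge0// lee_fin powR_ge0.
apply: le_poweR; [exact: ltW|exact: esum_ge0|].
rewrite poweRM ?lee_fin ?powR_ge0// !poweR_EFin -powRrM mulfV ?gt_eqF// powRr1 ?(ltW W0)//.
rewrite muleC; apply: le_trans (lee_wpmul2l _ (HW (k - 1)%R)); last by rewrite lee_fin ltW.
have c0 (a : nat) : 0 <= ((2 `^ (- 1)) ^+ a)%:E :> \bar R by rewrite lee_fin exprn_ge0// powR_ge0.
rewrite -esumZ ?(ltW vp)//; apply: le_esum => m _.
case: ifPn => [Mm|_]; last by rewrite mule_ge0// lee_fin ltW.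
have mk : (m <= k - 1)%R.
  have := le_lt_trans (Mv m Mm) k2; rewrite pow2Z ltr_pow2 ltr_int; lia.
rewrite -EFinM lee_fin; apply: (@le_trans _ _ (2 ^ (k - 1) * (2 `^ (- 1)) ^+ `|(m - (k - 1))%R|)%R); last first.
  by rewrite ler_wpM2r// exprn_ge0// powR_ge0.
rewrite -(powR_mulrn _ (powR_ge0 _ _)) -powRrM pow2Z pow2D ler_powR ?ler1n//.
rewrite natr_absz ler0_norm ?subr_le0//.
by rewrite mulN1r !rmorphN !rmorphB/=; lra.
Qed.

Lemma convw_indic_le N : (n < N)%N -> exists2 C : R, (0 < C)%R &
  forall j (D : set E), measurable D ->
  [/\ forall x, convw N j (fun y => (\1_D y)%:E) x <= C%:E,
      forall x, convw N j (fun y => (\1_D y)%:E) x <= (2 `^ (j%:R * n%:R))%:E * mu D &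
      \int[mu]_x convw N j (fun y => (\1_D y)%:E) x <= C%:E * mu D].
Proof.
move=> nN; have [A A0 HA] := @integral_wker_le R n.
have [B B0 HB] := @convw_L1 R n.
exists (A + B)%R => [|j D mD]; first by rewrite addr_gt0.
have mi : measurable_fun setT (fun y : E => (\1_D y : R)%:E).
  by apply/measurable_EFinP; exact: measurable_indic.
have i0 y : 0 <= (\1_D y : R)%:E by rewrite lee_fin.
split => [x|x|].
- apply: (@le_trans _ _ A%:E); last by rewrite lee_fin lerDl ltW.
  apply: le_trans (HA j N nN x).1; apply: ge0_le_integral => //.
  + by move=> y _; rewrite mule_ge0 ?lee_fin ?wker_ge0.
  + by apply: emeasurable_funM => //; apply/measurable_EFinP; exact: measurable_wker_sub.
  + by apply/measurable_EFinP; exact: measurable_wker_sub.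
  + move=> y _; rewrite indicE; case: (_ \in _); rewrite ?mule1 ?mule0//.
    by rewrite lee_fin wker_ge0.
- by rewrite -(integral_indicE mD) -natrM -pow2X; exact: convw_le_sup.
- apply: (le_trans (HB j N _ nN mi i0)); rewrite integral_indicE//.
  by rewrite lee_wpmul2r// lee_fin lerDr ltW.
Qed.

Lemma esum_unique_le (I : choiceType) (P : I -> bool) (c : \bar R) : 0 <= c ->
  (forall i k : I, P i -> P k -> i = k) ->
  \esum_(i in [set: I]) (if P i then c else 0) <= c.
Proof.
move=> c0 uP; have [[i Pi]|noP] := pselect (exists i : I, P i); last first.
  by rewrite esum1// => i _; case: ifPn => // Pi; case: noP; exists i.
rewrite (esumID [set i])//=; last by move=> k _; case: ifPn.
rewrite setTI esum_set1 ?Pi// esum1 ?adde0// => k [_ ki].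
by case: ifPn => // Pk; case: ki; exact: uP.
Qed.

Lemma poweR_le_lin (t b : R) (h : \bar R) : (1 <= t)%R -> 0 <= h -> h <= b%:E ->
  h `^ t <= (b `^ (t - 1))%:E * h.
Proof.
move=> t1; have t0 : (0 < t)%R by rewrite (lt_le_trans _ t1).
case: h => [h| |]//.
rewrite !lee_fin => h0 hb; rewrite -(mulr_powRB1 h0 t0) mulrC ler_wpM2r//.
by rewrite ge0_ler_powR ?subr_ge0 ?nnegrE// (le_trans h0).
Qed.

Definition layer (g : E -> R) m : set E := [set x | ((2 : R) ^ (m - 1) <= g x < (2 : R) ^ m)%R].

(** Layers are grouped by the dyadic size of their measure, because the
    interaction of a layer with the frequency j depends on this size and on j
    only. *)
Definition layer_idx (g : E -> R) m i : bool :=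
  ((2 : R) ^ (i - 1) <= fine (mu (layer g m)) < (2 : R) ^ i)%R.

(** The height of the i-th group; for sums of distinct powers of two the sum
    and the l^q norm are comparable, by esum_mem_pow2_le. *)
Definition layer_sum (g : E -> R) i : \bar R :=
  \esum_(m in [set: int]) (if layer_idx g m i then (2 `^ m%:~R)%:E else 0).

Lemma dyadic_unique (t : R) m i : ((2 : R) ^ (m - 1) <= t < (2 : R) ^ m)%R ->
  ((2 : R) ^ (i - 1) <= t < (2 : R) ^ i)%R -> m = i.
Proof.
move=> /andP[h1 h2] /andP[h3 h4]; apply/eqP; rewrite eq_le; apply/andP; split.
  by have := le_lt_trans h1 h4; rewrite lt_expz2 ltrBlDr ltzD1.
by have := le_lt_trans h3 h2; rewrite lt_expz2 ltrBlDr ltzD1.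
Qed.

Section layers.
Variables (g : E -> R).
Hypothesis mg : measurable_fun setT g.
Hypothesis g0 : forall x, (0 <= g x)%R.
Variable q : R.
Hypothesis q1 : (1 < q)%R.
Let q0 : (0 < q)%R. Proof. exact: lt_trans q1. Qed.

Lemma measurable_layer m : measurable (layer g m).
Proof.
rewrite (_ : layer g m = setT `&` g @^-1` `[2 ^ (m - 1), 2 ^ m[%classic); first exact: mg.
by rewrite setTI; apply/seteqP; split => x /=; rewrite in_itv.
Qed.

Lemma measurable_pow_q : measurable_fun setT (fun y => (g y)%:E `^ q).
Proof. by apply: measurable_poweR_comp; exact/measurable_EFinP. Qed.

Let i0 m (y : E) : 0 <= (\1_(layer g m) y : R)%:E. Proof. by rewrite lee_fin. Qed.
Let mi m : measurable_fun setT (fun y : E => (\1_(layer g m) y : R)%:E).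
Proof. by apply/measurable_EFinP; apply: measurable_indic; exact: measurable_layer. Qed.

(** Chebyshev's inequality on a layer. *)
Lemma layer_measure_le m : (2 `^ ((m%:~R - 1) * q))%:E * mu (layer g m) <=
  \int[mu]_y ((\1_(layer g m) y)%:E * (g y)%:E `^ q).
Proof.
have mL := measurable_layer m.
rewrite -integral_indicE// -ge0_integralZl//.
apply: ge0_le_integral => //.
- exact: emeasurable_funM.
- by apply: emeasurable_funM => //; exact: measurable_pow_q.
move=> y _; rewrite indicE; case: (boolP (y \in layer g m)) => [/set_mem/andP[h _]|_] /=; last by rewrite mule0 mul0e.
rewrite mule1 mul1e lee_fin powRrM ge0_ler_powR ?nnegrE ?powR_ge0 ?(ltW q0)//.
by move: h; rewrite pow2Z rmorphB.
Qed.

Lemma layer_integral_sum :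
  \esum_(m in [set: int]) \int[mu]_y ((\1_(layer g m) y)%:E * (g y)%:E `^ q) <=
  \int[mu]_y ((g y)%:E `^ q).
Proof.
have mm m : measurable_fun setT (fun y => (\1_(layer g m) y)%:E * (g y)%:E `^ q).
  by apply: emeasurable_funM => //; exact: measurable_pow_q.
have m0 m y : 0 <= (\1_(layer g m) y)%:E * (g y)%:E `^ q by rewrite mule_ge0 ?poweR_ge0.
rewrite -integral_esum//; apply: ge0_le_integral => //.
- by move=> y _; exact: esum_ge0.
- exact: measurable_fun_esum.
- exact: measurable_pow_q.
move=> y _; apply: le_trans (@esum_unique_le _ (fun m => y \in layer g m) _ (poweR_ge0 _ _) _).
  by apply: le_esum => m _; rewrite indicE; case: (_ \in _); rewrite ?mul1e ?mul0e.
by move=> m i /set_mem/= h1 /set_mem/= h2; exact: dyadic_unique h1 h2.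
Qed.

Lemma esum_layer_ge y : (g y)%:E <= \esum_(m in [set: int]) ((2 `^ m%:~R)%:E * (\1_(layer g m) y)%:E).
Proof.
have [g_eq0|gy] := eqVneq (g y) 0%R.
  by rewrite g_eq0 esum_ge0// => m _; rewrite mule_ge0// lee_fin powR_ge0.
have [m my] : exists m, layer g m y by apply: exists_dyadic; rewrite lt_def gy g0.
apply: le_trans (@esum_ge_term _ _ (fun m => (2 `^ m%:~R)%:E * (\1_(layer g m) y)%:E) m _) => [|i].
  by rewrite indicE mem_set// mule1 lee_fin -pow2Z ltW//; case/andP: my.
by rewrite mule_ge0// lee_fin powR_ge0.
Qed.

Hypothesis gfin : \int[mu]_y ((g y)%:E `^ q) < +oo.

Lemma layer_fin m : mu (layer g m) = (fine (mu (layer g m)))%:E.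
Proof.
rewrite fineK// ge0_fin_numE//.
have h : (2 `^ ((m%:~R - 1) * q))%:E * mu (layer g m) < +oo.
  apply: le_lt_trans (layer_measure_le m) _; apply: le_lt_trans gfin.
  apply: integral_indicM_le; [exact: measurable_layer|exact: measurable_pow_q|].
  by move=> y; exact: poweR_ge0.
move: h; case: (mu _) => [x _| |]//; first by rewrite ltry.
by rewrite gt0_muley// lte_fin powR_gt0.
Qed.

Lemma layer_sum_ge0 i : 0 <= layer_sum g i.
Proof. by apply: esum_ge0 => m _; case: ifPn => // _; rewrite lee_fin powR_ge0. Qed.

End layers.

(** A group with measure about 2^i contributes 2^i (sum of 2^m)^q, which is
    comparable with the sum of 2^(mq) |layer m|; every layer belongs to at
    most one group. *)
Lemma layer_sum_power (q : R) : (1 < q)%R -> exists2 C : R, (0 < C)%R & forall g : E -> R,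
  measurable_fun setT g -> (forall x, (0 <= g x)%R) ->
  \int[mu]_y ((g y)%:E `^ q) < +oo ->
  \esum_(i in [set: int]) ((2 `^ i%:~R)%:E * layer_sum g i `^ q) <=
    C%:E * \int[mu]_y ((g y)%:E `^ q).
Proof.
move=> q1; have q0 : (0 < q)%R by exact: lt_trans q1.
have [C C0 HC] := esum_mem_pow2_le q0.
exists (C * (2 * 2 `^ q))%R => [|g mg g0 gfin]; first by rewrite !mulr_gt0// powR_gt0.
have K0 : (0 <= 2 * 2 `^ q :> R)%R by rewrite mulr_ge0// powR_ge0.
pose X m := (2 * 2 `^ q)%:E * \int[mu]_y ((\1_(layer g m) y)%:E * (g y)%:E `^ q).
have I0 m : 0 <= \int[mu]_y ((\1_(layer g m) y)%:E * (g y)%:E `^ q).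
  by apply: integral_ge0 => y _; rewrite mule_ge0 ?poweR_ge0// lee_fin.
have X0 m : 0 <= X m by rewrite mule_ge0.
have x0 m i : 0 <= (if layer_idx g m i then X m else 0) by case: ifPn.
apply: (@le_trans _ _ (\esum_(i in [set: int]) (C%:E * \esum_(m in [set: int]) (if layer_idx g m i then X m else 0)))).
  apply: le_esum => i _.
  apply: (@le_trans _ _ ((2 `^ i%:~R)%:E * (C%:E * \esum_(m in [set: int]) (if layer_idx g m i then (2 `^ (m%:~R * q))%:E else 0)))).
    by rewrite lee_wpmul2l ?lee_fin ?powR_ge0//; exact: HC.
  rewrite muleCA lee_wpmul2l ?lee_fin ?(ltW C0)//.
  have t0 m : 0 <= (if layer_idx g m i then (2 `^ (m%:~R * q))%:E else 0) :> \bar R.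
    by case: ifPn => // _; rewrite lee_fin powR_ge0.
  rewrite -esumZ ?powR_ge0//; apply: le_esum => m _.
  case: ifPn => [mi|_]; last by rewrite mule0.
  apply: (@le_trans _ _ ((2 * 2 `^ q)%:E * ((2 `^ ((m%:~R - 1) * q))%:E * mu (layer g m)))); last first.
    by rewrite lee_wpmul2l ?lee_fin//; exact: layer_measure_le.
  have -> : mu (layer g m) = (fine (mu (layer g m)))%:E by eapply layer_fin; eauto.
  rewrite -!EFinM lee_fin.
  have /andP[h _] := mi.
  apply: (@le_trans _ _ ((2 * 2 `^ q) * (2 `^ ((m%:~R - 1) * q) * 2 ^ (i - 1)))%R); last first.
    by rewrite ler_wpM2l// ler_wpM2l// powR_ge0.
  rewrite pow2Z rmorphB/= -[X in (_ <= X * _ * _)%R](powRr1 (ler0n R 2)) !pow2D.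
  by rewrite ler_powR ?ler1n// le_eqVlt; apply/orP; left; apply/eqP; ring.
rewrite esumZ ?(ltW C0)//; last by move=> i; exact: esum_ge0.
rewrite EFinM -muleA lee_wpmul2l ?lee_fin ?(ltW C0)//.
rewrite exchange_esum//.
apply: (@le_trans _ _ (\esum_(m in [set: int]) X m)).
  apply: le_esum => m _; apply: esum_unique_le => // i k h1 h2.
  exact: dyadic_unique h1 h2.
rewrite /X esumZ// lee_wpmul2l ?lee_fin//; exact: layer_integral_sum.
Qed.

Definition layer_conv N j (g : E -> R) i x : \bar R :=
  \esum_(m in [set: int]) (if layer_idx g m i then
     (2 `^ m%:~R)%:E * convw N j (fun y => (\1_(layer g m) y)%:E) x else 0).

Section layer_conv_theory.
Variables (N : nat) (q : R) (g : E -> R).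
Hypothesis nN : (n < N)%N.
Hypothesis q1 : (1 < q)%R.
Hypothesis mg : measurable_fun setT g.
Hypothesis g0 : forall x, (0 <= g x)%R.
Hypothesis gfin : \int[mu]_y ((g y)%:E `^ q) < +oo.

Let iL m (y : E) : 0 <= (\1_(layer g m) y : R)%:E. Proof. by rewrite lee_fin. Qed.
Let miL m : measurable_fun setT (fun y : E => (\1_(layer g m) y : R)%:E).
Proof. by apply/measurable_EFinP; apply: measurable_indic; exact: measurable_layer. Qed.

Let cL0 j m x : 0 <= convw N j (fun y => (\1_(layer g m) y)%:E) x.
Proof. exact: convw_ge0. Qed.

Let t0 j m i x : 0 <= (if layer_idx g m i then
  (2 `^ m%:~R)%:E * convw N j (fun y => (\1_(layer g m) y)%:E) x else 0).
Proof. by case: ifPn => // _; rewrite mule_ge0// lee_fin powR_ge0. Qed.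

Let mt j m i : measurable_fun setT (fun x => if layer_idx g m i then
  (2 `^ m%:~R)%:E * convw N j (fun y => (\1_(layer g m) y)%:E) x else 0).
Proof.
case: (layer_idx g m i) => //; apply: emeasurable_funM => //; exact: measurable_convw.
Qed.

Lemma layer_conv_ge0 j i x : 0 <= layer_conv N j g i x.
Proof. exact: esum_ge0. Qed.

Lemma measurable_layer_conv j i : measurable_fun setT (layer_conv N j g i).
Proof. exact: measurable_fun_esum. Qed.

Lemma convw_le_layers j x :
  convw N j (EFin \o g) x <= \esum_(i in [set: int]) layer_conv N j g i x.
Proof.
have w0 y : 0 <= (wker N j (x - y)%R)%:E by rewrite lee_fin wker_ge0.
have mw : measurable_fun setT (fun y => (wker N j (x - y)%R)%:E).
  by apply/measurable_EFinP; exact: measurable_wker_sub.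
have p0 m : 0 <= (2 `^ m%:~R : R)%:E by rewrite lee_fin powR_ge0.
apply: (@le_trans _ _ (\esum_(m in [set: int]) ((2 `^ m%:~R)%:E * convw N j (fun y => (\1_(layer g m) y)%:E) x))).
  apply: (@le_trans _ _ (\int[mu]_y (\esum_(m in [set: int]) ((2 `^ m%:~R)%:E * ((wker N j (x - y)%R)%:E * (\1_(layer g m) y)%:E))))).
    apply: ge0_le_integral => //.
    - by move=> y _; rewrite mule_ge0// lee_fin.
    - by apply: emeasurable_funM => //; exact/measurable_EFinP.
    - apply: measurable_fun_esum => [m|m y].
        by apply: emeasurable_funM => //; exact: emeasurable_funM.
      by rewrite mule_ge0// mule_ge0.
    move=> y _; under eq_esum do rewrite muleCA.
    rewrite esumZ ?wker_ge0//.
    by rewrite lee_wpmul2l//; exact: esum_layer_ge.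
  rewrite integral_esum; last 2 first.
  - by move=> m; apply: emeasurable_funM => //; exact: emeasurable_funM.
  - by move=> m y; rewrite mule_ge0// mule_ge0.
  apply: le_esum => m _; rewrite ge0_integralZl//; first exact: emeasurable_funM.
  by move=> y _; rewrite mule_ge0.
rewrite /layer_conv exchange_esum//; apply: le_esum => m _.
have LF : mu (layer g m) = (fine (mu (layer g m)))%:E by eapply layer_fin; eauto.
have [u_eq0|u_neq0] := eqVneq (fine (mu (layer g m))) 0%R.
  apply: le_trans (_ : 0 <= _); last exact: esum_ge0.
  rewrite (_ : convw _ _ _ _ = 0) ?mule0//; apply/eqP; rewrite eq_le cL0 andbT.
  have [C _ /(_ j _ (measurable_layer mg m))[_ /(_ x) h _]] := convw_indic_le nN.
  by apply: (le_trans h); rewrite LF u_eq0 mule0.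
have [i mi] : exists i, layer_idx g m i.
  by apply: exists_dyadic; rewrite lt_def u_neq0 fine_ge0.
apply: le_trans (@esum_ge_term _ _ _ i (fun i => t0 j m i x)).
by rewrite mi.
Qed.

(** Each bound is that of convw_indic_le for one layer, summed over the group.
    *)
Lemma layer_conv_le (C : R) : (0 < C)%R ->
  (forall j (D : set E), measurable D ->
    [/\ forall x, convw N j (fun y => (\1_D y)%:E) x <= C%:E,
      forall x, convw N j (fun y => (\1_D y)%:E) x <= (2 `^ (j%:R * n%:R))%:E * mu D &
      \int[mu]_x convw N j (fun y => (\1_D y)%:E) x <= C%:E * mu D]) ->
  forall j i,
  [/\ forall x, layer_conv N j g i x <= C%:E * layer_sum g i,
      forall x, layer_conv N j g i x <= (2 `^ (j%:R * n%:R + i%:~R))%:E * layer_sum g i &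
      \int[mu]_x layer_conv N j g i x <= (C * 2 `^ i%:~R)%:E * layer_sum g i].
Proof.
move=> C0 HC j i.
have s0 m : 0 <= (if layer_idx g m i then (2 `^ m%:~R)%:E else 0) :> \bar R.
  by case: ifPn => // _; rewrite lee_fin powR_ge0.
have LF m : mu (layer g m) = (fine (mu (layer g m)))%:E by eapply layer_fin; eauto.
split => [x|x|].
- rewrite -esumZ ?(ltW C0)//; apply: le_esum => m _.
  case: ifPn => [_|_]; last by rewrite mule0.
  rewrite muleC lee_wpmul2r ?lee_fin ?powR_ge0//.
  by have [h _ _] := HC j _ (measurable_layer mg m).
- rewrite -esumZ ?powR_ge0//; apply: le_esum => m _.
  case: ifPn => [/andP[_ /ltW mi]|_]; last by rewrite mule0.
  rewrite muleC lee_wpmul2r ?lee_fin ?powR_ge0//.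
  have [_ h _] := HC j _ (measurable_layer mg m); apply: (le_trans (h x)).
  by rewrite LF -EFinM lee_fin -pow2D ler_wpM2l ?powR_ge0// -pow2Z.
rewrite integral_esum//.
rewrite -esumZ ?mulr_ge0 ?powR_ge0 ?(ltW C0)//; apply: le_esum => m _.
case: (boolP (layer_idx g m i)) => [/andP[_ /ltW mi]|_]; last by rewrite integral0 mule0.
rewrite ge0_integralZl//; last exact: measurable_convw.
rewrite muleC lee_wpmul2r ?lee_fin ?powR_ge0//.
have [_ _ h] := HC j _ (measurable_layer mg m); apply: (le_trans h).
by rewrite LF -EFinM lee_fin ler_wpM2l ?(ltW C0)// -pow2Z.
Qed.

End layer_conv_theory.

(** Integrate h^s <= (sup h)^(s-1) h, with the first of the two supremum
    bounds C T and 2^(jn+i) T if jn + i >= 0 and with the second one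
    otherwise. As s > q > 1, either choice leaves a negative power of
    2^|jn+i|. *)
Lemma layer_conv_power (q s : R) N : (n < N)%N -> (1 < q)%R -> (q < s)%R ->
  exists2 C : R, (0 < C)%R & forall g : E -> R,
  measurable_fun setT g -> (forall x, (0 <= g x)%R) ->
  \int[mu]_y ((g y)%:E `^ q) < +oo -> forall j i,
  (2 `^ (j%:R * (n%:R / s - n%:R / q) * s))%:E * \int[mu]_x (layer_conv N j g i x `^ s) <=
  C%:E * ((2 `^ (- Num.min (s / q - 1) (s - s / q))) ^+ absz (- (j%:Z * n%:Z) - i)%R)%:E *
    ((2 `^ i%:~R)%:E * layer_sum g i `^ q) `^ (s / q).
Proof.
move=> nN q1 qs; have q0 : (0 < q)%R by exact: lt_trans q1.
have s1 : (1 < s)%R by exact: lt_trans qs.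
have s0 : (0 < s)%R by exact: lt_trans s1.
have [A A0 HA] := convw_indic_le nN.
have [B B0 HB] := layer_sum_power q1.
exists (A `^ s + A)%R => [|g mg g0 gfin j i]; first by rewrite addr_gt0// powR_gt0.
have [h1 h2 h3] := layer_conv_le q1 mg g0 gfin A0 HA j i.
have L0 x : 0 <= layer_conv N j g i x by eapply layer_conv_ge0; eauto.
have mL : measurable_fun setT (layer_conv N j g i) by eapply measurable_layer_conv; eauto.
set eta := Num.min _ _.
have Tfin : (2 `^ i%:~R)%:E * layer_sum g i `^ q < +oo.
  apply: (@le_lt_trans _ _ (B%:E * \int[mu]_y ((g y)%:E `^ q))); last first.
    by rewrite lte_mul_pinfty// lee_fin ltW.
  apply: le_trans (HB g mg g0 gfin).
  apply: (@esum_ge_term _ _ (fun i => (2 `^ i%:~R)%:E * layer_sum g i `^ q)) => k.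
  by rewrite mule_ge0 ?poweR_ge0// lee_fin powR_ge0.
have := layer_sum_ge0 g i.
case ET : (layer_sum g i) => [t| |]// t0; last first.
  by move: Tfin; rewrite ET poweRyr ?gt_eqF// gt0_muley// lte_fin powR_gt0.
rewrite lee_fin in t0; rewrite ET -EFinM in h1 h3.
have {}h2 x : layer_conv N j g i x <= (2 `^ (j%:R * n%:R + i%:~R) * t)%:E.
  by rewrite EFinM -ET.
set m := (j%:Z * n%:Z + i)%R.
have mE : (j%:R * n%:R + i%:~R = m%:~R :> R)%R by rewrite /m rmorphD rmorphM.
have key (S : R) : (0 <= S)%R -> (forall x, layer_conv N j g i x <= (S * t)%:E) ->
  \int[mu]_x (layer_conv N j g i x `^ s) <= ((S * t) `^ (s - 1) * (A * 2 `^ i%:~R * t))%:E.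
  move=> S0 hS.
  apply: (@le_trans _ _ (\int[mu]_x (((S * t) `^ (s - 1))%:E * layer_conv N j g i x))).
    apply: ge0_le_integral => //.
    - by move=> x _; exact: poweR_ge0.
    - exact: measurable_poweR_comp.
    - exact: emeasurable_funM.
    - by move=> x _; apply: poweR_le_lin => //; exact: ltW.
  by rewrite ge0_integralZl ?lee_fin ?powR_ge0// EFinM lee_wpmul2l ?lee_fin ?powR_ge0.
have dE : (- (j%:Z * n%:Z) - i = - m)%R by rewrite /m opprD.
have TE : ((2 `^ i%:~R)%:E * t%:E `^ q) `^ (s / q) = (2 `^ (i%:~R * (s / q)) * t `^ s)%:E.
  rewrite poweR_EFin -EFinM poweR_EFin powRM ?powR_ge0// -!powRrM.
  by rewrite [(q * _)%R]mulrC divfK ?gt_eqF.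
rewrite TE.
rewrite dE abszN -(powR_mulrn _ (powR_ge0 _ _)) -powRrM natr_absz.
have expo : (j%:R * (n%:R / s - n%:R / q) * s + i%:~R = m%:~R * (1 - s / q) + i%:~R * (s / q))%R.
  by rewrite -mE; field; rewrite !gt_eqF.
(* Both supremum bounds lead to a bound of this form, with e the exponent of
   2 that remains once (2^i T^q)^(s/q) is split off. *)
have fin (a e : R) : (0 <= a)%R -> (a <= A `^ s + A)%R -> (e <= - eta * `|m|%:~R)%R ->
  (a * 2 `^ e * (2 `^ (i%:~R * (s / q)) * t `^ s) <=
   (A `^ s + A) * 2 `^ (- eta * `|m|%:~R) * (2 `^ (i%:~R * (s / q)) * t `^ s))%R.
  move=> a0 aA ee; rewrite ler_wpM2r ?mulr_ge0 ?powR_ge0// ler_pM ?powR_ge0//.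
  by rewrite ler_powR// ler1n.
have eta1 : (eta <= s / q - 1)%R by rewrite /eta ge_min lexx.
have eta2 : (eta <= s - s / q)%R by rewrite /eta ge_min lexx orbT.
have [m0|m0] := leP 0%R m.
  apply: (le_trans (lee_wpmul2l _ (key A (ltW A0) h1))); first by rewrite lee_fin powR_ge0.
  rewrite -!EFinM lee_fin; apply: le_trans (fin (A `^ s)%R (m%:~R * (1 - s / q))%R _ _ _).
  - rewrite -(mulr_powRB1 (ltW A0) s0) -(mulr_powRB1 t0 s0) powRM ?(ltW A0)//.
    rewrite le_eqVlt; apply/orP; left; apply/eqP.
    transitivity (A * A `^ (s - 1) * (t * t `^ (s - 1)) *
      (2 `^ (j%:R * (n%:R / s - n%:R / q) * s) * 2 `^ i%:~R))%R; first ring.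
    by rewrite pow2D expo -pow2D; ring.
  - exact: powR_ge0.
  - by rewrite lerDl ltW.
  - rewrite ger0_norm// [X in (_ <= X)%R]mulrC ler_wpM2l ?ler0z//; lra.
have p0 := powR_ge0 (2 : R) m%:~R.
have h2' x : layer_conv N j g i x <= (2 `^ m%:~R * t)%:E by rewrite -mE; exact: h2.
apply: (le_trans (lee_wpmul2l _ (key _ p0 h2'))); first by rewrite lee_fin powR_ge0.
rewrite -!EFinM lee_fin; apply: le_trans (fin A (m%:~R * (s - s / q))%R _ _ _).
- rewrite -(mulr_powRB1 t0 s0) powRM// -powRrM.
  rewrite le_eqVlt; apply/orP; left; apply/eqP.
  transitivity (A * (t * t `^ (s - 1)) *
    (2 `^ (j%:R * (n%:R / s - n%:R / q) * s) * 2 `^ i%:~R * 2 `^ (m%:~R * (s - 1))))%R; first ring.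
  rewrite !pow2D expo (_ : m%:~R * (1 - s / q) + i%:~R * (s / q) + m%:~R * (s - 1) =
    m%:~R * (s - s / q) + i%:~R * (s / q))%R; last ring.
  by rewrite -pow2D; ring.
- exact: ltW.
- by rewrite lerDr powR_ge0.
- rewrite ltr0_norm// rmorphN/= mulrNN mulrC -subr_ge0 -mulrBl.
  by rewrite mulr_le0 ?subr_le0// ltW// ltrz0.
Qed.

(** The groups are summed with esum_weighted, half of the gain in |jn+i| being
    spent; the remaining gain makes the sum over j a discrete convolution in
    the variable -jn. *)
Lemma jawerth_franke (q s r : R) N : (n < N)%N -> (1 < q)%R -> (q < s)%R -> (q <= r)%R ->
  exists2 C : R, (0 < C)%R & forall g : E -> R,
  measurable_fun setT g -> (forall x, (0 <= g x)%R) ->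
  \esum_(j in [set: nat]) (((2 `^ (j%:R * (n%:R / s - n%:R / q) * s))%:E *
     \int[mu]_x (convw N j (EFin \o g) x `^ s)) `^ (r / s)) <=
  C%:E * (\int[mu]_y ((g y)%:E `^ q)) `^ (r / q).
Proof.
move=> nN q1 qs qr; have q0 : (0 < q)%R by exact: lt_trans q1.
have s1 : (1 < s)%R by exact: lt_trans qs.
have s0 : (0 < s)%R by exact: lt_trans s1.
have r0 : (0 < r)%R by exact: lt_le_trans qr.
have rs0 : (0 < r / s)%R by rewrite divr_gt0.
have [A A0 HA] := layer_conv_power nN q1 qs.
have [B B0 HB] := layer_sum_power q1.
set eta := Num.min _ _ in HA.
have eta0 : (0 < eta)%R.
  rewrite /eta lt_min !subr_gt0 ltr_pdivlMr// mul1r qs/=.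
  by rewrite ltr_pdivrMr// ltr_pMr.
have e20 : (0 < eta / 2)%R by rewrite divr_gt0.
have [W W0 HW] := esum_geometric_int (@pow2N_itv R (eta / 2 / s)%R (divr_gt0 e20 s0)).
pose phi (j : nat) : int := (- (j%:Z * n%:Z))%R.
have iphi : injective phi.
  by move=> i j /oppr_inj/eqP; rewrite -!PoszM eqz_nat eqn_pmul2r// => /eqP.
have [D D0 HD] := esum_geometric_conv iphi rs0 (pow2N_itv e20).
exists ((W `^ s * A) `^ (r / s) * (D * B `^ (r / q)))%R => [|g mg g0].
  by rewrite !mulr_gt0 ?powR_gt0// mulr_gt0// powR_gt0.
have [gfin|] := ltP (\int[mu]_y ((g y)%:E `^ q)) +oo; last first.
  rewrite leye_eq => /eqP ->; rewrite poweRyr; last by rewrite gt_eqF// divr_gt0.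
  by rewrite gt0_muley ?leey// lte_fin !mulr_gt0 ?powR_gt0// mulr_gt0// powR_gt0.
pose T i := (2 `^ i%:~R)%:E * layer_sum g i `^ q.
have T0 i : 0 <= T i by rewrite mule_ge0 ?poweR_ge0// lee_fin powR_ge0.
have L0 j i x : 0 <= layer_conv N j g i x by eapply layer_conv_ge0; eauto.
have mL j i : measurable_fun setT (layer_conv N j g i) by eapply measurable_layer_conv; eauto.
have LL j x : convw N j (EFin \o g) x <= \esum_(i in [set: int]) layer_conv N j g i x.
  exact: (convw_le_layers nN q1 mg g0 gfin).
have mge : measurable_fun setT (EFin \o g) by exact/measurable_EFinP.
have ge0 y : 0 <= (EFin \o g) y by rewrite lee_fin.
pose w j i : R := ((2 `^ (eta / 2)) ^+ absz (phi j - i)%R)%R.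
have w0 j i : (0 < w j i)%R by rewrite exprn_gt0// powR_gt0.
pose Z j := \esum_(i in [set: int]) (((2 `^ (- (eta / 2))) ^+ absz (phi j - i)%R)%:E * T i `^ (s / q)).
have z0 j i : 0 <= ((2 `^ (- (eta / 2))) ^+ absz (phi j - i)%R)%:E * T i `^ (s / q).
  by rewrite mule_ge0 ?poweR_ge0// lee_fin exprn_ge0// powR_ge0.
have Z0 j : 0 <= Z j by exact: esum_ge0.
have mLs j i : measurable_fun setT (fun x => (w j i)%:E * layer_conv N j g i x `^ s).
  by apply: emeasurable_funM => //; exact: measurable_poweR_comp.
have Ls0 j i x : 0 <= (w j i)%:E * layer_conv N j g i x `^ s.
  by rewrite mule_ge0 ?poweR_ge0// lee_fin ltW.
have step j : (2 `^ (j%:R * (n%:R / s - n%:R / q) * s))%:E *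
     \int[mu]_x (convw N j (EFin \o g) x `^ s) <= (W `^ s * A)%:E * Z j.
  apply: (@le_trans _ _ ((2 `^ (j%:R * (n%:R / s - n%:R / q) * s))%:E *
     \int[mu]_x ((W `^ s)%:E * \esum_(i in [set: int]) ((w j i)%:E * layer_conv N j g i x `^ s)))).
    rewrite lee_wpmul2l ?lee_fin ?powR_ge0//; apply: ge0_le_integral => //.
    - by move=> x _; exact: poweR_ge0.
    - by apply: measurable_poweR_comp; exact: measurable_convw.
    - by apply: emeasurable_funM => //; exact: measurable_fun_esum.
    move=> x _; apply: (@le_trans _ _ ((\esum_(i in [set: int]) layer_conv N j g i x) `^ s)).
      by apply: le_poweR (LL j x); [exact: ltW|exact: convw_ge0].
    apply: esum_weighted => //.
    apply: le_trans (HW (phi j)); apply: le_esum => i _; rewrite lee_fin /w.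
    rewrite -(powR_mulrn _ (powR_ge0 _ _)) -(powR_mulrn _ (powR_ge0 2 (- (eta / 2 / s)))) -!powRrM.
    rewrite distnC le_eqVlt; apply/orP; left; apply/eqP; congr (_ `^ _)%R.
    by field; rewrite gt_eqF.
  rewrite ge0_integralZl//; last 3 first.
  - exact: measurable_fun_esum.
  - by move=> x _; exact: esum_ge0.
  - by rewrite lee_fin powR_ge0.
  rewrite muleCA EFinM -muleA lee_wpmul2l ?lee_fin ?powR_ge0//.
  rewrite integral_esum// -!esumZ ?powR_ge0 ?(ltW A0)//; last by move=> i; exact: integral_ge0.
  apply: le_esum => i _.
  rewrite ge0_integralZl//; last 3 first.
  - exact: measurable_poweR_comp.
  - by move=> x _; exact: poweR_ge0.
  - by rewrite lee_fin ltW.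
  rewrite muleCA; apply: (le_trans (lee_wpmul2l _ (HA g mg g0 gfin j i))).
    by rewrite lee_fin ltW.
  rewrite -/(T i) !muleA lee_wpmul2r ?poweR_ge0// -!EFinM lee_fin -mulrA mulrCA ler_wpM2l ?(ltW A0)//.
  rewrite /w -/(phi j) -exprMn pow2D (_ : eta / 2 + - eta = - (eta / 2))%R//; by field.
apply: (@le_trans _ _ (\esum_(j in [set: nat]) (((W `^ s * A) `^ (r / s))%:E * Z j `^ (r / s)))).
  apply: le_esum => j _.
  have WA0 : (0 <= W `^ s * A)%R by rewrite mulr_ge0 ?powR_ge0// ltW.
  rewrite (_ : ((W `^ s * A) `^ (r / s))%:E * Z j `^ (r / s) =
    ((W `^ s * A)%:E * Z j) `^ (r / s)); last by rewrite poweRM// poweR_EFin.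
  apply: le_poweR (step j); first exact: ltW.
  by rewrite mule_ge0 ?lee_fin ?powR_ge0//; apply: integral_ge0 => x _; exact: poweR_ge0.
rewrite esumZ ?powR_ge0//; last by move=> j; exact: poweR_ge0.
rewrite EFinM -muleA lee_wpmul2l ?lee_fin ?powR_ge0//.
apply: le_trans (HD (fun i => T i `^ (s / q)) _) _; first by move=> i; exact: poweR_ge0.
rewrite EFinM -muleA lee_wpmul2l ?lee_fin ?(ltW D0)//.
apply: (@le_trans _ _ (\esum_(i in [set: int]) (T i `^ (r / q)))).
  apply: le_esum => i _; rewrite -poweRrM mulrC mulrA divfK ?gt_eqF//.
have rq1 : (1 <= r / q)%R by rewrite ler_pdivlMr// mul1r.
apply: (le_trans (esum_poweR_le rq1 T0)).
rewrite -poweR_EFin -poweRM ?lee_fin ?(ltW B0)//; last first.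
  by apply: integral_ge0 => y _; exact: poweR_ge0.
apply: le_poweR (HB g mg g0 gfin); first by rewrite divr_ge0 ?ltW.
by apply: esum_ge0 => i _; exact: T0.
Qed.

End jawerth_franke.

(** * The estimate for positive functions *)

Section positive_embedding.
Context {R : realType} {n : nat}.
Hypothesis n_gt0 : (0 < n)%N.
Local Notation E := 'rV[R]_n.
Local Notation mu := (lebesgue_rV R n).
Implicit Types (x y z : E) (j N M : nat) (k l : int) (F G : E -> \bar R).

Lemma shell_cut_EFin (g : E -> R) k :
  shell_cut k (EFin \o g) = EFin \o (fun y => g y * \1_(dyadic_annulus k) y)%R.
Proof. by apply/funext => y; rewrite /shell_cut /= EFinM. Qed.

(** For alpha = 0 the exponent r/s <= 1 allows the sum over k to be taken out
    of the power; the sum over j of every single piece is bounded by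
    jawerth_franke. *)
Lemma near_critical (q s s1 r : R) N : (n < N)%N -> (1 < q)%R -> (q < s)%R ->
  (q <= r)%R -> (r <= s)%R -> (n%:R / s - s1 = n%:R / q)%R ->
  exists2 C : R, (0 < C)%R & forall g : E -> R,
  measurable_fun setT g -> (forall y, (0 <= g y)%R) ->
  \esum_(j in [set: nat]) (near_sum s s1 N (EFin \o g) j `^ (r / s)) <=
   C%:E * \esum_(k in [set: int]) (herz_term 0 q (EFin \o g) k `^ r).
Proof.
move=> nN q1 qs qr rs bal.
have q0 : (0 < q)%R by exact: lt_trans q1.
have s0 : (0 < s)%R by exact: lt_trans qs.
have r0 : (0 < r)%R by exact: lt_le_trans qr.
have rs0 : (0 < r / s)%R by rewrite divr_gt0.
have [C C0 HC] := jawerth_franke n_gt0 nN q1 qs qr.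
exists C => // g mg g0.
have mge : measurable_fun setT (EFin \o g) by exact/measurable_EFinP.
have ge0 y : 0 <= (EFin \o g) y by rewrite lee_fin.
pose b j k := besov_term s s1 N (shell_cut k (EFin \o g)) j.
have b0 j k : 0 <= b j k by exact: besov_term_ge0.
apply: (@le_trans _ _ (\esum_(j in [set: nat]) \esum_(k in [set: int]) (b j k `^ (r / s)))).
  apply: le_esum => j _.
  apply: (@le_trans _ _ ((\esum_(k in [set: int]) b j k) `^ (r / s))).
    apply: le_poweR; [exact: ltW|exact: near_sum_ge0|].
    apply: le_esum => k _; case: ifPn => // _.
    rewrite lee_wpmul2l ?lee_fin ?powR_ge0//; apply: integral_indicM_le.
    - exact: measurable_fat.
    - apply: measurable_poweR_comp; apply: measurable_convw; first exact: measurable_cut.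
      by move=> y; exact: cut_ge0.
    - by move=> y; exact: poweR_ge0.
  by apply: esum_poweR_ge => //; rewrite rs0/= ler_pdivrMr// mul1r.
rewrite exchange_esum; last by move=> j k; exact: poweR_ge0.
rewrite -esumZ ?(ltW C0)//; last by move=> k; exact: poweR_ge0.
apply: le_esum => k _.
rewrite /b shell_cut_EFin.
set gk := (fun y => _ * _)%R.
have mgk : measurable_fun setT gk.
  by apply: measurable_funM => //; apply: measurable_indic; exact: measurable_annulus.
have gk0 y : (0 <= gk y)%R by rewrite mulr_ge0.
have -> : herz_term 0 q (EFin \o g) k `^ r = (\int[mu]_y ((gk y)%:E `^ q)) `^ (r / q).
  by rewrite /herz_term mulr0 powRr0 mul1e -poweRrM mulrC shell_cut_EFin.
apply: le_trans (HC gk mgk gk0); apply: le_esum => j _.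
by rewrite /besov_term (_ : s1 = n%:R / s - n%:R / q)%R//; move: bal; lra.
Qed.

Lemma mule_cancel (a b K : R) (X Y : \bar R) : (0 < a)%R -> (a * b = 1)%R ->
  b%:E * X <= K%:E * Y -> X <= (K * a)%:E * Y.
Proof.
move=> a0 ab key; rewrite -[X]mul1e -ab [(K * a)%R]mulrC !EFinM -!muleA.
by apply: lee_wpmul2l; rewrite // lee_fin ltW.
Qed.

(** Average convw_shift over a cube with corner x and side 2^(-j). *)
Lemma convw_sup_le (p : R) N : (0 < p)%R -> exists2 C : R, (0 < C)%R & forall j F x,
  measurable_fun setT F -> (forall y, 0 <= F y) ->
  convw N j F x `^ p <= (C * 2 `^ (j%:R * n%:R))%:E * \int[mu]_y (convw N j F y `^ p).
Proof.
move=> p0.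
exists (((1 + n%:R) ^+ N) `^ p)%R => [|j F x mF F0].
  by rewrite powR_gt0// exprn_gt0// ltr_wpDr.
pose h : R := (2 ^- j)%R.
have h0 : (0 < h)%R by rewrite invr_gt0 exprn_gt0.
pose D : set E := [set y | forall i, (x ord0 i < y ord0 i <= (x + const_mx h)%R ord0 i)%R].
have mD : measurable D.
  rewrite (_ : D = \bigcap_(i in [set: 'I_n])
    ((fun y : 'rV[R]_n => y ord0 i) @^-1` `]x ord0 i, (x + const_mx h)%R ord0 i])); last first.
    apply/seteqP; split => [y xuv i _ /=|y xuv i]; first by have := xuv i; rewrite in_itv/=.
    by have := xuv i Logic.I; rewrite /= in_itv.
  apply: fin_bigcap_measurable => // i _.
  by rewrite -[X in measurable X]setTI; exact: measurable_rV_coord.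
have DE : mu D = (2 `^ (- (j%:R * n%:R)))%:E.
  rewrite lebesgue_rV_box => [|i]; last by rewrite !mxE lerDl ltW.
  congr EFin; rewrite (eq_bigr (fun=> h)); last by move=> i _; rewrite !mxE addrAC subrr add0r.
  by rewrite prodr_const card_ord /h -exprVn exprVn -exprVn -exprM exprVn pow2X natrM powRN.
have mc : measurable_fun setT (convw N j F) by exact: measurable_convw.
have c0 y : 0 <= convw N j F y by exact: convw_ge0.
pose K : R := (((1 + n%:R) ^+ N) `^ p)%R.
have K0 : (0 < K)%R by rewrite powR_gt0// exprn_gt0// ltr_wpDr.
have key : (2 `^ (- (j%:R * n%:R)))%:E * convw N j F x `^ p <= K%:E * \int[mu]_y (convw N j F y `^ p).
  rewrite -DE muleC -integral_indicE// -ge0_integralZl//; last 2 first.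
  - by apply/measurable_EFinP; exact: measurable_indic.
  - exact: poweR_ge0.
  rewrite -ge0_integralZl//; try (by exact: measurable_poweR_comp);
    try (by move=> y _; exact: poweR_ge0); try (by rewrite lee_fin ltW).
  apply: ge0_le_integral => //.
  - by move=> y _; rewrite mule_ge0 ?poweR_ge0// lee_fin.
  - by apply: emeasurable_funM => //; apply/measurable_EFinP; exact: measurable_indic.
  - by apply: emeasurable_funM => //; exact: measurable_poweR_comp.
  move=> y _; rewrite indicE; have [yD|_] := boolP (y \in D); last first.
    by rewrite mule0 mule_ge0 ?poweR_ge0// lee_fin ltW.
  rewrite mule1 /K -poweR_EFin -poweRM ?lee_fin ?exprn_ge0 ?addr_ge0//.
  apply: le_poweR; [exact: ltW|exact: c0|].
  apply: (le_trans (convw_shift N j mF F0 x y)).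
  rewrite lee_wpmul2r// lee_fin lerXn2r ?nnegrE ?bracket_ge0 ?addr_ge0//.
  rewrite /bracket lerD2l; move/set_mem : yD => yD.
  apply: (@le_trans _ _ (2 ^+ j * \sum_(i < n) h)%R).
    rewrite ler_wpM2l ?exprn_ge0//; apply: le_trans (eucl_norm_le_sum _) _.
    apply: ler_sum => i _; have /andP[y1 y2] := yD i; rewrite !mxE in y2 *.
    by rewrite gtr0_norm ?subr_gt0// lerBlDl.
  rewrite sumr_const card_ord -[(h *+ n)%R]mulr_natr mulrA /h mulfV ?mul1r//.
have t0 : (0 < 2 `^ (j%:R * n%:R) :> R)%R by rewrite powR_gt0.
have ab : (2 `^ (j%:R * n%:R) * 2 `^ (- (j%:R * n%:R)) = 1 :> R)%R by rewrite pow2D subrr powRr0.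
by rewrite -/K; exact: (mule_cancel t0 ab key).
Qed.

(** The cases in which the absolute value of the kernels suffices. *)
Definition conv_cases (s : \bar R) (alpha q r : R) :=
  [\/ [/\ (q%:E < s)%E & (0 < alpha)%R],
      [/\ (q%:E < s)%E, (q <= r)%R, (r%:E <= s)%E & alpha = 0%R] |
      (s <= q%:E)%E /\ (dim_over n s - n%:R / q < alpha)%R].

Lemma positive_finite (alpha q r s s1 : R) : (1 < q)%R -> (0 < r)%R -> (0 < s)%R ->
  (0 <= alpha)%R -> (alpha < n%:R - n%:R / q)%R -> (n%:R / s - s1 = alpha + n%:R / q)%R ->
  conv_cases s%:E alpha q r ->
  exists N, (n < N)%N /\ exists2 C : R, (0 < C)%R & forall g : E -> R,
  measurable_fun setT g -> (forall y, (0 <= g y)%R) ->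
  \esum_(j in [set: nat]) (besov_term s s1 N (EFin \o g) j `^ (r / s)) <=
   C%:E * \esum_(k in [set: int]) (herz_term alpha q (EFin \o g) k `^ r).
Proof.
move=> q1 r0 s0 al0 al1 bal cases.
(* Large enough for the integrability of the s-th power of the weight and
   for far_sum. *)
pose M := (n + n + (Num.trunc (n.+1%:R / s)).+1)%N.
have hM : (n.+1%:R <= M%:R * s)%R.
  rewrite -ler_pdivrMr//; apply: (@le_trans _ _ (Num.trunc (n.+1%:R / s)).+1%:R).
    by rewrite ltW// truncnS_gt.
  by rewrite ler_nat leq_addl.
have nM : (n + n <= M)%N by rewrite leq_addr.
exists (M + M)%N; split; first by rewrite /M; lia.
have nN : (n < M + M)%N by rewrite /M; lia.
have [A A0 HA] := total_split n_gt0 (ltW q1) s0 al0 al1 bal r0 hM nM.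
have [B B0 HB] : exists2 C : R, (0 < C)%R & forall g : E -> R,
  measurable_fun setT g -> (forall y, (0 <= g y)%R) ->
  \esum_(j in [set: nat]) (near_sum s s1 (M + M) (EFin \o g) j `^ (r / s)) <=
   C%:E * \esum_(k in [set: int]) (herz_term alpha q (EFin \o g) k `^ r).
  have ext (C : R) : (forall F, measurable_fun setT F -> (forall y, 0 <= F y) ->
      \esum_(j in [set: nat]) (near_sum s s1 (M + M) F j `^ (r / s)) <=
      C%:E * \esum_(k in [set: int]) (herz_term alpha q F k `^ r)) -> forall g : E -> R,
    measurable_fun setT g -> (forall y, (0 <= g y)%R) ->
    \esum_(j in [set: nat]) (near_sum s s1 (M + M) (EFin \o g) j `^ (r / s)) <=
    C%:E * \esum_(k in [set: int]) (herz_term alpha q (EFin \o g) k `^ r).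
    by move=> H g mg g0; apply: H => [|y]; [exact/measurable_EFinP|rewrite lee_fin].
  case: cases => [[qs a0]|[qs qr rs a0]|[sq a0]].
  - rewrite lte_fin in qs.
    have [C C0 HC] := near_high n_gt0 (ltW q1) s0 al0 al1 bal r0 nN (ltW qs) a0.
    by exists C => //; exact: ext.
  - rewrite lte_fin in qs; rewrite lee_fin in rs; rewrite a0.
    by apply: near_critical => //; rewrite bal a0 add0r.
  - rewrite lee_fin in sq.
    have [C C0 HC] := near_low n_gt0 (ltW q1) s0 al0 al1 bal r0 nN sq a0.
    by exists C => //; exact: ext.
exists (A * (1 + B))%R => [|g mg g0]; first by rewrite mulr_gt0// addr_gt0.
apply: (le_trans (HA (EFin \o g) _ _)); [exact/measurable_EFinP|by move=> y; rewrite lee_fin|].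
have h0 : 0 <= \esum_(k in [set: int]) (herz_term alpha q (EFin \o g) k `^ r).
  by apply: esum_ge0 => k _; exact: poweR_ge0.
rewrite EFinM -muleA lee_wpmul2l ?lee_fin ?(ltW A0)//.
rewrite EFinD ge0_muleDl ?lee_fin ?(ltW B0)// mul1e leeD2l//.
exact: HB.
Qed.

(** For s = oo the finite exponent s' > max(q, r) is used, with s1 replaced by
    s1 + n/s'; by convw_sup_le the supremum norm costs exactly the factor
    2^(jn/s'). *)
Lemma positive_embedding (alpha q r s1 : R) (s : \bar R) : (1 < q)%R -> (0 < r)%R -> 0 < s ->
  (0 <= alpha)%R -> (alpha < n%:R - n%:R / q)%R -> (dim_over n s - s1 = alpha + n%:R / q)%R ->
  conv_cases s alpha q r ->
  exists N, (n < N)%N /\ exists2 C : R, (0 < C)%R & forall g : E -> R,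
  measurable_fun setT g -> (forall y, (0 <= g y)%R) ->
  \esum_(j in [set: nat]) (((2 `^ (j%:R * s1))%:E * Lnorm mu s (convw N j (EFin \o g))) `^ r) <=
   C%:E * \esum_(k in [set: int]) (herz_term alpha q (EFin \o g) k `^ r).
Proof.
move=> q1 r0; case: s => [s| |]//.
  rewrite lte_fin /= => s0 al0 al1 bal cases.
  have [N [nN [C C0 HC]]] := positive_finite q1 r0 s0 al0 al1 bal cases.
  exists N; split => //; exists C => // g mg g0.
  apply: le_trans (HC g mg g0); apply: le_esum => j _.
  have h0 : 0 <= \int[mu]_x (convw N j (EFin \o g) x `^ s).
    by apply: integral_ge0 => x _; exact: poweR_ge0.
  rewrite /besov_term poweRM ?lee_fin ?powR_ge0//; last exact: Lnorm_ge0.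
  rewrite poweRM ?lee_fin ?powR_ge0// !poweR_EFin -!powRrM.
  rewrite (_ : j%:R * s1 * s * (r / s) = j%:R * s1 * r)%R; last by field; rewrite gt_eqF.
  rewrite lee_wpmul2l ?lee_fin ?powR_ge0// unlock /=.
  under eq_integral do rewrite gee0_abs ?convw_ge0//.
  by rewrite -poweRrM mulrC.
move=> _ /= al0 al1 bal cases.
pose s := (Num.max q r + 1)%R.
have sq : (q < s)%R by rewrite /s ltr_pwDr// le_max lexx.
have sr : (r <= s)%R by rewrite /s ler_wpDr// le_max lexx orbT.
have s0 : (0 < s)%R by rewrite (lt_trans _ sq)// (lt_trans _ q1).
pose s1' := (s1 + n%:R / s)%R.
have bal' : (n%:R / s - s1' = alpha + n%:R / q)%R by rewrite /s1' -bal; ring.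
have cases' : conv_cases s%:E alpha q r.
  case: cases => [[_ a0]|[_ qr _ a0]|[]]//.
  - by apply: Or31; rewrite lte_fin.
  - by apply: Or32; rewrite lte_fin lee_fin.
have [N [nN [C C0 HC]]] := positive_finite q1 r0 s0 al0 al1 bal' cases'.
have [A A0 HA] := convw_sup_le N s0.
exists N; split => //; exists (A `^ (r / s) * C)%R => [|g mg g0]; first by rewrite mulr_gt0// powR_gt0.
have mge : measurable_fun setT (EFin \o g) by exact/measurable_EFinP.
have ge0 y : 0 <= (EFin \o g) y by rewrite lee_fin.
apply: (@le_trans _ _ (\esum_(j in [set: nat]) ((A `^ (r / s))%:E * besov_term s s1' N (EFin \o g) j `^ (r / s)))); last first.
  rewrite esumZ ?powR_ge0//; last by move=> j; exact: poweR_ge0.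
  by rewrite EFinM -muleA lee_wpmul2l ?lee_fin ?powR_ge0//; exact: HC.
apply: le_esum => j _.
have h0 : 0 <= \int[mu]_x (convw N j (EFin \o g) x `^ s).
  by apply: integral_ge0 => x _; exact: poweR_ge0.
pose B := ((A * 2 `^ (j%:R * n%:R))%:E * \int[mu]_y (convw N j (EFin \o g) y `^ s)) `^ s^-1.
have LB : Lnorm mu +oo (convw N j (EFin \o g)) <= B.
  rewrite unlock; case: ifPn => _; last exact: poweR_ge0.
  apply/ess_supP; apply: nearW => x /=; rewrite gee0_abs ?convw_ge0//.
  apply: poweR_le_inv => //; [exact: convw_ge0|exact: HA].
apply: (@le_trans _ _ (((2 `^ (j%:R * s1))%:E * B) `^ r)).
  apply: le_poweR; first exact: ltW.
    by rewrite mule_ge0 ?Lnorm_ge0// lee_fin powR_ge0.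
  by rewrite lee_wpmul2l ?lee_fin ?powR_ge0.
rewrite /besov_term /B poweRM ?lee_fin ?powR_ge0 ?poweR_ge0// -poweRrM.
rewrite (mulrC s^-1%R r).
rewrite !poweRM ?lee_fin ?powR_ge0 ?mulr_ge0 ?powR_ge0 ?(ltW A0)// !poweR_EFin.
rewrite powRM ?powR_ge0 ?(ltW A0)// !muleA lee_wpmul2r ?poweR_ge0// -!EFinM lee_fin -!powRrM.
rewrite mulrCA pow2D le_eqVlt; apply/orP; left; apply/eqP; congr (_ * (_ `^ _))%R.
by rewrite /s1'; field; rewrite gt_eqF.
Qed.

End positive_embedding.

(** * Decay, dilation structure and cancellation of the kernels *)

Local Close Scope ereal_scope.

Section trig_transform.
Context {R : realType} {n : nat}.
Local Notation E := 'rV[R]_n.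
Local Notation mu := (lebesgue_rV R n).
Implicit Types (x y xi : E) (u f : E -> R) (tr : R -> R).

(** Makes a function integrable with an explicit bound, and is inherited by
    translates, dilates and differences. *)
Definition ball_bounded (r B : R) u :=
  measurable_fun setT u /\ forall x, `|u x| <= B * \1_[set x : E | eucl_norm x < r] x.

Lemma ball_bounded_cst_ge0 r B u : 0 < r -> ball_bounded r B u -> 0 <= B.
Proof.
move=> r0 [_ /(_ 0)]; rewrite indicE mem_set/= ?eucl_norm0// mulr1.
exact: le_trans.
Qed.

Lemma le_ball_bounded r r' B B' u : 0 <= B -> r <= r' -> B <= B' -> ball_bounded r B u ->
  ball_bounded r' B' u.
Proof.
move=> B0 rr' BB' [mu' bu]; split=> // x; apply: (le_trans (bu x)).
apply: ler_pM => //; rewrite !indicE; case: (boolP (x \in [set x | eucl_norm x < r])) => //.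
by rewrite inE/= => xr; rewrite mem_set//=; exact: lt_le_trans rr'.
Qed.

Lemma ball_bounded_integral r B u : 0 <= r -> 0 <= B -> ball_bounded r B u ->
  mu.-integrable setT (EFin \o u) /\ `|\int[mu]_x u x| <= B * (2 * r) ^+ n.
Proof.
move=> r0 B0 [mu' bu].
pose g x : R := B * \1_[set x : E | eucl_norm x < r] x.
have mb := @measurable_eucl_ball R n r.
have g0 x : 0 <= g x by rewrite mulr_ge0.
have mg : measurable_fun setT g.
  by apply: measurable_funM => //; exact: measurable_indic.
have Ig : (\int[mu]_x (g x)%:E <= (B * (2 * r) ^+ n)%:E)%E.
  rewrite /g; under eq_integral do rewrite EFinM.
  rewrite ge0_integralZl//; last by apply/measurable_EFinP; exact: measurable_indic.
  by rewrite integral_indicE// EFinM lee_wpmul2l// lebesgue_rV_eucl_ball.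
have ig : mu.-integrable setT (EFin \o g).
  apply/integrableP; split; first exact/measurable_EFinP.
  under eq_integral do rewrite /= ger0_norm//.
  by apply: le_lt_trans Ig _; rewrite ltry.
have iu : mu.-integrable setT (EFin \o u).
  apply: (le_integrable _ _ _ ig) => //; first exact/measurable_EFinP.
  by move=> x _; rewrite /= lee_fin [leRHS]ger0_norm// bu.
split=> //; apply: (le_trans (le_normr_Rintegral measurableT iu)).
apply: (@le_trans _ _ (\int[mu]_x g x)).
  by apply: le_Rintegral => //; exact: integrable_norm.
rewrite -lee_fin; apply: le_trans Ig.
by rewrite /Rintegral fineK// (integrable_fin_num _ ig).
Qed.

(** What the argument needs to know about the cosine and the sine. *)
Definition trig tr := [/\ measurable_fun setT tr, forall t, `|tr t| <= 1,
  forall t, tr (t + pi) = - tr t & forall s t, `|tr s - tr t| <= `|s - t|].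

Lemma lip_of_deriv (f df : R -> R) : (forall t : R, is_derive t (1 : R) f (df t)) ->
  (forall t, `|df t| <= 1) -> forall s t, `|f s - f t| <= `|s - t|.
Proof.
move=> Df b.
have H s t : s <= t -> `|f t - f s| <= `|t - s|.
  move=> st.
  have cf : {within `[s, t], continuous f}.
    by apply: derivable_within_continuous => x _; have [] := Df x.
  have [c _ ->] := @MVT_segment _ f df s t st (fun (x : R) _ => Df x) cf.
  by rewrite normrM -[leRHS]mul1r ler_wpM2r.
move=> s t; have [st|/ltW st] := leP s t; last exact: H.
by rewrite distrC [leRHS]distrC; exact: H.
Qed.

Lemma trig_cos : trig cos.
Proof.
split.
- by apply: continuous_measurable_fun; exact: continuous_cos.
- by move=> t; rewrite ler_norml cos_geN1 cos_le1.
- by move=> t; rewrite cosDpi.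
- apply: lip_of_deriv => t; rewrite normrN ler_norml sin_geN1 sin_le1//.
Qed.

Lemma trig_sin : trig sin.
Proof.
split.
- by apply: continuous_measurable_fun; exact: continuous_sin.
- by move=> t; rewrite ler_norml sin_geN1 sin_le1.
- by move=> t; rewrite sinDpi.
- apply: lip_of_deriv => t; rewrite ler_norml cos_geN1 cos_le1//.
Qed.

Lemma dotpDr x y xi : dotp x (y + xi) = dotp x y + dotp x xi.
Proof.
by rewrite /dotp -big_split; apply: eq_bigr => i _; rewrite mxE mulrDr.
Qed.

Lemma dotpBl x y xi : dotp (x - y) xi = dotp x xi - dotp y xi.
Proof.
by rewrite /dotp -sumrB; apply: eq_bigr => i _; rewrite !mxE mulrBl.
Qed.

Lemma dotpZ (c : R) x xi : dotp x (c *: xi) = dotp (c *: x) xi.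
Proof. by apply: eq_bigr => i _; rewrite !mxE mulrCA mulrA. Qed.

Lemma dotp_delta x (h : R) i : dotp x (h *: delta_mx ord0 i) = x ord0 i * h.
Proof.
rewrite /dotp (bigD1 i)//= big1 ?addr0 => [|j ji]; first by rewrite !mxE !eqxx mulr1.
by rewrite !mxE (negbTE ji) andbF !mulr0.
Qed.

Lemma measurable_dotp x : measurable_fun setT (fun xi => dotp x xi).
Proof.
apply: measurable_sum => i; apply: measurable_funM => //; exact: measurable_rV_coord.
Qed.

(** The real and imaginary parts of the Fourier integral are combinations of
    these transforms of real functions. *)
Definition trigt tr u x : R := \int[mu]_xi (tr (dotp x xi) * u xi).

Lemma ball_bounded_trig tr r B u x : trig tr -> ball_bounded r B u ->
  ball_bounded r B (fun xi => tr (dotp x xi) * u xi).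
Proof.
move=> [mtr btr _ _] [mu' bu]; split.
  apply: measurable_funM => //; apply: measurableT_comp => //; exact: measurable_dotp.
move=> xi; apply: le_trans (bu xi).
by rewrite normrM -[leRHS]mul1r ler_wpM2r.
Qed.

Lemma trigt_le tr r B u x : 0 <= r -> 0 <= B -> trig tr -> ball_bounded r B u ->
  `|trigt tr u x| <= B * (2 * r) ^+ n.
Proof.
move=> r0 B0 ttr bu.
by have [] := ball_bounded_integral r0 B0 (ball_bounded_trig x ttr bu).
Qed.

Lemma trigt_integrable tr r B u x : 0 <= r -> 0 <= B -> trig tr -> ball_bounded r B u ->
  mu.-integrable setT (EFin \o (fun xi => tr (dotp x xi) * u xi)).
Proof.
move=> r0 B0 ttr bu.
by have [] := ball_bounded_integral r0 B0 (ball_bounded_trig x ttr bu).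
Qed.

Lemma trigt_lip tr r B u : 0 <= r -> 0 <= B -> trig tr -> ball_bounded r B u ->
  forall x y, `|trigt tr u x - trigt tr u y| <= r * B * (2 * r) ^+ n * eucl_norm (x - y).
Proof.
move=> r0 B0 ttr bu x y.
have ix := trigt_integrable x r0 B0 ttr bu; have iy := trigt_integrable y r0 B0 ttr bu.
rewrite /trigt -RintegralB//.
have bb : ball_bounded r (eucl_norm (x - y) * r * B)
   (fun xi => tr (dotp x xi) * u xi - tr (dotp y xi) * u xi).
  split.
    by apply: measurable_funB; [have [] := ball_bounded_trig x ttr bu|have [] := ball_bounded_trig y ttr bu].
  move=> xi; have [mtr btr _ ltr] := ttr; have [_ /(_ xi) bxi] := bu.
  rewrite -mulrBl normrM.
  have h1 : `|tr (dotp x xi) - tr (dotp y xi)| <= eucl_norm (x - y) * eucl_norm xi.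
    by apply: (le_trans (ltr _ _)); rewrite -dotpBl; exact: dotp_le.
  move: bxi; rewrite indicE; case: (boolP (xi \in _)) => [|_].
    rewrite inE/= !mulr1 => xr ub; apply: ler_pM => //.
    by apply: (le_trans h1); rewrite ler_wpM2l// ltW.
  by rewrite !mulr0 normr_le0 => /eqP ->; rewrite normr0 mulr0.
have [] := ball_bounded_integral r0 _ bb; first by rewrite !mulr_ge0.
move=> _ /le_trans; apply.
by rewrite le_eqVlt; apply/orP; left; apply/eqP; ring.
Qed.

(** The difference along a coordinate axis whose iterates replace integrations
    by parts. *)
Definition shift_diff (h : R) (i : 'I_n) u : E -> R :=
  fun xi => u xi - u (xi + h *: delta_mx ord0 i).

Lemma eucl_norm_delta (i : 'I_n) : eucl_norm (delta_mx ord0 i : E) = 1.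
Proof.
rewrite /eucl_norm (bigD1 i)//= big1 ?addr0 => [|j ji]; first by rewrite !mxE !eqxx expr1n sqrtr1.
by rewrite mxE (negbTE ji) andbF expr0n.
Qed.

Lemma ball_bounded_shift_diff h i r B u : 0 < h -> 0 < r -> ball_bounded r B u ->
  ball_bounded (r + h) (B + B) (shift_diff h i u).
Proof.
move=> h0 r0 bu; have B0 := ball_bounded_cst_ge0 r0 bu; have [mu' _] := bu; split.
  apply: measurable_funB => //.
  have -> : (fun xi => u (xi + h *: delta_mx ord0 i)) = u \o (fun xi => 1 *: xi + h *: delta_mx ord0 i).
    by apply/funext => xi /=; rewrite scale1r.
  apply: measurableT_comp => //; exact: measurable_rV_affine.
move=> xi; apply: (le_trans (ler_normB _ _)); rewrite mulrDl; apply: lerD.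
  have rr : r <= r + h by rewrite lerDl ltW.
  by have [_ ->] := le_ball_bounded B0 rr (lexx B) bu.
have [_ /(_ (xi + h *: delta_mx ord0 i)) /le_trans] := bu; apply.
rewrite ler_wpM2l// !indicE; case: (boolP (_ \in _)) => //.
rewrite inE/= => xr; rewrite mem_set//=.
have -> : xi = (xi + h *: delta_mx ord0 i) + - (h *: delta_mx ord0 i) by rewrite addrK.
apply: (le_lt_trans (eucl_norm_triangle _ _)).
by rewrite eucl_normN eucl_normZ eucl_norm_delta mulr1 gtr0_norm// ltrD2r.
Qed.

Lemma ball_bounded_iter h i r u N : 0 < h -> 0 < r -> forall B, ball_bounded r B u ->
  ball_bounded (r + N%:R * h) (2 ^+ N * B) (iter N (shift_diff h i) u).
Proof.
move=> h0 r0 B bu; elim: N => [|N IH]; first by rewrite mul0r addr0 expr0 mul1r.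
have r'0 : 0 < r + N%:R * h by rewrite ltr_wpDr// mulr_ge0// ltW.
have := ball_bounded_shift_diff i h0 r'0 IH.
rewrite -addrA (_ : N.+1%:R * h = N%:R * h + h); last by rewrite -natr1 mulrDl mul1r.
by rewrite (_ : 2 ^+ N.+1 * B = 2 ^+ N * B + 2 ^+ N * B)// exprS -mulrA mulr_natl mulr2n.
Qed.

(** With |x_i| h = pi, translating by h e_i multiplies the trigonometric
    factor by -1, so that the two terms of the difference have equal
    transforms. *)
Lemma trigt_shift_diff tr h i r B u x : trig tr -> 0 < h -> 0 < r -> ball_bounded r B u ->
  `|x ord0 i| * h = pi -> trigt tr (shift_diff h i u) x = 2 * trigt tr u x.
Proof.
move=> ttr h0 r0 bu xh; have B0 := ball_bounded_cst_ge0 r0 bu.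
have iu := trigt_integrable x (ltW r0) B0 ttr bu.
set e := h *: delta_mx ord0 i : E.
(* The sign of x_i does not matter, as pi is an antiperiod in both
   directions. *)
have trE t : tr (t + x ord0 i * h) = - tr t.
  have [_ _ trp _] := ttr.
  have [x0|x0] := leP 0 (x ord0 i); first by rewrite -(ger0_norm x0) xh trp.
  have -> : x ord0 i * h = - pi by rewrite -xh ltr0_norm// mulNr opprK.
  by rewrite -[in RHS](subrK pi t) trp opprK.
have iu' := integrable_rV_affine e (oner_neq0 R) iu.
have aff := Rintegral_rV_affine e (oner_neq0 R) iu.
rewrite normr1 expr1n mul1r in aff.
have iB : mu.-integrable setT (EFin \o (fun xi => - (tr (dotp x xi) * u (xi + e)))).
  apply: eq_integrable iu' => // xi _ /=.
  by rewrite scale1r dotpDr dotp_delta trE mulNr.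
rewrite /trigt.
transitivity (\int[mu]_xi (tr (dotp x xi) * u xi + - (tr (dotp x xi) * u (xi + e)))).
  by apply: eq_Rintegral => xi _; rewrite -mulrBr.
rewrite RintegralD// mulr_natl mulr2n; congr (_ + _).
rewrite aff; apply: eq_Rintegral => xi _.
by rewrite scale1r dotpDr dotp_delta trE mulNr.
Qed.

Lemma trigt_iter tr h i r u x N : trig tr -> 0 < h -> 0 < r -> forall B, ball_bounded r B u ->
  `|x ord0 i| * h = pi -> trigt tr (iter N (shift_diff h i) u) x = 2 ^+ N * trigt tr u x.
Proof.
move=> ttr h0 r0 B bu xh; elim: N => [|N IH]; first by rewrite expr0 mul1r.
have r'0 : 0 < r + N%:R * h by rewrite ltr_wpDr// mulr_ge0// ltW.
rewrite iterS (trigt_shift_diff ttr h0 r'0 (ball_bounded_iter i N h0 r0 bu) xh) IH.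
by rewrite exprS mulrA.
Qed.

Lemma derivable_translate (w : E -> R) (v a : E) xi : derivable w (xi + a) v ->
  derivable (fun y => w (y + a)) xi v /\ 'D_v (fun y => w (y + a)) xi = 'D_v w (xi + a).
Proof.
rewrite /derivable /derive.
have -> // : (fun h : R => h^-1 *: (((fun y => w (y + a)) \o shift xi) (h *: v) - w (xi + a))) =
  (fun h : R => h^-1 *: ((w \o shift (xi + a)) (h *: v) - w (xi + a))).
by apply/funext => h /=; rewrite addrA.
Qed.

Lemma is_derive_along (w : E -> R) (v : E) xi (t : R) : derivable w (xi + t *: v) v ->
  is_derive t (1 : R) (fun t => w (xi + t *: v)) ('D_v w (xi + t *: v)).
Proof.
have e : (fun h : R => h^-1 *: (((fun t : R => w (xi + t *: v)) \o shift t) (h *: (1 : R)) - w (xi + t *: v))) =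
  (fun h : R => h^-1 *: ((w \o shift (xi + t *: v)) (h *: v) - w (xi + t *: v))).
  by apply/funext => h /=; rewrite scalerDl addrCA /GRing.scale/= mulr1.
by move=> dw; apply: DeriveDef; rewrite /derivable /derive e.
Qed.

(** Every difference costs a derivative and gains h, by the mean value
    theorem. The sequence w_k consists of the successive derivatives along
    e_i. *)
Lemma iter_shift_diff_le (h : R) i N : 0 < h -> forall (w : nat -> E -> R) M,
  (forall k xi, derivable (w k) xi (delta_mx ord0 i)) ->
  (forall k xi, 'D_(delta_mx ord0 i) (w k) xi = w k.+1 xi) ->
  (forall xi, `|w N xi| <= M) ->
  forall xi, `|iter N (shift_diff h i) (w 0%N) xi| <= h ^+ N * M.
Proof.
move=> h0; elim: N => [|N IH] w M dw Dw bw xi; first by rewrite expr0 mul1r /=.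
rewrite iterSr exprSr -mulrA.
apply: (IH (fun k => shift_diff h i (w k))) => [k y|k y|y].
- apply: derivableB => //.
  by have [] := derivable_translate (dw k (y + h *: delta_mx ord0 i)).
- have [d1 d2] := derivable_translate (dw k (y + h *: delta_mx ord0 i)).
  by rewrite /shift_diff deriveB// d2 !Dw.
pose g (t : R) := w N (y + t *: delta_mx ord0 i).
have Dg (t : R) : is_derive t (1 : R) g (w N.+1 (y + t *: delta_mx ord0 i)).
  by rewrite -Dw; apply: is_derive_along.
have cg : {within `[0, h], continuous g}.
  by apply: derivable_within_continuous => t _; have [] := Dg t.
have [c _] := @MVT_segment _ g _ 0 h (ltW h0) (fun (t : R) _ => Dg t) cg.
rewrite {1 2}/g scale0r addr0 subr0 => gE.
by rewrite /shift_diff distrC gE normrM mulrC (gtr0_norm h0) ler_wpM2l// ltW.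
Qed.

End trig_transform.

Section kernel_decay.
Context {R : realType} {n : nat}.
Hypothesis n_gt0 : (0 < n)%N.
Local Notation E := 'rV[R]_n.
Local Notation mu := (lebesgue_rV R n).
Implicit Types (x y xi : E) (u f : E -> R) (tr : R -> R).

Lemma large_coord x : exists i, eucl_norm x <= n%:R * `|x ord0 i|.
Proof.
case: (arg_maxP (fun i : 'I_n => `|x ord0 i|) (isT : xpredT (Ordinal n_gt0))) => i _ imax.
exists i; apply: le_trans (eucl_norm_le_sum x) _.
apply: (@le_trans _ _ (\sum_(j < n) `|x ord0 i|)); first by apply: ler_sum => j _; exact: imax.
by rewrite sumr_const card_ord mulr_natl.
Qed.

(** Choose i with |x| <= n |x_i|. If |x_i| >= 1, the N-th difference with step
    h = pi / |x_i| <= pi is of size h^N and is supported in a fixed ball. *)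
Lemma trigt_decay tr u (w : 'I_n -> nat -> E -> R) (r B : R) : trig tr -> 0 < r ->
  ball_bounded r B u -> (forall i, w i 0%N = u) ->
  (forall i k xi, derivable (w i k) xi (delta_mx ord0 i)) ->
  (forall i k xi, 'D_(delta_mx ord0 i) (w i k) xi = w i k.+1 xi) ->
  (forall N, exists M, forall i xi, `|w i N xi| <= M) ->
  forall N, exists C, forall x, `|trigt tr u x| <= C * (1 + eucl_norm x) ^- N.
Proof.
move=> ttr r0 bu w0 dw Dw bw N; have B0 := ball_bounded_cst_ge0 r0 bu.
have [M HM] := bw N.
have M0 : 0 <= M by apply: le_trans (HM (Ordinal n_gt0) 0).
pose A := B * (2 * r) ^+ n; pose r' := r + N%:R * pi.
have pi0 : 0 < pi :> R := pi_gt0 R.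
have r'0 : 0 < r' by rewrite ltr_wpDr// mulr_ge0// ltW.
pose D := (pi * (1 + n%:R)) ^+ N * (M * (2 * r') ^+ n).
have A0 : 0 <= A by rewrite mulr_ge0// exprn_ge0// mulr_ge0// ltW.
have D0 : 0 <= D.
  apply: mulr_ge0.
    by apply: exprn_ge0; apply: mulr_ge0; [exact: ltW|exact: addr_ge0].
  by apply: mulr_ge0 => //; apply: exprn_ge0; apply: mulr_ge0 => //; exact: ltW.
have n10 : 0 < 1 + n%:R :> R by rewrite ltr_wpDr.
exists ((1 + n%:R) ^+ N * A + D) => x.
have x0 := eucl_norm_ge0 x; have x10 : 0 < 1 + eucl_norm x by rewrite ltr_wpDr.
have [i xi] := large_coord x.
rewrite ler_pdivlMr ?exprn_gt0//.
have [xi1|xi1] := ltP `|x ord0 i| 1.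
  apply: (@le_trans _ _ ((1 + n%:R) ^+ N * A)); last by rewrite lerDl.
  rewrite mulrC; apply: ler_pM; rewrite ?exprn_ge0 ?(ltW x10)//.
    rewrite lerXn2r ?nnegrE ?(ltW x10) ?(ltW n10)// lerD2l (le_trans xi)//.
    by rewrite -[leRHS]mulr1 ler_wpM2l// ltW.
  exact: (trigt_le x (ltW r0) B0 ttr bu).
apply: (@le_trans _ _ D); last by rewrite lerDr mulr_ge0// exprn_ge0// ltW.
have xi0 : 0 < `|x ord0 i| by rewrite (lt_le_trans _ xi1).
pose h := pi / `|x ord0 i|.
have h0 : 0 < h by rewrite divr_gt0.
have hpi : h <= pi by rewrite ler_pdivrMr// -[leLHS]mulr1 ler_wpM2l// ltW.
have xh : `|x ord0 i| * h = pi by rewrite mulrC divfK// gt_eqF.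
have bI := ball_bounded_iter i N h0 r0 bu.
have bI' : ball_bounded r' (h ^+ N * M) (iter N (shift_diff h i) u).
  have [mI sI] := bI; split => // y.
  have hNM : `|iter N (shift_diff h i) u y| <= h ^+ N * M.
    by rewrite -(w0 i); apply: iter_shift_diff_le.
  rewrite indicE; case: (boolP (y \in _)) => [_|]; first by rewrite mulr1.
  rewrite notin_setE/= => /negP; rewrite -leNgt => yr.
  have := sI y; rewrite indicE (_ : y \in _ = false); last first.
    apply/negP; rewrite inE/= ltNge; apply/negP; rewrite negbK.
    by apply: le_trans yr; rewrite lerD2l ler_wpM2l.
  by rewrite !mulr0.
have hNM0 : 0 <= h ^+ N * M by rewrite mulr_ge0// exprn_ge0// ltW.
have := trigt_le x (ltW r'0) hNM0 ttr bI'.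
rewrite (trigt_iter N ttr h0 r0 bu xh) normrM normrX normr_nat => key.
have {key} : `|trigt tr u x| <= h ^+ N * M * (2 * r') ^+ n.
  apply: le_trans key; rewrite -[leLHS]mul1r ler_wpM2r// -natrX ler1n.
  by rewrite expn_gt0.
move=> /(ler_wpM2r (exprn_ge0 N (ltW x10))) /le_trans; apply.
rewrite /D (_ : h ^+ N * M * _ * _ = (h * (1 + eucl_norm x)) ^+ N * (M * (2 * r') ^+ n)); last first.
  move: (h) => h'; rewrite [(h' * _) ^+ N]exprMn; move: ((2 * r') ^+ n) => Y; ring.
rewrite ler_wpM2r ?mulr_ge0 ?exprn_ge0 ?mulr_ge0 ?(ltW r'0)//.
rewrite lerXn2r ?nnegrE ?mulr_ge0 ?(ltW h0) ?(ltW x10) ?(ltW pi0) ?(ltW n10)//.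
rewrite /h -mulrA ler_wpM2l ?(ltW pi0)// mulrC ler_pdivrMr// mulrDl mul1r.
exact: lerD.
Qed.

(** What is kept of a Schwartz function: enough for measurability,
    integrability and a Hoelder estimate in L^1. *)
Definition profile u := (exists2 L, 0 <= L & forall x y, `|u x - u y| <= L * eucl_norm (x - y)) /\
  forall N, exists2 C, 0 <= C & forall x, `|u x| <= C * (1 + eucl_norm x) ^- N.

Lemma measurable_profile u : profile u -> measurable_fun setT u.
Proof.
move=> [[L L0 HL] _]; apply: continuous_rV_measurable => x.
apply/(@cvgrPdist_le _ _ _ _ (nbhs_filter x)) => /= e e0.
pose d := e / (L * n%:R + 1).
have c0 : 0 < L * n%:R + 1 by rewrite ltr_wpDl// mulr_ge0.
have d0 : 0 < d by rewrite divr_gt0.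
apply: filterS (nbhsx_ballx x _ d0) => y /= xy.
apply: (le_trans (HL _ _)).
apply: (@le_trans _ _ (L * (n%:R * d))).
  rewrite ler_wpM2l//; apply: le_trans (eucl_norm_le_sum _) _.
  apply: (@le_trans _ _ (\sum_(i < n) d)); last by rewrite sumr_const card_ord mulr_natl.
  by apply: ler_sum => i _; rewrite !mxE; have [_ /(_ ord0 i)] := xy; rewrite /ball/= => /ltW.
rewrite mulrA /d mulrA ler_pdivrMr// mulrC ler_wpM2l ?(ltW e0)// lerDl//.
Qed.

Lemma profileD u f : profile u -> profile f -> profile (fun x => u x + f x).
Proof.
move=> [[L L0 HL] Du] [[K K0 HK] Df]; split.
  exists (L + K); first exact: addr_ge0.
  move=> x y; rewrite opprD addrACA mulrDl; apply: (le_trans (ler_normD _ _)).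
  by apply: lerD.
move=> N; have [C C0 HC] := Du N; have [D D0 HD] := Df N.
exists (C + D) => [|x]; first exact: addr_ge0.
by rewrite mulrDl; apply: (le_trans (ler_normD _ _)); apply: lerD.
Qed.

Lemma profileZ c u : profile u -> profile (fun x => c * u x).
Proof.
move=> [[L L0 HL] Du]; split.
  exists (`|c| * L); first exact: mulr_ge0.
  by move=> x y; rewrite -mulrBr normrM -mulrA ler_wpM2l.
move=> N; have [C C0 HC] := Du N.
exists (`|c| * C) => [|x]; first exact: mulr_ge0.
by rewrite normrM -mulrA ler_wpM2l.
Qed.

Lemma profile_scale (c : R) u : 0 < c -> profile u -> profile (fun x => u (c *: x)).
Proof.
move=> c0 [[L L0 HL] Du]; split.
  exists (L * c); first by rewrite mulr_ge0// ltW.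
  move=> x y; apply: (le_trans (HL _ _)).
  by rewrite -scalerBr eucl_normZ gtr0_norm// mulrA.
move=> N; have [C C0 HC] := Du N.
exists (C * (1 + c^-1) ^+ N) => [|x].
  by rewrite mulr_ge0// exprn_ge0// addr_ge0// invr_ge0 ltW.
apply: (le_trans (HC _)); rewrite -mulrA ler_wpM2l// eucl_normZ gtr0_norm//.
have x0 := eucl_norm_ge0 x.
have h0 : 0 < 1 + c * eucl_norm x by rewrite ltr_wpDr// mulr_ge0// ltW.
have h1 : 0 < 1 + eucl_norm x by rewrite ltr_wpDr.
rewrite ler_pdivlMr ?exprn_gt0// mulrC ler_pdivrMr ?exprn_gt0// -exprMn.
rewrite lerXn2r ?nnegrE ?(ltW h1)//; last first.
  rewrite mulrDr mulrDl mul1r mulr1 mulrDl mul1r mulrA mulVf ?gt_eqF// mul1r.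
  have : 0 < c^-1 by rewrite invr_gt0.
  have : 0 <= c * eucl_norm x by rewrite mulr_ge0// ltW.
  lra.
by rewrite mulr_ge0 ?addr_ge0 ?invr_ge0 ?(ltW c0) ?mulr_ge0 ?(ltW c0).
Qed.

Lemma profile_integrable u : profile u -> mu.-integrable setT (EFin \o u).
Proof.
move=> pu; have mu' := measurable_profile pu; have [_ /(_ n.+1)[C C0 HC]] := pu.
have [D D0 HD] := @integral_tail_fin R n.
apply/integrableP; split; first exact/measurable_EFinP.
have mt := @measurable_tail R n n.+1.
apply: (@le_lt_trans _ _ (\int[mu]_x (C%:E * ((1 + eucl_norm x) ^- n.+1)%:E))%E).
  apply: ge0_le_integral => //.
  - by apply: measurableT_comp => //; exact/measurable_EFinP.
  - by apply: emeasurable_funM => //; exact/measurable_EFinP.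
  - by move=> x _; rewrite /= -EFinM lee_fin.
rewrite ge0_integralZl//; try exact/measurable_EFinP; last first.
  by move=> x _; rewrite lee_fin invr_ge0 exprn_ge0// addr_ge0.
apply: (@le_lt_trans _ _ (C%:E * D%:E)%E); first by rewrite lee_wpmul2l.
by rewrite -EFinM ltry.
Qed.

End kernel_decay.

Section resolution_kernels.
Context {R : realType} {n : nat}.
Hypothesis n_gt0 : (0 < n)%N.
Local Notation C := R[i].
Local Notation E := 'rV[R]_n.
Local Notation mu := (lebesgue_rV R n).
Implicit Types (x y xi : E) (u f : E -> R) (tr : R -> R) (pr : C -> R) (phi : E -> C).

Lemma Re_le_cmod (z : C) : `|complex.Re z| <= cmod z.
Proof. by case: z => a b; rewrite /cmod /= -sqrtr_sqr ler_wsqrtr// lerDl sqr_ge0. Qed.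

Lemma Im_le_cmod (z : C) : `|complex.Im z| <= cmod z.
Proof. by case: z => a b; rewrite /cmod /= -sqrtr_sqr ler_wsqrtr// lerDr sqr_ge0. Qed.

Lemma cmod_ge0 (z : C) : 0 <= cmod z.
Proof. by case: z => a b; rewrite /cmod /= sqrtr_ge0. Qed.

Lemma cmod_le (z : C) : cmod z <= `|complex.Re z| + `|complex.Im z|.
Proof.
case: z => a b; rewrite /cmod /= -[leRHS]ger0_norm ?addr_ge0// -sqrtr_sqr ler_wsqrtr//.
by rewrite sqrrD !real_normK ?num_real// lerD2r lerDl mulrn_wge0// mulr_ge0.
Qed.

Lemma schwartz_decay N phi : schwartz phi -> exists2 M : R, 0 <= M &
  forall s x, (size s <= N)%N -> (1 + eucl_norm x) ^+ N * cmod (partials s phi x) <= M.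
Proof.
move=> [_ /(_ N)]; rewrite /schwartz_seminorm; set S := (X in ereal_sup X) => Soo.
have SE s x : (size s <= N)%N ->
    (((1 + eucl_norm x) ^+ N * cmod (partials s phi x))%:E <= ereal_sup S)%E.
  by move=> sN; apply: ereal_sup_ubound; exists s, x.
have pos x : 0 <= (1 + eucl_norm x) ^+ N * cmod (phi x).
  by rewrite mulr_ge0 ?cmod_ge0// exprn_ge0// addr_ge0.
have SE0 := SE [::] 0 isT.
move: SE0 Soo SE; case: (ereal_sup S) => [M| |]//= M0 _ SE.
exists M => [|s x sN]; first by rewrite -lee_fin (le_trans _ M0)// lee_fin.
by rewrite -lee_fin; exact: SE.
Qed.

Definition is_part pr := pr = (@complex.Re R) \/ pr = (@complex.Im R).

Lemma part_le pr z : is_part pr -> `|pr z| <= cmod z.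
Proof. by case=> ->; [exact: Re_le_cmod|exact: Im_le_cmod]. Qed.

Lemma part_derive pr phi i xi : is_part pr ->
  pr (partial i phi xi) = 'D_(delta_mx ord0 i) (fun y => pr (phi y)) xi.
Proof. by case=> ->. Qed.

Lemma part_differentiable pr phi s xi : is_part pr -> smooth phi ->
  differentiable (fun y => pr (partials s phi y)) xi.
Proof. by move=> p sm; have [] := sm s xi; case: p => ->. Qed.

Lemma measurable_part pr phi : is_part pr -> smooth phi ->
  measurable_fun setT (fun x => pr (phi x)).
Proof.
move=> ppr sm; apply: continuous_rV_measurable => x.
exact: differentiable_continuous (part_differentiable [::] x ppr sm).
Qed.

Section generator.
Variable phi0 : E -> C.
Hypothesis gen : is_resolution_generator phi0.

Lemma generator_ball_bounded : exists2 B, 0 <= B & forall pr, is_part pr ->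
  ball_bounded 2 B (pr \o phi0).
Proof.
have [sch _ z] := gen; have [M M0 HM] := schwartz_decay 0 sch.
exists M => // pr ppr; split; first exact: (measurable_part ppr (proj1 sch)).
move=> x; rewrite indicE; case: (boolP (x \in _)) => [_|].
  rewrite mulr1; apply: (le_trans (part_le _ ppr)).
  by have := HM [::] x isT; rewrite expr0 mul1r.
rewrite notin_setE/= => /negP; rewrite -leNgt => /z ->.
by case: ppr => ->; rewrite /= normr0 mulr0.
Qed.

Lemma generator_profile pr tr : is_part pr -> trig tr -> profile (trigt tr (pr \o phi0)).
Proof.
move=> ppr ttr; have [B B0 HB] := generator_ball_bounded.
have [sch _ _] := gen; split.
  exists (2 * B * (2 * 2) ^+ n); first by rewrite !mulr_ge0// exprn_ge0// mulr_ge0.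
  by apply: trigt_lip => //; exact: HB.
pose w i k := fun y => pr (partials (nseq k i) phi0 y).
have two0 : (0 : R) < 2 by [].
have dec := @trigt_decay R n n_gt0 tr (pr \o phi0) w 2 B ttr two0 (HB _ ppr) (fun=> erefl).
have H : forall N, exists C, forall x, `|trigt tr (pr \o phi0) x| <= C * (1 + eucl_norm x) ^- N.
  apply: dec => [i k xi|i k xi|N].
  - exact: diff_derivable (part_differentiable (nseq k i) xi ppr (proj1 sch)).
  - by rewrite -part_derive.
  - have [M M0 HM] := schwartz_decay N sch; exists M => i xi.
    apply: (le_trans (part_le _ ppr)).
    have sN : (size (nseq N i) <= N)%N by rewrite size_nseq.
    apply: le_trans (HM (nseq N i) xi sN).
    by rewrite -[leLHS]mul1r ler_wpM2r ?cmod_ge0// exprn_ege1// lerDl.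
move=> N; have [D HD] := H N; exists (Num.max D 0) => [|x]; first by rewrite le_max lexx orbT.
apply: (le_trans (HD x)); rewrite ler_wpM2r ?le_max ?lexx// invr_ge0 exprn_ge0// addr_ge0.
Qed.

End generator.

Lemma ball_bounded_scale c r B u : 0 < c -> ball_bounded r B u ->
  ball_bounded (r / c) B (fun xi => u (c *: xi)).
Proof.
move=> c0 [mu' bu]; split.
  have -> : (fun xi => u (c *: xi)) = u \o (fun xi => c *: xi + 0).
    by apply/funext => xi /=; rewrite addr0.
  by apply: measurableT_comp => //; exact: measurable_rV_affine.
move=> x; apply: (le_trans (bu _)); rewrite le_eqVlt; apply/orP; left; apply/eqP.
rewrite !indicE; congr (_ * (nat_of_bool _)%:R); apply/idP/idP.
  by rewrite !inE/= eucl_normZ gtr0_norm// ltr_pdivlMr// mulrC.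
by rewrite !inE/= eucl_normZ gtr0_norm// ltr_pdivlMr// mulrC.
Qed.

Lemma trigt_scale tr c r B u x : trig tr -> 0 < r -> 0 < c -> ball_bounded r B u ->
  trigt tr (fun xi => u (c *: xi)) x = c ^- n * trigt tr u (c^-1 *: x).
Proof.
move=> ttr r0 c0 bu; have B0 := ball_bounded_cst_ge0 r0 bu.
have iu := trigt_integrable (c^-1 *: x) (ltW r0) B0 ttr bu.
have cn0 : c ^+ n != 0 by rewrite expf_neq0// gt_eqF.
apply: (mulfI cn0); rewrite mulrA mulfV// mul1r.
rewrite /trigt (Rintegral_rV_affine 0 (lt0r_neq0 c0) iu) gtr0_norm//; congr (_ * _).
apply: eq_Rintegral => xi _.
by rewrite addr0 dotpZ scalerA mulfV ?gt_eqF// scale1r.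
Qed.

Lemma trigtB tr r B u f x : trig tr -> 0 < r -> ball_bounded r B u -> ball_bounded r B f ->
  trigt tr (fun xi => u xi - f xi) x = trigt tr u x - trigt tr f x.
Proof.
move=> ttr r0 bu bf; have B0 := ball_bounded_cst_ge0 r0 bu.
rewrite /trigt -RintegralB//; try exact: (trigt_integrable x (ltW r0) B0 ttr).
by apply: eq_Rintegral => xi _; rewrite mulrBr.
Qed.

Definition dilate j u x : R := 2 ^+ (j * n) * u (2 ^+ j *: x).

(** If u is the profile of psi_0, then psi_j for j >= 1 is the dilation by 2^j
    of this function. *)
Definition halve u y : R := u y - 2 ^- n * u (2^-1 *: y).

(** A dilation of the frequency variable by 2^(-j) is the L^1-normalized
    dilation by 2^j of the transform; the j-th piece of the resolution is a
    difference of two such dilations. *)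
Lemma trigt_resolution tr r B u j x : trig tr -> 0 < r -> ball_bounded r B u ->
  trigt tr (fun xi => u (2 ^- j.+1 *: xi) - u (2 ^- j *: xi)) x =
  dilate j.+1 (halve (trigt tr u)) x.
Proof.
move=> ttr r0 bu; have B0 := ball_bounded_cst_ge0 r0 bu.
have p j' : (0 : R) < 2 ^- j' by rewrite invr_gt0 exprn_gt0.
have b1 := ball_bounded_scale (p j.+1) bu.
have r1 : r / 2 ^- j <= r / 2 ^- j.+1.
  by rewrite !invrK ler_wpM2l ?(ltW r0)// ler_weXn2l// ler1n.
have b2 := le_ball_bounded B0 r1 (lexx B) (ball_bounded_scale (p j) bu).
have r2 : 0 < r / 2 ^- j.+1 by rewrite divr_gt0.
rewrite (trigtB x ttr r2 b1 b2) !(trigt_scale x ttr r0 _ bu)// /dilate /halve !invrK.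
have e k : (2 ^- k : R) ^- n = 2 ^+ (k * n) by rewrite -exprVn -exprM exprVn invrK.
rewrite !e mulrBr [in RHS]scalerA [2 ^+ j.+1]exprS mulKf//.
by rewrite mulrA mulSn exprD [2 ^+ n * _]mulrC mulfK ?expf_neq0.
Qed.

Lemma profile_halve u : profile u -> profile (halve u).
Proof.
move=> pu; rewrite /halve.
have -> : (fun y => u y - 2 ^- n * u (2^-1 *: y)) = (fun y => u y + (- 2 ^- n) * u (2^-1 *: y)).
  by apply/funext => y; rewrite mulNr.
by apply: profileD => //; apply: profileZ; apply: profile_scale => //; rewrite invr_gt0.
Qed.

(** The two terms are L^1-normalized dilations of the same function, and so
    have the same integral. No value of the Fourier transform is computed. *)
Lemma Rintegral_halve u : profile u -> \int[mu]_x (halve u x) = 0.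
Proof.
move=> pu; have iu := profile_integrable pu.
have h0 : (0 : R) < 2^-1 by rewrite invr_gt0.
have iu2 := profile_integrable (profile_scale h0 pu).
rewrite /halve RintegralB//; last first.
  exact: profile_integrable (profileZ (2 ^- n) (profile_scale h0 pu)).
rewrite RintegralZl// (Rintegral_rV_affine 0 (lt0r_neq0 h0) iu) gtr0_norm//.
rewrite exprVn; under [X in _ * X - _]eq_Rintegral do rewrite addr0.
exact: subrr.
Qed.

Lemma inv_fourierE phi r B x : 0 < r ->
  (forall pr, is_part pr -> ball_bounded r B (pr \o phi)) ->
  let c : R := (2 * pi) `^ (- (n%:R / 2)) in
  inv_fourier phi x =
  ((c * (trigt cos ((@complex.Re R) \o phi) x - trigt sin ((@complex.Im R) \o phi) x))%R +i*
   (c * (trigt cos ((@complex.Im R) \o phi) x + trigt sin ((@complex.Re R) \o phi) x))%R)%C.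
Proof.
move=> r0 bb c.
have bR := bb _ (or_introl erefl); have bI := bb _ (or_intror erefl).
have B0 := ball_bounded_cst_ge0 r0 bR.
have R0 := ltW r0.
have i1 := trigt_integrable x R0 B0 trig_cos bR; have i2 := trigt_integrable x R0 B0 trig_sin bI.
have i3 := trigt_integrable x R0 B0 trig_cos bI; have i4 := trigt_integrable x R0 B0 trig_sin bR.
rewrite /inv_fourier /cintegral /trigt -RintegralB// -RintegralD//.
have e1 : (\int[mu]_xi complex.Re (expi (dotp x xi) * phi xi)) = (\int[mu]_xi
    (cos (dotp x xi) * complex.Re (phi xi) - sin (dotp x xi) * complex.Im (phi xi))).
  by apply: eq_Rintegral => xi _; case: (phi xi).
have e2 : (\int[mu]_xi complex.Im (expi (dotp x xi) * phi xi)) = (\int[mu]_xi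
    (cos (dotp x xi) * complex.Im (phi xi) + sin (dotp x xi) * complex.Re (phi xi))).
  by apply: eq_Rintegral => xi _; case: (phi xi).
rewrite e1 e2; apply/eqP; rewrite eq_complex /=.
by rewrite !mul0r subr0 addr0 !eqxx.
Qed.

Lemma resolution_kernel phi0 : is_resolution_generator phi0 -> exists a b : E -> R,
  [/\ profile a, profile b,
    forall x, inv_fourier (resolution phi0 0) x = (a x +i* b x)%C &
    forall j x, inv_fourier (resolution phi0 j.+1) x =
      (dilate j.+1 (halve a) x +i* dilate j.+1 (halve b) x)%C].
Proof.
move=> gen; have [B B0 HB] := generator_ball_bounded gen.
pose c : R := (2 * pi) `^ (- (n%:R / 2)).
pose T tr pr : E -> R := trigt tr (pr \o phi0).
have pT tr pr : is_part pr -> trig tr -> profile (T tr pr) by exact: generator_profile.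
have pRe : is_part (@complex.Re R) by left.
have pIm : is_part (@complex.Im R) by right.
pose a x := c * (T cos (@complex.Re R) x + (- 1) * T sin (@complex.Im R) x).
pose b x := c * (T cos (@complex.Im R) x + T sin (@complex.Re R) x).
exists a, b; split.
- apply: profileZ; apply: profileD; first exact: pT _ _ pRe trig_cos.
  by apply: profileZ; exact: pT _ _ pIm trig_sin.
- apply: profileZ; apply: profileD; [exact: pT _ _ pIm trig_cos|exact: pT _ _ pRe trig_sin].
- by move=> x; rewrite (inv_fourierE x (ltr0n _ 2) HB) /a /b mulN1r.
move=> j x.
have p j' : (0 : R) < 2 ^- j' by rewrite invr_gt0 exprn_gt0.
have r2 : (0 : R) < 2 / 2 ^- j.+1 by rewrite divr_gt0.
have partE pr : is_part pr -> pr \o resolution phi0 j.+1 =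
  (fun xi => (pr \o phi0) (2 ^- j.+1 *: xi) - (pr \o phi0) (2 ^- j *: xi)).
  by case=> ->; apply/funext => xi /=; case: (phi0 _) => ? ?; case: (phi0 _).
have bb pr : is_part pr -> ball_bounded (2 / 2 ^- j.+1) (B + B) (pr \o resolution phi0 j.+1).
  move=> ppr; rewrite partE//.
  have r1 : (2 : R) / 2 ^- j <= 2 / 2 ^- j.+1.
    by rewrite !invrK ler_wpM2l// ler_weXn2l// ler1n.
  have [m1 b1] := ball_bounded_scale (p j.+1) (HB _ ppr).
  have [m2 b2] := le_ball_bounded B0 r1 (lexx B) (ball_bounded_scale (p j) (HB _ ppr)).
  split; first exact: measurable_funB.
  by move=> xi; apply: (le_trans (ler_normB _ _)); rewrite mulrDl; exact: lerD.
rewrite (inv_fourierE x r2 bb) !partE// -/c.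
have tE tr pr : is_part pr -> trig tr -> trigt tr (fun xi =>
    (pr \o phi0) (2 ^- j.+1 *: xi) - (pr \o phi0) (2 ^- j *: xi)) x = dilate j.+1 (halve (T tr pr)) x.
  by move=> ppr ttr; rewrite (trigt_resolution _ _ ttr (ltr0n _ 2) (HB _ ppr)).
rewrite !tE//; try exact: trig_cos; try exact: trig_sin.
by congr (_ +i* _)%C; rewrite /dilate /halve /a /b; ring.
Qed.

End resolution_kernels.

(** * From positive functions to the Besov norm *)

Local Open Scope ereal_scope.

Section lnorm_monotone.
Context d (T : measurableType d) {R : realType} (mu : {measure set T -> \bar R}).

(** The integral of a nonnegative function, measurable or not, is the supremum
    of the integrals of the simple functions below it. *)
Lemma ge0_le_integralT (f g : T -> \bar R) : (forall x, 0 <= f x) -> (forall x, f x <= g x) ->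
  \int[mu]_x f x <= \int[mu]_x g x.
Proof.
move=> f0 fg; rewrite !ge0_integralTE//; last by move=> x; exact: le_trans (fg x).
by apply: ub_ereal_sup => _ /= [h hf <-]; apply: ereal_sup_ubound; exists h => // x; exact: le_trans (fg x).
Qed.

Lemma Lnorm_le_scale (s : \bar R) (f g : T -> \bar R) (C : R) : 0 < s -> (0 < C)%R ->
  measurable_fun setT g -> (forall x, 0 <= g x) ->
  (forall x, 0 <= f x) -> (forall x, f x <= C%:E * g x) ->
  Lnorm mu s f <= C%:E * Lnorm mu s g.
Proof.
case: s => [s| |]// s0 C0 mg g0 f0 fg.
- rewrite lte_fin in s0; rewrite unlock.
  apply: (@le_trans _ _ ((\int[mu]_x ((C `^ s)%:E * `|g x| `^ s)) `^ s^-1)).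
    apply: le_poweR; first by rewrite invr_ge0 ltW.
      by apply: integral_ge0 => x _; exact: poweR_ge0.
    apply: ge0_le_integralT => x; first exact: poweR_ge0.
    rewrite gee0_abs// gee0_abs// -poweR_EFin -poweRM ?lee_fin ?(ltW C0)//.
    by apply: le_poweR => //; exact: ltW.
  rewrite ge0_integralZl//; last 3 first.
  - by apply: (measurableT_comp (measurable_poweR s)); exact: measurableT_comp.
  - by move=> x _; exact: poweR_ge0.
  - by rewrite lee_fin powR_ge0.
  rewrite poweRM ?lee_fin ?powR_ge0//; last by apply: integral_ge0 => x _; exact: poweR_ge0.
  rewrite -poweR_EFin poweRKV ?lee_fin ?(ltW C0)//.
rewrite unlock; case: ifPn => _; last by rewrite mule0.
rewrite -ess_sup_pZl//; apply: le_ess_sup; apply: nearW => x /=.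
by rewrite gee0_abs// gee0_abs.
Qed.

End lnorm_monotone.

Section complex_convolution.
Context {R : realType} {n : nat}.
Hypothesis n_gt0 : (0 < n)%N.
Local Notation C := R[i].
Local Notation E := 'rV[R]_n.
Local Notation mu := (lebesgue_rV R n).
Implicit Types (x y z : E) (f psi : E -> C) (j N : nat) (k : int).

Lemma cmodM (z w : C) : cmod (z * w)%R = (cmod z * cmod w)%R.
Proof. by rewrite /cmod ComplexField.Normc.normcM. Qed.

Lemma cmod_real (a : R) : cmod (a%:C)%C = `|a|%R.
Proof. by rewrite /cmod /= expr0n addr0 sqrtr_sqr. Qed.

Lemma measurable_cmod f : cmeasurable f -> measurable_fun setT (fun x => cmod (f x)).
Proof.
move=> [mr mi].
have -> : (fun x => cmod (f x)) = @Num.sqrt R \o (fun x => (complex.Re (f x) ^+ 2 + complex.Im (f x) ^+ 2)%R).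
  by apply/funext => x /=; case: (f x).
apply: measurableT_comp; first by apply: continuous_measurable_fun; exact: sqrt_continuous.
by apply: measurable_funD; apply: measurable_funX.
Qed.

Lemma cmeasurableM f psi : cmeasurable f -> cmeasurable psi -> cmeasurable (fun x => f x * psi x)%R.
Proof.
move=> [a b] [c d].
have H : ((fun x => complex.Re (f x * psi x)%R) = (fun x => complex.Re (f x) * complex.Re (psi x) - complex.Im (f x) * complex.Im (psi x))%R) *
  ((fun x => complex.Im (f x * psi x)%R) = (fun x => complex.Re (f x) * complex.Im (psi x) + complex.Im (f x) * complex.Re (psi x))%R).
  by split; apply/funext => x; case: (f x) => ? ?; case: (psi x).
rewrite /cmeasurable !H; split.
  by apply: measurable_funB; apply: measurable_funM.
by apply: measurable_funD; apply: measurable_funM.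
Qed.

Lemma herz_normE (alpha r q : R) f : (0 < q)%R ->
  herz_norm alpha r%:E q%:E f =
  (\esum_(k in [set: int]) (herz_term alpha q (fun x => (cmod (f x))%:E) k `^ r)) `^ r^-1.
Proof.
move=> q0; rewrite /herz_norm /ell_norm; congr (_ `^ _); apply: eq_esum => k _.
have e : \int[mu]_x (`|(cmod (restrict_to (dyadic_annulus k) f x))%:E| `^ q) =
    \int[mu]_x (shell_cut k (fun x => (cmod (f x))%:E) x `^ q).
  apply: eq_integral => x _; rewrite /restrict_to cmodM cmod_real /shell_cut.
  by rewrite EFinM gee0_abs ?mule_ge0 ?lee_fin ?cmod_ge0// ger0_norm.
by rewrite /herz_term /Lp_norm unlock e.
Qed.

(** Finite parts do not increase absolute values: fine vanishes at infinity.
    *)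
Lemma fine_abs_le (z : \bar R) : (`|fine z|)%:E <= `|z|.
Proof. by case: z => [z| |] //=; rewrite normr0 leey. Qed.

(** Each part of the integral is the finite part of an extended real, and so
    is at most the integral of the absolute value, finite or not. *)
Lemma cintegral_le f : cmeasurable f -> (cmod (cintegral f))%:E <= 2%:E * \int[mu]_x (cmod (f x))%:E.
Proof.
move=> mf; have [mr mi] := mf; rewrite /cintegral.
have m := measurable_cmod mf.
have key (h : E -> R) : measurable_fun setT h -> (forall x, `|h x| <= cmod (f x))%R ->
    (`|\int[mu]_x h x|%R)%:E <= \int[mu]_x (cmod (f x))%:E.
  move=> mh hb; apply: (le_trans (fine_abs_le _)).
  apply: (le_trans (le_abse_integral mu measurableT _)); first exact/measurable_EFinP.
  by apply: ge0_le_integralT => // x; rewrite lee_fin.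
have h1 := key _ mr (fun x => Re_le_cmod _); have h2 := key _ mi (fun x => Im_le_cmod _).
apply: (@le_trans _ _ ((`|\int[mu]_x complex.Re (f x)|%R)%:E + (`|\int[mu]_x complex.Im (f x)|%R)%:E)).
  by rewrite -EFinD lee_fin; apply: (le_trans (cmod_le _)).
rewrite (_ : 2%:E = 1%:E + 1%:E :> \bar R); last by rewrite -EFinD.
by rewrite ge0_muleDl// !mul1e; exact: leeD.
Qed.

Lemma measurable_dilate j u : profile u -> measurable_fun setT (@dilate R n j u).
Proof.
move=> pu; rewrite /dilate; apply: measurable_funM => //.
have -> : (fun x => u (2 ^+ j *: x)) = u \o (fun x => 2 ^+ j *: x + 0)%R.
  by apply/funext => x /=; rewrite addr0.
by apply: measurableT_comp; [exact: measurable_profile|exact: measurable_rV_affine].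
Qed.

Lemma dilate_le u N : profile u -> exists2 A : R, (0 <= A)%R &
  forall j x, (`|@dilate R n j u x| <= A * wker N j x)%R.
Proof.
move=> [_ /(_ N)[A A0 HA]]; exists A => // j x.
rewrite /dilate normrM ger0_norm ?exprn_ge0// /wker mulrCA ler_wpM2l ?exprn_ge0//.
by rewrite bracketE.
Qed.

Section with_generator.
Variable phi0 : E -> C.
Hypothesis gen : is_resolution_generator phi0.

(** One constant serves all frequencies, because the kernels are dilations of
    two complex profiles only. *)
Lemma kernel_bound N : exists2 A : R, (0 < A)%R & forall j, cmeasurable (inv_fourier (resolution phi0 j)) /\
  forall x, (cmod (inv_fourier (resolution phi0 j) x) <= A * wker N j x)%R.
Proof.
have [a [b [pa pb e0 e1]]] := resolution_kernel n_gt0 gen.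
have pa' := profile_halve pa; have pb' := profile_halve pb.
have [A0 p0 H0] := dilate_le N pa; have [A1 p1 H1] := dilate_le N pb.
have [A2 p2 H2] := dilate_le N pa'; have [A3 p3 H3] := dilate_le N pb'.
exists (A0 + A1 + A2 + A3 + 1)%R; first by rewrite ltr_wpDl// !addr_ge0.
have d0 (u : E -> R) x : u x = dilate 0 u x by rewrite /dilate mul0n expr0 mul1r scale1r.
case=> [|j].
  split=> [|x].
    by split; (under eq_fun do rewrite e0); exact: measurable_profile.
  rewrite e0; apply: (le_trans (cmod_le _)); rewrite /= [a x]d0 [b x]d0.
  apply: (le_trans (lerD (H0 0%N x) (H1 0%N x))).
  by rewrite -mulrDl ler_wpM2r ?wker_ge0//; lra.
split=> [|x].
  by split; (under eq_fun do rewrite e1); exact: measurable_dilate.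
rewrite e1; apply: (le_trans (cmod_le _)) => /=.
apply: (le_trans (lerD (H2 j.+1 x) (H3 j.+1 x))).
by rewrite -mulrDl ler_wpM2r ?wker_ge0//; lra.
Qed.

Lemma cmeasurable_subl x psi : cmeasurable psi -> cmeasurable (fun y => psi (x - y)%R).
Proof.
move=> [a b].
have ms : measurable_fun setT (fun y : E => x - y)%R.
  exact: (measurableT_comp measurable_rV_sub (@measurable_pair1 _ _ _ _ x)).
by split; [exact: (measurableT_comp a ms)|exact: (measurableT_comp b ms)].
Qed.

Lemma convolution_le N : exists2 A : R, (0 < A)%R & forall f j x, cmeasurable f ->
  (cmod (convolution (inv_fourier (resolution phi0 j)) (distribution_of f) x))%:E <=
  A%:E * convw N j (fun y => (cmod (f y))%:E) x.
Proof.
have [A A0 HA] := kernel_bound N; exists (2 * A)%R => [|f j x mf]; first exact: mulr_gt0.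
have [mp Hp] := HA j.
rewrite /convolution /distribution_of.
apply: (le_trans (cintegral_le (cmeasurableM mf (cmeasurable_subl x mp)))).
rewrite EFinM -muleA; apply: lee_wpmul2l => //.
have mc := measurable_cmod mf.
rewrite /convw -ge0_integralZl//; last 3 first.
- apply: emeasurable_funM; apply/measurable_EFinP => //; exact: measurable_wker_sub.
- by move=> y _; rewrite mule_ge0 ?lee_fin ?wker_ge0 ?cmod_ge0.
- by rewrite lee_fin ltW.
apply: ge0_le_integralT => y; first by rewrite lee_fin cmod_ge0.
by rewrite cmodM -!EFinM lee_fin mulrA mulrC ler_wpM2r ?cmod_ge0.
Qed.

(** Reduction to positive functions: psi_j * f is bounded by a multiple of w_j
    * |f|. *)
Lemma besov_norm_le (s1 alpha q r : R) (s : \bar R) N (D : R) : (1 < q)%R -> (0 < r)%R -> 0 < s ->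
  (0 < D)%R ->
  (forall g : E -> R, measurable_fun setT g -> (forall y, (0 <= g y)%R) ->
  \esum_(j in [set: nat]) (((2 `^ (j%:R * s1))%:E * Lnorm mu s (convw N j (EFin \o g))) `^ r) <=
   D%:E * \esum_(k in [set: int]) (herz_term alpha q (EFin \o g) k `^ r)) ->
  exists c : R, forall f, cmeasurable f ->
    besov_norm phi0 s1 s r%:E (distribution_of f) <= c%:E * herz_norm alpha r%:E q%:E f.
Proof.
move=> q1 r0 s0 D0 H; have q0 : (0 < q)%R by exact: lt_trans q1.
have [A A0 HA] := convolution_le N.
exists ((A `^ r * D) `^ r^-1)%R => f mf.
have mc := measurable_cmod mf.
pose g x := cmod (f x); have g0 x : (0 <= g x)%R by exact: cmod_ge0.
rewrite herz_normE// -poweR_EFin -poweRM ?lee_fin ?mulr_ge0 ?powR_ge0 ?(ltW D0)//; last first.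
  by apply: esum_ge0 => k _; exact: poweR_ge0.
rewrite /besov_norm /ell_norm; apply: le_poweR; first by rewrite invr_ge0 ltW.
  by apply: esum_ge0 => k _; exact: poweR_ge0.
rewrite EFinM -muleA; apply: le_trans (lee_wpmul2l _ (H g mc g0)); last by rewrite lee_fin powR_ge0.
rewrite -esumZ ?powR_ge0//; last by move=> j; exact: poweR_ge0.
apply: le_esum => j _.
have X0 : 0 <= (2 `^ (j%:R * s1))%:E * Lnorm mu s (convw N j (EFin \o g)).
  by rewrite mule_ge0 ?Lnorm_ge0// lee_fin powR_ge0.
rewrite -[(A `^ r)%:E]poweR_EFin -poweRM ?lee_fin ?(ltW A0)//.
apply: le_poweR; [exact: ltW|by rewrite mule_ge0 ?Lnorm_ge0// lee_fin powR_ge0|].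
rewrite muleCA; apply: lee_wpmul2l; first by rewrite lee_fin powR_ge0.
apply: Lnorm_le_scale => // [|x|x|x].
- by apply: measurable_convw; first exact/measurable_EFinP.
- by apply: convw_ge0 => y; rewrite lee_fin.
- by rewrite lee_fin cmod_ge0.
- exact: HA.
Qed.

End with_generator.
End complex_convolution.

(** * Elements of Herz spaces as tempered distributions *)

Section regular_distributions.
Context {R : realType} {n : nat}.
Hypothesis n_gt0 : (0 < n)%N.
Local Notation C := R[i].
Local Notation E := 'rV[R]_n.
Local Notation mu := (lebesgue_rV R n).
Implicit Types (x y z : E) (f g h phi psi : E -> C) (N M : nat) (k : int).

Lemma cintegrable_of_le g (G : E -> \bar R) : cmeasurable g -> measurable_fun setT G ->
  (forall x, 0 <= G x) -> \int[mu]_x G x < +oo -> (forall x, (cmod (g x))%:E <= G x) ->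
  cintegrable g.
Proof.
move=> [mr mi] mG G0 Goo gG.
have key (u : E -> R) : measurable_fun setT u -> (forall x, `|u x| <= cmod (g x))%R ->
    mu.-integrable setT (EFin \o u).
  move=> mu' ug; apply/integrableP; split; first exact/measurable_EFinP.
  apply: le_lt_trans Goo; apply: ge0_le_integralT => x //=.
  by apply: le_trans (gG x); rewrite lee_fin.
split; apply: key => // x; [exact: Re_le_cmod|exact: Im_le_cmod].
Qed.

Lemma cintegral_lin (a : C) g h : cintegrable g -> cintegrable h ->
  cintegral (fun x => a * g x + h x)%R = (a * cintegral g + cintegral h)%R.
Proof.
move=> [gr gi] [hr hi]; case: a => a b; rewrite /cintegral.
have z c (u : E -> R) : mu.-integrable setT (EFin \o u) ->
    mu.-integrable setT (EFin \o (fun x => c * u x)%R).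
  by move=> iu; have := integrableZl measurableT c iu; apply: eq_integrable.
have e1 : (\int[mu]_x complex.Re ((a +i* b)%C * g x + h x) =
  a * \int[mu]_x complex.Re (g x) - b * \int[mu]_x complex.Im (g x) + \int[mu]_x complex.Re (h x))%R.
  rewrite -!RintegralZl// -RintegralB//; try exact: z.
  rewrite -RintegralD//; last first.
    by have := integrableB measurableT (z a _ gr) (z b _ gi); apply: eq_integrable.
  by apply: eq_Rintegral => x _; case: (g x) => ? ?; case: (h x).
have e2 : (\int[mu]_x complex.Im ((a +i* b)%C * g x + h x) =
  a * \int[mu]_x complex.Im (g x) + b * \int[mu]_x complex.Re (g x) + \int[mu]_x complex.Im (h x))%R.
  rewrite -!RintegralZl// -RintegralD//; try exact: z.
  rewrite -RintegralD//; last first.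
    by have := integrableD measurableT (z a _ gi) (z b _ gr); apply: eq_integrable.
  by apply: eq_Rintegral => x _; case: (g x) => ? ?; case: (h x).
by rewrite e1 e2.
Qed.

Lemma schwartz_cmeasurable phi : schwartz phi -> cmeasurable phi.
Proof.
by move=> [sm _]; split; [apply: (measurable_part _ sm); left|apply: (measurable_part _ sm); right].
Qed.

(** Finiteness of this integral for some M is what makes f a tempered
    distribution. *)
Definition weighted_mass M f : \bar R := \int[mu]_y ((bracket 0 y ^- M)%:E * (cmod (f y))%:E).

Section finite_mass.
Variables (M : nat) (f : E -> C).
Hypothesis mf : cmeasurable f.
Hypothesis foo : weighted_mass M f < +oo.

Let mwf : measurable_fun setT (fun y => (bracket 0 y ^- M)%:E * (cmod (f y))%:E).
Proof.
apply: emeasurable_funM; apply/measurable_EFinP; first exact: measurable_bracketX.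
exact: measurable_cmod.
Qed.

Let wf0 y : 0 <= (bracket 0 y ^- M)%:E * (cmod (f y))%:E.
Proof. by rewrite mule_ge0// lee_fin ?bracketVX_ge0 ?cmod_ge0. Qed.

Lemma cintegrable_weighted g (A : R) : cmeasurable g -> (0 <= A)%R ->
  (forall y, cmod (g y) <= A * (bracket 0 y ^- M * cmod (f y)))%R -> cintegrable g.
Proof.
move=> mg A0 gA.
apply: (@cintegrable_of_le g (fun y => A%:E * ((bracket 0 y ^- M)%:E * (cmod (f y))%:E))) => //.
- exact: emeasurable_funM.
- by move=> y; rewrite mule_ge0.
- by rewrite ge0_integralZl// lte_mul_pinfty// ge0_fin_numE ?ltry.
Qed.

Lemma cintegrable_restrict (K : set E) : compact K -> cintegrable (restrict_to K f).
Proof.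
move=> cK; have mK := compact_rV_measurable cK.
have mi : measurable_fun setT (\1_K : E -> R) by exact: measurable_indic.
have [rho rho0 Hrho] : exists2 rho : R, (0 <= rho)%R & forall x, K x -> (eucl_norm x <= rho)%R.
  have /pinfty_ex_gt0[B B0 HB] := compact_bounded cK.
  exists (n%:R * B)%R => [|x Kx]; first by rewrite mulr_ge0// ltW.
  apply: le_trans (eucl_norm_le_sum x) _.
  apply: (@le_trans _ _ (\sum_(j < n) B)%R); last by rewrite sumr_const card_ord mulr_natl.
  by apply: ler_sum => i _; apply: le_trans (HB _ Kx); rewrite [leRHS]mx_normrE; apply: (le_bigmax_cond _ (fun i => `|x i.1 i.2|%R) (j := (ord0, i))).
apply: (@cintegrable_weighted _ ((1 + rho) ^+ M)%R).
- apply: cmeasurableM => //; split => //=; exact: measurable_cst.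
- by rewrite exprn_ge0// addr_ge0.
move=> y; rewrite /restrict_to cmodM cmod_real indicE.
have b0 := bracket_gt0 0 y.
have [/set_mem/Hrho yr|_] := boolP (y \in K); last first.
  by rewrite normr0 mulr0 !mulr_ge0 ?exprn_ge0 ?addr_ge0 ?bracketVX_ge0 ?cmod_ge0.
rewrite normr1 mulr1 mulrA -[leLHS]mul1r ler_wpM2r ?cmod_ge0//.
rewrite ler_pdivlMr ?exprn_gt0// mul1r lerXn2r ?nnegrE ?(ltW b0) ?addr_ge0//.
by rewrite /bracket expr0 mul1r lerD2l.
Qed.

Lemma cintegrable_schwartz phi : schwartz phi -> cintegrable (fun x => f x * phi x)%R.
Proof.
move=> sphi; have [A A0 HA] := schwartz_decay M sphi.
apply: (@cintegrable_weighted _ A) => //; first exact: (cmeasurableM mf (schwartz_cmeasurable sphi)).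
move=> y; rewrite cmodM mulrA mulrC ler_wpM2r ?cmod_ge0//.
rewrite ler_pdivlMr ?exprn_gt0 ?bracket_gt0// mulrC /bracket expr0 mul1r.
exact: (HA [::]).
Qed.

(** A Schwartz seminorm of order M bounds phi by (1 + |y|)^(-M), so that |<f,
    phi>| is at most twice the product of this seminorm and of the weighted
    mass. *)
Lemma regular_tempered_weighted : regular_tempered f.
Proof.
split; [exact: cintegrable_restrict|exact: cintegrable_schwartz|split].
  move=> a phi psi sphi spsi; rewrite /distribution_of -cintegral_lin; try exact: cintegrable_schwartz.
  by congr cintegral; apply/funext => x; rewrite mulrDr mulrCA.
move=> phi sphi e e0.
have W0 : 0 <= weighted_mass M f by apply: integral_ge0.
have [w Ew] : exists w : R, weighted_mass M f = w%:E.
  by exists (fine (weighted_mass M f)); rewrite fineK// ge0_fin_numE.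
rewrite Ew lee_fin in W0.
have c0 : (0 < 2 * w + 1)%R by lra.
exists M, (e / (2 * w + 1))%R; split=> [|psi spsi sd]; first by rewrite divr_gt0.
set d := (e / (2 * w + 1))%R in sd *.
have d0 : (0 < d)%R by rewrite divr_gt0.
have -> : (distribution_of f psi - distribution_of f phi)%R = cintegral (fun x => f x * (psi x - phi x))%R.
  rewrite addrC -mulN1r /distribution_of -cintegral_lin; try exact: cintegrable_schwartz.
  by congr cintegral; apply/funext => x; ring.
have Hd y : (cmod (psi y - phi y) <= d * bracket 0 y ^- M)%R.
  rewrite ler_pdivlMr ?exprn_gt0 ?bracket_gt0// mulrC -lee_fin; apply: le_trans (ltW sd).
  apply: ereal_sup_ubound; exists [::], y; split=> //.
  by rewrite /bracket expr0 mul1r.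
have mdiff : cmeasurable (fun x => psi x - phi x)%R.
  have [a1 a2] := schwartz_cmeasurable sphi; have [b1 b2] := schwartz_cmeasurable spsi.
  split.
    rewrite (_ : (fun x => _) = (fun x => complex.Re (psi x) - complex.Re (phi x))%R).
      exact: measurable_funB.
    by apply/funext => x /=; case: (psi x); case: (phi x).
  rewrite (_ : (fun x => _) = (fun x => complex.Im (psi x) - complex.Im (phi x))%R).
    exact: measurable_funB.
  by apply/funext => x /=; case: (psi x); case: (phi x).
rewrite -lte_fin.
apply: (le_lt_trans (cintegral_le (cmeasurableM mf mdiff))).
apply: (@le_lt_trans _ _ (2%:E * (d%:E * weighted_mass M f))).
  apply: lee_wpmul2l => //; rewrite -ge0_integralZl//; last by rewrite lee_fin ltW.
  apply: ge0_le_integralT => y; first by rewrite lee_fin cmod_ge0.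
  by rewrite cmodM -!EFinM lee_fin mulrA mulrC ler_wpM2r ?cmod_ge0.
rewrite Ew -!EFinM lte_fin /d (_ : 2 * (e / (2 * w + 1) * w) = e * (2 * w) / (2 * w + 1))%R; last by ring.
by rewrite ltr_pdivrMr// ltr_pM2l//; lra.
Qed.

End finite_mass.

(** The bound far_sum at j = 0: the Herz terms are bounded by the Herz norm
    and the geometric factors are summable. *)
Lemma herz_regular (alpha q r : R) f : (1 < q)%R -> (0 < r)%R -> (0 <= alpha)%R ->
  (alpha < n%:R - n%:R / q)%R -> herz_space alpha r%:E q%:E f -> regular_tempered f.
Proof.
move=> q1 r0 al0 al1 [[mf _] foo]; have q0 : (0 < q)%R by exact: lt_trans q1.
have mc := measurable_cmod mf.
apply: (@regular_tempered_weighted (n + n)) => //.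
have [A A0 HA] := far_sum n_gt0 (ltW q1) al0 al1 (leqnn (n + n)).
rewrite herz_normE// in foo; set S := (X in X `^ _) in foo.
pose F y := (cmod (f y))%:E : \bar R.
have mF : measurable_fun setT F by exact/measurable_EFinP.
have F0 y : 0 <= F y by rewrite lee_fin cmod_ge0.
have := HA 0%N F mF F0; rewrite mul0r powRr0 mul1e -/(weighted_mass (n + n) f).
set c := (2 `^ _)%R.
have c01 : (0 < c < 1)%R by apply: pow2N_itv; rewrite subr_gt0.
have [W W0 HW] := esum_geometric_int c01.
move/le_lt_trans; apply.
set H := S `^ r^-1 in foo.
have H0 : 0 <= H by exact: poweR_ge0.
have Hfin : H \is a fin_num by rewrite ge0_fin_numE.
have hH k : herz_term alpha q F k <= H.
  apply: poweR_le_inv => //; first exact: herz_term_ge0.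
  by apply: (@esum_ge_term _ _ (fun k => herz_term alpha q F k `^ r)) => i; exact: poweR_ge0.
apply: (@le_lt_trans _ _ (A%:E * (W%:E * H))); last by rewrite -(fineK Hfin) -!EFinM ltry.
apply: lee_wpmul2l; first by rewrite lee_fin ltW.
have c0 k : (0 <= c ^+ `|k|%N)%R by have /andP[/ltW ? _] := c01; rewrite exprn_ge0.
apply: (@le_trans _ _ (\esum_(k in [set: int]) (H * (c ^+ absz (k - 0)%R)%:E))).
  apply: le_esum => k _; rewrite oppr0 sub0r abszN subr0 muleC.
  by apply: lee_wpmul2r; [rewrite lee_fin|exact: hH].
rewrite -(fineK Hfin) esumZ ?fine_ge0//; last by move=> k; rewrite lee_fin subr0.
by rewrite muleC; apply: lee_wpmul2r; [rewrite lee_fin fine_ge0|exact: HW].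
Qed.

End regular_distributions.

(** * Square integrable functions and integral operators *)

Local Close Scope ereal_scope.

Section square_integrable.
Context d (T : measurableType d) {R : realType} (mu : {measure set T -> \bar R}).
Implicit Types (a b c : T -> R).

Definition L2 a := measurable_fun setT a /\ (\int[mu]_x (a x ^+ 2)%:E < +oo)%E.

Definition ip a b : R := \int[mu]_x (a x * b x).

Lemma L2_sqr_integrable a : L2 a -> mu.-integrable setT (EFin \o (fun x => a x ^+ 2)).
Proof.
move=> [ma aoo]; apply/integrableP; split; first by apply/measurable_EFinP; exact: measurable_funX.
by under eq_integral do rewrite /= ger0_norm ?sqr_ge0//.
Qed.

Lemma L2_integrable a b : L2 a -> L2 b -> mu.-integrable setT (EFin \o (fun x => a x * b x)).
Proof.
move=> La Lb; have [ma _] := La; have [mb _] := Lb.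
apply: (le_integrable _ _ _ (integrableD measurableT (L2_sqr_integrable La) (L2_sqr_integrable Lb))) => //.
  by apply/measurable_EFinP; exact: measurable_funM.
move=> x _ /=; rewrite lee_fin [leRHS]ger0_norm ?addr_ge0 ?sqr_ge0//.
rewrite normrM -(real_normK (num_real (a x))) -(real_normK (num_real (b x))).
have := sqr_ge0 (`|a x| - `|b x|); have := normr_ge0 (a x); have := normr_ge0 (b x).
nra.
Qed.

Lemma L2_le (A : R) a b : measurable_fun setT b -> L2 a ->
  (forall x, `|b x| <= A * `|a x|) -> L2 b.
Proof.
move=> mb [ma aoo] ba; split=> //.
apply: (@le_lt_trans _ _ (\int[mu]_x ((A ^+ 2)%:E * (a x ^+ 2)%:E))%E).
  apply: ge0_le_integralT => x; first by rewrite lee_fin sqr_ge0.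
  rewrite -EFinM lee_fin -(real_normK (num_real (b x))) -(real_normK (num_real (a x))) -exprMn.
  by rewrite lerXn2r ?nnegrE// (le_trans _ (ba x)).
rewrite ge0_integralZl ?lee_fin ?sqr_ge0//; last 2 first.
- by apply/measurable_EFinP; exact: measurable_funX.
- by move=> x _; rewrite lee_fin sqr_ge0.
rewrite lte_mul_pinfty ?lee_fin ?sqr_ge0//.
Qed.

Lemma L2Z (k : R) a : L2 a -> L2 (fun x => k * a x).
Proof.
move=> La; apply: (@L2_le `|k| _ _ _ La) => [|x]; last by rewrite normrM.
by apply: measurable_funM => //; case: La.
Qed.

Lemma L2D a b : L2 a -> L2 b -> L2 (fun x => a x + b x).
Proof.
move=> La Lb; have [ma _] := La; have [mb _] := Lb; split; first exact: measurable_funD.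
have i1 := integrableD measurableT (L2_sqr_integrable La) (L2_sqr_integrable Lb).
have /integrableP[_] := integrableZl measurableT 2 i1.
apply: le_lt_trans; apply: ge0_le_integralT => x; first by rewrite lee_fin sqr_ge0.
rewrite /= lee_fin [leRHS]ger0_norm ?mulr_ge0 ?addr_ge0 ?sqr_ge0//.
have := sqr_ge0 (a x - b x); nra.
Qed.

Lemma L2_sum J (a : nat -> T -> R) : (forall j, L2 (a j)) -> L2 (fun x => \sum_(j < J) a j x).
Proof.
move=> La; elim: J => [|J IH].
  split.
    rewrite (_ : (fun _ => _) = cst 0); first exact: measurable_cst.
    by apply/funext => x; rewrite big_ord0.
  by under eq_integral do rewrite big_ord0 expr0n/=; rewrite integral0.
by under eq_fun do rewrite big_ord_recr/=; exact: L2D.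
Qed.

Lemma ipC a b : ip a b = ip b a.
Proof. by apply: eq_Rintegral => x _; rewrite mulrC. Qed.

Lemma ipDl a b c : L2 a -> L2 b -> L2 c -> ip (fun x => a x + b x) c = ip a c + ip b c.
Proof.
move=> La Lb Lc; rewrite /ip -RintegralD//; try exact: L2_integrable.
by apply: eq_Rintegral => x _; rewrite mulrDl.
Qed.

Lemma ipZl k a b : L2 a -> L2 b -> ip (fun x => k * a x) b = k * ip a b.
Proof.
move=> La Lb; rewrite /ip -RintegralZl//; last exact: L2_integrable.
by apply: eq_Rintegral => x _; rewrite mulrA.
Qed.

Lemma ip_suml J (a : nat -> T -> R) b : (forall j, L2 (a j)) -> L2 b ->
  ip (fun x => \sum_(j < J) a j x) b = \sum_(j < J) ip (a j) b.
Proof.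
move=> La Lb; elim: J => [|J IH].
  by rewrite big_ord0 /ip; under eq_Rintegral do rewrite big_ord0 mul0r; rewrite Rintegral_cst// mul0r.
rewrite big_ord_recr/= -IH -ipDl//; last exact: L2_sum.
by apply: eq_Rintegral => x _; rewrite big_ord_recr.
Qed.

Lemma ip_ge0 a : 0 <= ip a a.
Proof. by apply: Rintegral_ge0 => x _; rewrite -expr2 sqr_ge0. Qed.

Lemma ipE a : L2 a -> (ip a a)%:E = (\int[mu]_x (a x ^+ 2)%:E)%E.
Proof.
move=> La; rewrite /ip /Rintegral fineK; last exact: (integrable_fin_num _ (L2_integrable La La)).
by apply: eq_integral => x _; rewrite expr2.
Qed.

Lemma ip_expand (k : R) a b : L2 a -> L2 b ->
  ip (fun x => k * a x + b x) (fun x => k * a x + b x) =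
  k ^+ 2 * ip a a + 2 * k * ip a b + ip b b.
Proof.
move=> La Lb; have Lk := L2Z k La; have Ls := L2D Lk Lb.
rewrite ipDl// ipZl// ipC [ip b _]ipC !ipDl// !ipZl// (ipC b a); ring.
Qed.

End square_integrable.

Section integral_operators.
Context {R : realType} {n : nat}.
Local Notation E := 'rV[R]_n.
Local Notation mu := (lebesgue_rV R n).
Local Notation w := (@wker R n n.+1).
Local Notation L2 := (@L2 _ _ R mu).
Local Notation ip := (@ip _ _ R mu).
Implicit Types (x y z : E) (a b g h : E -> R) (B : E -> E -> R) (j k : nat) (A : R).

(** Kernels with the majorant w_j. The operator with kernel B is written g |->
    (x |-> ip (B x) g). *)
Definition kern A j B := measurable_fun setT (fun z : E * E => B z.1 z.2) /\
  forall x y, `|B x y| <= A * w j (x - y).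

Definition absE g : E -> \bar R := fun y => (`|g y|)%:E.

Lemma wkerN N j z : @wker R n N j (- z) = wker N j z.
Proof. by rewrite /wker bracketN. Qed.

Lemma kern_transpose A j B : kern A j B -> kern A j (fun x y => B y x).
Proof.
move=> [mB HB]; split=> [|x y]; last by rewrite -wkerN opprB.
rewrite (_ : (fun _ => _) = (fun z : E * E => B z.1 z.2) \o (fun z : E * E => (z.2, z.1)))//.
apply: measurableT_comp => //; apply: measurable_fun_pair; [exact: measurable_snd|exact: measurable_fst].
Qed.

Lemma L2_wker j x : L2 (fun y => w j (x - y)).
Proof.
have mw : measurable_fun setT (fun y => w j (x - y)) by exact: measurable_wker_sub.
split=> //; have [C C0 HC] := @integral_wker_le R n.
have [h _] := HC j n.+1 (ltnSn n) x.
apply: (@le_lt_trans _ _ (\int[mu]_y ((2 ^+ (j * n))%:E * (w j (x - y))%:E))%E).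
  apply: ge0_le_integralT => y; first by rewrite lee_fin sqr_ge0.
  by rewrite -EFinM lee_fin expr2 ler_wpM2r ?wker_ge0 ?wker_le.
rewrite ge0_integralZl ?lee_fin ?exprn_ge0//; last 2 first.
- exact/measurable_EFinP.
- by move=> y _; rewrite lee_fin wker_ge0.
by rewrite lte_mul_pinfty ?lee_fin ?exprn_ge0// (le_lt_trans h)// ltry.
Qed.

Lemma L2_kern A j B x : kern A j B -> L2 (B x).
Proof.
move=> [mB HB]; apply: (@L2_le _ _ _ _ A (fun y => w j (x - y))) => [||y].
- exact: (measurableT_comp mB (@measurable_pair1 _ _ _ _ x)).
- exact: L2_wker.
- by rewrite [`|w _ _|]ger0_norm ?wker_ge0.
Qed.

Lemma op_le A j B g x : 0 <= A -> kern A j B -> L2 g ->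
  ((`|ip (B x) g|)%:E <= A%:E * convw n.+1 j (absE g) x)%E.
Proof.
move=> A0 kB Lg; have LB := L2_kern x kB; have iBg := L2_integrable LB Lg.
have [mg _] := Lg; have [_ HB] := kB.
apply: (le_trans (fine_abs_le _)); apply: (le_trans (le_abse_integral mu measurableT _)).
  exact: measurable_int iBg.
rewrite /convw -ge0_integralZl//; last 2 first.
- apply: emeasurable_funM; apply/measurable_EFinP; first exact: measurable_wker_sub.
  exact: measurableT_comp.
- by move=> y _; rewrite mule_ge0 ?lee_fin ?wker_ge0.
apply: ge0_le_integralT => // y; rewrite -!EFinM lee_fin /= normrM mulrA.
by rewrite ler_wpM2r.
Qed.

Lemma measurable_op A j B g : kern A j B -> L2 g -> measurable_fun setT (fun x => ip (B x) g).
Proof.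
move=> [mB HB] [mg _]; pose F (z : E * E) : \bar R := (B z.1 z.2 * g z.2)%:E.
have mF : measurable_fun setT F.
  apply/measurable_EFinP; apply: measurable_funM => //.
  exact: (measurableT_comp mg measurable_snd).
have mI : measurable_fun setT (fun x => \int[mu]_y F (x, y))%E.
  under eq_fun do rewrite integralE.
  apply: emeasurable_funB.
    rewrite (_ : (fun x => _) = fubini_F mu (F ^\+)%E).
      by apply: measurable_fun_fubini_tonelli_F => //; exact: measurable_funepos.
    by apply/funext => x; apply: eq_integral => y _; rewrite !funeposE.
  rewrite (_ : (fun x => _) = fubini_F mu (F ^\-)%E).
    by apply: measurable_fun_fubini_tonelli_F => //; exact: measurable_funeneg.
  by apply/funext => x; apply: eq_integral => y _; rewrite !funenegE.
exact: (measurableT_comp (fine_measurable measurableT) mI).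
Qed.

Lemma absE_sqr g y : (absE g y `^ 2 = (g y ^+ 2)%:E)%E.
Proof. by rewrite /absE poweR_EFin powR_mulrn// real_normK// num_real. Qed.

Lemma measurable_absE g : measurable_fun setT g -> measurable_fun setT (absE g).
Proof. by move=> mg; apply/measurable_EFinP; exact: measurableT_comp. Qed.

Lemma absE_ge0 g y : (0 <= absE g y)%E.
Proof. by rewrite lee_fin. Qed.

Lemma convw_L2 : exists2 C : R, 0 < C & forall j G, measurable_fun setT G ->
  (forall y, 0 <= G y)%E ->
  (\int[mu]_x (convw n.+1 j G x `^ 2) <= C%:E * \int[mu]_y (G y `^ 2))%E.
Proof.
have two : 1 <= 2 :> R by rewrite ler1n.
have [C C0 HC] := @convw_Lq R n 2 n.+1 two (ltnSn n).
by exists C => // j G mG G0; have [] := HC j G mG G0.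
Qed.

Lemma op_L2 : exists2 C : R, 0 < C & forall A j B g, 0 <= A -> kern A j B -> L2 g ->
  L2 (fun x => ip (B x) g) /\
  (\int[mu]_x (ip (B x) g ^+ 2)%:E <= (A ^+ 2 * C)%:E * \int[mu]_y (g y ^+ 2)%:E)%E.
Proof.
have [C C0 HC] := convw_L2; exists C => // A j B g A0 kB Lg.
have [mg goo] := Lg.
have key : (\int[mu]_x (ip (B x) g ^+ 2)%:E <= (A ^+ 2 * C)%:E * \int[mu]_y (g y ^+ 2)%:E)%E.
  apply: (@le_trans _ _ (\int[mu]_x ((A ^+ 2)%:E * convw n.+1 j (absE g) x `^ 2))%E).
    apply: ge0_le_integralT => x; first by rewrite lee_fin sqr_ge0.
    rewrite -(absE_sqr (fun x => ip (B x) g)) -powR_mulrn// -poweR_EFin.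
    rewrite -poweRM ?lee_fin//; last by apply: convw_ge0 => y; exact: absE_ge0.
    apply: le_poweR => //; first exact: absE_ge0.
    exact: (op_le x A0 kB Lg).
  rewrite ge0_integralZl ?lee_fin ?sqr_ge0//; last 2 first.
  - by apply: measurable_poweR_comp; apply: measurable_convw; [exact: measurable_absE|exact: absE_ge0].
  - by move=> x _; exact: poweR_ge0.
  rewrite [(A ^+ 2 * C)%:E]EFinM -muleA; apply: lee_wpmul2l; first by rewrite lee_fin sqr_ge0.
  apply: (le_trans (HC j _ (measurable_absE mg) (absE_ge0 g))).
  by under eq_integral do rewrite absE_sqr.
split=> //; split; first exact: (measurable_op kB Lg).
apply: (le_lt_trans key); rewrite lte_mul_pinfty ?lee_fin ?mulr_ge0 ?sqr_ge0 ?(ltW C0)//.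
Qed.

(** Fubini's theorem: |a(x) B(x, y) b(y)| is integrable on the product, being
    dominated by a^2 + (w_j * |b|)^2 after integration in y. *)
Lemma ip_adjoint A j B a b : 0 <= A -> kern A j B -> L2 a -> L2 b ->
  ip a (fun x => ip (B x) b) = ip b (fun y => ip (B^~ y) a).
Proof.
move=> A0 kB La Lb; have [mB HB] := kB; have [ma aoo] := La; have [mb boo] := Lb.
pose F (z : E * E) : \bar R := (a z.1 * (B z.1 z.2 * b z.2))%:E.
have mF : measurable_fun setT F.
  apply/measurable_EFinP; apply: measurable_funM.
    exact: (measurableT_comp ma measurable_fst).
  by apply: measurable_funM => //; exact: (measurableT_comp mb measurable_snd).
have [C C0 HC] := convw_L2.
have iF : (mu \x mu)%E.-integrable setT F.
  apply/integrable12ltyP => //.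
  have mc : measurable_fun setT (convw n.+1 j (absE b)).
    by apply: measurable_convw; [exact: measurable_absE|exact: absE_ge0].
  have c0 x : (0 <= convw n.+1 j (absE b) x)%E by apply: convw_ge0 => y; exact: absE_ge0.
  apply: (@le_lt_trans _ _ (\int[mu]_x (A%:E * ((a x ^+ 2)%:E + convw n.+1 j (absE b) x `^ 2)))%E).
    apply: ge0_le_integralT => x; first exact: integral_ge0.
    apply: (@le_trans _ _ ((`|a x|)%:E * (A%:E * convw n.+1 j (absE b) x))%E).
      rewrite /convw -ge0_integralZl//; last 2 first.
      - apply: emeasurable_funM; last exact: measurable_absE.
        by apply/measurable_EFinP; exact: measurable_wker_sub.
      - by move=> y _; rewrite mule_ge0 ?lee_fin ?wker_ge0.
      rewrite -ge0_integralZl ?lee_fin//; last 2 first.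
      - apply: emeasurable_funM => //; apply: emeasurable_funM; last exact: measurable_absE.
        by apply/measurable_EFinP; exact: measurable_wker_sub.
      - by move=> y _; rewrite mule_ge0 ?mule_ge0 ?lee_fin ?wker_ge0.
      apply: ge0_le_integralT => // y; rewrite /F /absE /= -!EFinM lee_fin !normrM.
      by rewrite ler_wpM2l// mulrA ler_wpM2r.
    rewrite muleCA; apply: lee_wpmul2l => //.
    case: (convw n.+1 j (absE b) x) (c0 x) => [t| |]//.
      rewrite lee_fin => t0; rewrite poweR_EFin powR_mulrn// -EFinM -EFinD lee_fin.
      rewrite -(real_normK (num_real (a x))).
      by have := sqr_ge0 (`|a x| - t); have := normr_ge0 (a x); nra.
    by move=> _; rewrite poweRyr ?pnatr_eq0// addey ?leey.
  rewrite ge0_integralZl//; last 2 first.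
  - apply: emeasurable_funD; last exact: measurable_poweR_comp.
    by apply/measurable_EFinP; exact: measurable_funX.
  - by move=> x _; rewrite adde_ge0 ?poweR_ge0// lee_fin sqr_ge0.
  rewrite ge0_integralD//; last 4 first.
  - by move=> x _; rewrite lee_fin sqr_ge0.
  - by apply/measurable_EFinP; exact: measurable_funX.
  - by move=> x _; exact: poweR_ge0.
  - exact: measurable_poweR_comp.
  rewrite lte_mul_pinfty// lte_add_pinfty//.
  apply: (le_lt_trans (HC j _ (measurable_absE mb) (absE_ge0 b))).
  under eq_integral do rewrite absE_sqr.
  by rewrite lte_mul_pinfty// lee_fin ltW.
have iB x : mu.-integrable setT (EFin \o (fun y => B x y * b y)).
  by apply: L2_integrable => //; exact: L2_kern kB.
have iBt y : mu.-integrable setT (EFin \o (fun x => B x y * a x)).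
  by apply: L2_integrable => //; exact: (L2_kern y (kern_transpose kB)).
have e1 x : (\int[mu]_y F (x, y) = (a x * ip (B x) b)%:E)%E.
  rewrite /F /ip EFinM fineK; last exact: (integrable_fin_num _ (iB x)).
  by rewrite -(integralZl measurableT (iB x)); apply: eq_integral => y _; rewrite /= -EFinM.
have e2 y : (\int[mu]_x F (x, y) = (b y * ip (B^~ y) a)%:E)%E.
  rewrite /F /ip EFinM fineK; last exact: (integrable_fin_num _ (iBt y)).
  rewrite -(integralZl measurableT (iBt y)); apply: eq_integral => x _ /=.
  by rewrite -EFinM; congr EFin; ring.
rewrite {1 3}/ip /Rintegral; congr fine.
transitivity (\int[mu]_x \int[mu]_y F (x, y))%E; first by apply: eq_integral => x _; rewrite e1.
by rewrite (Fubini iF); apply: eq_integral => y _; rewrite e2.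
Qed.

End integral_operators.

(** * Almost orthogonality of the frequency pieces *)

(** The two summands contribute equally. *)
Lemma symmetric_double_sum (R : comRingType) J (c : nat -> nat -> R) (s : nat -> R) :
  (forall j k, c j k = c k j) ->
  \sum_(j < J) \sum_(k < J) c j k * (s j + s k) = 2 * \sum_(j < J) \sum_(k < J) c j k * s j.
Proof.
move=> csym; rewrite mulr_natl mulr2n -[in RHS](big_mkord xpredT (fun j => \sum_(k < J) c j k * s j)).
have ex : \sum_(j < J) \sum_(k < J) c j k * s k = \sum_(j < J) \sum_(k < J) c j k * s j.
  rewrite exchange_big; apply: eq_bigr => j _; apply: eq_bigr => k _; by rewrite csym.
rewrite big_mkord -[X in _ = _ + X]ex -big_split; apply: eq_bigr => j _.
by rewrite -big_split; apply: eq_bigr => k _; rewrite mulrDr.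
Qed.

Section almost_orthogonality.
Context {R : realType} {n : nat}.
Hypothesis n_gt0 : (0 < n)%N.
Local Notation E := 'rV[R]_n.
Local Notation mu := (lebesgue_rV R n).
Local Notation w := (@wker R n n.+1).
Local Notation L2 := (@L2 _ _ R mu).
Local Notation ip := (@ip _ _ R mu).
Implicit Types (x y z : E) (a b g h : E -> R) (j k m : nat).

Variable kappa : E -> R.
Hypothesis prof : profile kappa.

Definition ckern j x y : R := dilate j kappa (x - y).

Lemma ckern_kern : exists2 A : R, 0 <= A & forall j, kern A j (ckern j).
Proof.
have [A A0 HA] := dilate_le n.+1 prof; exists A => // j; split; last by move=> x y; exact: HA.
rewrite (_ : (fun _ => _) = dilate j kappa \o (fun z : E * E => z.1 - z.2))//.
by apply: measurableT_comp; [exact: measurable_dilate|exact: measurable_rV_sub].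
Qed.

(** The geometric mean of the Lipschitz bound and of the decay: a Hoelder
    estimate of exponent 1/2 that is still integrable. *)
Lemma profile_holder : exists2 H : R, 0 <= H & forall u v : E,
  `|kappa u - kappa v| <= H * Num.sqrt (eucl_norm (u - v)) *
     ((1 + eucl_norm u) ^- n.+1 + (1 + eucl_norm v) ^- n.+1).
Proof.
have [[L L0 HL] /(_ (n.+1 * 2)%N)[C C0 HC]] := prof.
exists (Num.sqrt (L * C)) => // u v.
set p := _ ^- n.+1; set q := (1 + eucl_norm v) ^- n.+1.
have p0 : 0 <= p by rewrite invr_ge0 exprn_ge0// addr_ge0.
have q0 : 0 <= q by rewrite invr_ge0 exprn_ge0// addr_ge0.
have r0 : 0 <= Num.sqrt (L * C) * Num.sqrt (eucl_norm (u - v)) * (p + q).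
  by rewrite mulr_ge0 ?addr_ge0 ?mulr_ge0 ?sqrtr_ge0.
rewrite -(@ler_pXn2r _ 2)// ?nnegrE// !exprMn !sqr_sqrtr ?mulr_ge0//.
have h1 := HL u v.
have h2 : `|kappa u - kappa v| <= C * (p ^+ 2 + q ^+ 2).
  apply: (le_trans (ler_normB _ _)); rewrite mulrDr /p /q -!exprVn -!exprM !exprVn.
  by apply: lerD; exact: HC.
rewrite expr2; apply: (le_trans (ler_pM _ _ h1 h2)) => //.
rewrite [leRHS](_ : _ = L * eucl_norm (u - v) * (C * (p + q) ^+ 2)); last by ring.
rewrite ler_wpM2l ?mulr_ge0// ler_wpM2l//.
have := mulr_ge0 p0 q0; rewrite sqrrD; nra.
Qed.

Lemma ckern_diff : exists2 H : R, 0 <= H & forall j x y x',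
  `|ckern j x y - ckern j x x'| <=
  H * Num.sqrt (2 ^+ j * eucl_norm (x' - y)) * (w j (x - y) + w j (x - x')).
Proof.
have [H H0 HH] := profile_holder; exists H => // j x y x'.
rewrite /ckern /dilate -mulrBr normrM ger0_norm ?exprn_ge0//.
rewrite /wker -mulrDr mulrCA ler_wpM2l ?exprn_ge0// !bracketE.
apply: (le_trans (HH _ _)).
rewrite (_ : eucl_norm (_ - _) = 2 ^+ j * eucl_norm (x' - y))//.
rewrite -scalerBr eucl_normZ ger0_norm ?exprn_ge0//; congr (_ * eucl_norm _).
by rewrite opprB addrC addrA subrK.
Qed.

Definition rho : R := Num.sqrt 2^-1.

Lemma rho_itv : 0 < rho < 1.
Proof.
rewrite /rho sqrtr_gt0 invr_gt0 ltr0n/= -[ltRHS]sqrtr1 ltr_sqrt//.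
by rewrite invf_lt1// ltr1n.
Qed.

(** The factor 2^(-m/2) is the gain in the interaction of the frequencies j
    and j + m. *)
Lemma rho_sqrt j m z : Num.sqrt (2 ^+ j * eucl_norm z) <= rho ^+ m * bracket (j + m) z.
Proof.
have b1 := bracket_ge1 (j + m) z.
have -> : 2 ^+ j * eucl_norm z = 2^-1 ^+ m * (2 ^+ (j + m) * eucl_norm z).
  have p : (2 : R) ^+ m != 0 by rewrite expf_neq0.
  by rewrite exprVn exprD; move: (2 ^+ m) p (2 ^+ j) => P p Q; field.
rewrite sqrtrM ?exprn_ge0 ?invr_ge0//.
have -> : Num.sqrt (2^-1 ^+ m : R) = rho ^+ m.
  rewrite -[RHS]ger0_norm; last by rewrite exprn_ge0// sqrtr_ge0.
  by rewrite -sqrtr_sqr -exprM mulnC exprM /rho sqr_sqrtr// invr_ge0.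
rewrite ler_wpM2l ?exprn_ge0 ?sqrtr_ge0//.
have t0 : 0 <= 2 ^+ (j + m) * eucl_norm z by rewrite mulr_ge0// exprn_ge0.
rewrite /bracket; move: (2 ^+ (j + m) * eucl_norm z) t0 => t t0.
rewrite -(@ler_pXn2r _ 2)// ?nnegrE ?sqrtr_ge0 ?addr_ge0// sqr_sqrtr// sqrrD.
by have := sqr_ge0 t; nra.
Qed.

Hypothesis mean0 : \int[mu]_x (kappa x) = 0.

Lemma ckern_mean0 j x : \int[mu]_y (ckern j x y) = 0.
Proof.
have ik := profile_integrable prof.
have c0 : - 2 ^+ j != 0 :> R by rewrite oppr_eq0 expf_neq0.
have := Rintegral_rV_affine (2 ^+ j *: x) c0 ik.
rewrite mean0 => /esym/eqP; rewrite mulf_eq0 expf_eq0 normr_eq0 (negbTE c0) andbF/= => /eqP i0.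
rewrite /ckern /dilate RintegralZl//; last first.
  have := integrable_rV_affine (2 ^+ j *: x) c0 ik; apply: eq_integrable => // y _ /=.
  by rewrite scalerBr scaleNr addrC.
apply/eqP; rewrite mulf_eq0; apply/orP; right; apply/eqP; rewrite -[RHS]i0.
by apply: eq_Rintegral => y _; rewrite scalerBr scaleNr addrC.
Qed.

Lemma ckern_integrable j x : mu.-integrable setT (EFin \o ckern j x).
Proof.
have ik := profile_integrable prof.
have c0 : - 2 ^+ j != 0 :> R by rewrite oppr_eq0 expf_neq0.
have := integrableZl measurableT (2 ^+ (j * n)) (integrable_rV_affine (2 ^+ j *: x) c0 ik).
by apply: eq_integrable => // y _ /=; rewrite /ckern /dilate scalerBr scaleNr addrC.
Qed.

Lemma measurable_wpair k j x : measurable_fun setT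
  (fun z : E * E => (w k (z.1 - z.2) * w j (x - z.2))%:E).
Proof.
apply/measurable_EFinP; apply: measurable_funM.
  exact: (measurableT_comp (measurable_wker _ _) measurable_rV_sub).
by apply: (measurableT_comp (measurable_wker_sub _ _ x)); exact: measurable_snd.
Qed.

(** The finer kernel has mean zero, so ckern j x x' may be subtracted from
    ckern j x y; the difference is controlled by ckern_diff, and the square
    root of 2^j |x' - y| is absorbed by one bracket of the finer kernel. *)
Lemma ckern_ip : exists2 K : R, 0 <= K & forall j m x x',
  ((`|ip (ckern (j + m) x') (ckern j x)|)%:E <= (K * rho ^+ m)%:E *
   (\int[mu]_y (w (j + m) (x' - y) * w j (x - y))%:E + (w j (x - x'))%:E))%E.
Proof.
have [H H0 HH] := ckern_diff; have [A A0 HA] := dilate_le n.+2 prof.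
have [C C0 HC] := @integral_wker_le R n.
have [A1 A10 HA1] := ckern_kern.
exists (A * H * (1 + C)) => [|j m x x']; first by rewrite !mulr_ge0// addr_ge0// ltW.
set k := (j + m)%N.
have rho0 : 0 <= rho ^+ m by rewrite exprn_ge0// sqrtr_ge0.
have Lk := L2_kern x' (HA1 k); have Lj := L2_kern x (HA1 j).
have ikj := L2_integrable Lk Lj; have ik := ckern_integrable k x'.
have iz : mu.-integrable setT (EFin \o (fun y => ckern j x x' * ckern k x' y)).
  by have := integrableZl measurableT (ckern j x x') ik; apply: eq_integrable.
(* The subtracted term integrates to zero. *)
have -> : ip (ckern k x') (ckern j x) = \int[mu]_y (ckern k x' y * (ckern j x y - ckern j x x')).
  transitivity (\int[mu]_y (ckern k x' y * ckern j x y - ckern j x x' * ckern k x' y)).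
    by rewrite RintegralB// RintegralZl// ckern_mean0 mulr0 subr0.
  by apply: eq_Rintegral => y _; rewrite mulrBr; congr (_ - _); rewrite mulrC.
apply: (le_trans (fine_abs_le _)); apply: (le_trans (le_abse_integral mu measurableT _)).
  have [mk _] := Lk; have [mj _] := Lj.
  by apply/measurable_EFinP; apply: measurable_funM => //; exact: measurable_funB.
have mwk : measurable_fun setT (fun y => (w k (x' - y))%:E).
  by apply/measurable_EFinP; exact: measurable_wker_sub.
have mp : measurable_fun setT (fun y => (w k (x' - y) * w j (x - y))%:E).
  apply/measurable_EFinP; apply: measurable_funM; exact: measurable_wker_sub.
have wk0 y : (0 <= (w k (x' - y))%:E)%E by rewrite lee_fin wker_ge0.
have p0 y : (0 <= (w k (x' - y) * w j (x - y))%:E)%E by rewrite lee_fin mulr_ge0 ?wker_ge0.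
have q0 y : (0 <= (w j (x - x'))%:E * (w k (x' - y))%:E)%E by rewrite mule_ge0 ?lee_fin ?wker_ge0.
have mq : measurable_fun setT (fun y => ((w j (x - x'))%:E * (w k (x' - y))%:E)%E).
  exact: emeasurable_funM.
apply: (@le_trans _ _ (\int[mu]_y ((A * H * rho ^+ m)%:E *
  ((w k (x' - y) * w j (x - y))%:E + (w j (x - x'))%:E * (w k (x' - y))%:E)))%E).
  apply: ge0_le_integralT => // y.
  rewrite [leRHS](_ : _ = (A * H * rho ^+ m *
    (w k (x' - y) * w j (x - y) + w j (x - x') * w k (x' - y)))%:E)// lee_fin /= normrM.
  have h1 : `|ckern k x' y| <= A * (w k (x' - y) * (bracket k (x' - y))^-1).
    apply: le_trans (HA k (x' - y)) _; rewrite ler_wpM2l// /wker -mulrA ler_wpM2l ?exprn_ge0//.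
    by rewrite [in leLHS]exprSr invfM.
  apply: (le_trans (ler_pM _ _ h1 (HH j x y x'))) => //.
  have := rho_sqrt j m (x' - y); rewrite -/k => rs.
  have b0 := bracket_gt0 k (x' - y).
  rewrite [leLHS](_ : _ = A * H * (w k (x' - y) * (w j (x - y) + w j (x - x'))) *
    (Num.sqrt (2 ^+ j * eucl_norm (x' - y)) / bracket k (x' - y))); last by ring.
  rewrite [leRHS](_ : _ = A * H * (w k (x' - y) * (w j (x - y) + w j (x - x'))) * rho ^+ m); last by ring.
  apply: ler_wpM2l; last by rewrite ler_pdivrMr.
  apply: mulr_ge0; first exact: mulr_ge0.
  by apply: mulr_ge0; [exact: wker_ge0|apply: addr_ge0; exact: wker_ge0].
rewrite ge0_integralZl//; last 3 first.
- exact: emeasurable_funD.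
- by move=> y _; rewrite adde_ge0.
- by rewrite lee_fin !mulr_ge0.
rewrite ge0_integralD// ge0_integralZl ?lee_fin ?wker_ge0//.
set I := (\int[mu]_y (w k (x' - y) * w j (x - y))%:E)%E.
have I0 : (0 <= I)%E by apply: integral_ge0.
rewrite (_ : A * H * (1 + C) * rho ^+ m = A * H * rho ^+ m * (1 + C)); last by ring.
rewrite [(A * H * rho ^+ m * (1 + C))%:E]EFinM -[leRHS]muleA; apply: lee_wpmul2l.
  by rewrite lee_fin !mulr_ge0.
have wj0 : (0 <= (w j (x - x'))%:E)%E by rewrite lee_fin wker_ge0.
apply: (@le_trans _ _ ((1 + C)%:E * I + (1 + C)%:E * (w j (x - x'))%:E)%E); last first.
  by rewrite -ge0_muleDr.
apply: leeD.
  by rewrite -[leLHS]mul1e; apply: lee_wpmul2r => //; rewrite lee_fin lerDl ltW.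
rewrite muleC; apply: lee_wpmul2r; first by rewrite lee_fin wker_ge0.
have [h _] := HC k n.+1 (ltnSn n) x'.
by apply: (le_trans h); rewrite lee_fin lerDr.
Qed.

(** Kernel bound for T_j T_(j+m)^t: move T_(j+m) to the other side, then apply
    ckern_ip and Tonelli's theorem. *)
Lemma ckern_compose : exists2 K : R, 0 <= K & forall j m b x, L2 b ->
  ((`|ip (ckern j x) (fun y => ip ((ckern (j + m))^~ y) b)|)%:E <= (K * rho ^+ m)%:E *
   (convw n.+1 j (convw n.+1 (j + m) (absE b)) x + convw n.+1 j (absE b) x))%E.
Proof.
have [K K0 HK] := ckern_ip; have [A A0 HA] := ckern_kern.
exists K => // j m b x Lb; set k := (j + m)%N.
have rho0 : 0 <= rho ^+ m by rewrite exprn_ge0// sqrtr_ge0.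
have Lj := L2_kern x (HA j).
rewrite (ip_adjoint A0 (kern_transpose (HA k)) Lj Lb).
have [mb boo] := Lb.
have ab0 y := absE_ge0 b y; have mab := measurable_absE mb.
have LM : L2 (fun x' => ip (ckern k x') (ckern j x)).
  by have [C C0 HC] := @op_L2 R n; have [] := HC A k _ _ A0 (HA k) Lj.
have iM := L2_integrable Lb LM.
apply: (le_trans (fine_abs_le _)); apply: (le_trans (le_abse_integral mu measurableT (measurable_int _ iM))).
pose I x' := (\int[mu]_y (w k (x' - y) * w j (x - y))%:E)%E.
have p0 x' y : (0 <= (w k (x' - y) * w j (x - y))%:E)%E by rewrite lee_fin mulr_ge0 ?wker_ge0.
have I0 x' : (0 <= I x')%E by apply: integral_ge0.
have mI : measurable_fun setT I.
  apply: (measurable_fun_fubini_tonelli_F (m2 := mu)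
    (fun z : E * E => (w k (z.1 - z.2) * w j (x - z.2))%:E)) => //; exact: measurable_wpair.
have mwj : measurable_fun setT (fun y => (w j (x - y))%:E).
  by apply/measurable_EFinP; exact: measurable_wker_sub.
have mwk x' : measurable_fun setT (fun y => (w k (x' - y))%:E).
  by apply/measurable_EFinP; exact: measurable_wker_sub.
have wj0 y : (0 <= (w j (x - y))%:E)%E by rewrite lee_fin wker_ge0.
have m1 : measurable_fun setT (fun x' => (absE b x' * I x')%E) by exact: emeasurable_funM.
have m2 : measurable_fun setT (fun x' => (absE b x' * (w j (x - x'))%:E)%E) by exact: emeasurable_funM.
apply: (@le_trans _ _ (\int[mu]_x' ((K * rho ^+ m)%:E * (absE b x' * I x' + absE b x' * (w j (x - x'))%:E)))%E).
  apply: ge0_le_integralT => // x'.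
  rewrite /= normrM EFinM -ge0_muleDr// muleCA; apply: lee_wpmul2l => //.
  exact: HK.
rewrite ge0_integralZl//; last 3 first.
- exact: emeasurable_funD.
- by move=> x' _; rewrite adde_ge0// mule_ge0.
- by rewrite lee_fin mulr_ge0.
apply: lee_wpmul2l; first by rewrite lee_fin mulr_ge0.
rewrite ge0_integralD//; last 2 first.
- by move=> x' _; rewrite mule_ge0.
- by move=> x' _; rewrite mule_ge0.
have -> : (\int[mu]_x' (absE b x' * (w j (x - x'))%:E) = convw n.+1 j (absE b) x)%E.
  by apply: eq_integral => y _; rewrite muleC.
suff -> : (\int[mu]_x' (absE b x' * I x') = convw n.+1 j (convw n.+1 k (absE b)) x)%E by [].
pose F (z : E * E) : \bar R := (absE b z.1 * ((w k (z.1 - z.2))%:E * (w j (x - z.2))%:E))%E.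
have F0 (z : E * E) : (0 <= F z)%E by rewrite /F mule_ge0// -EFinM.
have mF : measurable_fun setT F.
  apply: emeasurable_funM; first exact: (measurableT_comp mab measurable_fst).
  by under eq_fun do rewrite -EFinM; exact: measurable_wpair.
transitivity (\int[mu]_x' \int[mu]_y F (x', y))%E.
  apply: eq_integral => x' _; rewrite /I -ge0_integralZl//.
  by apply/measurable_EFinP; apply: measurable_funM; exact: measurable_wker_sub.
rewrite (fubini_tonelli F mF F0); apply: eq_integral => y _.
rewrite /convw -ge0_integralZl//; last 2 first.
- by apply: emeasurable_funM => //; apply/measurable_EFinP; exact: measurable_wker_sub.
- by move=> x' _; rewrite mule_ge0// lee_fin wker_ge0.
apply: eq_integral => x' _; rewrite /F /= muleC -muleA muleCA; congr (_ * (_ * _))%E.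
by rewrite -wkerN opprB.
Qed.

Lemma ckern_orthogonal : exists2 K : R, 0 < K & forall j m a b, L2 a -> L2 b ->
  `|ip a (fun x => ip (ckern j x) (fun y => ip ((ckern (j + m))^~ y) b))| <=
  K * rho ^+ m * (ip a a + ip b b).
Proof.
have [K K0 HK] := ckern_compose; have [C C0 HC] := @convw_L2 R n.
have [A A0 HA] := ckern_kern; have [D D0 HD] := @op_L2 R n.
exists ((K + 1) * (1 + C * C + C)) => [|j m a b La Lb].
  by apply: mulr_gt0; [lra|have := mulr_gt0 C0 C0; lra].
set k := (j + m)%N.
have rho0 : 0 <= rho ^+ m by rewrite exprn_ge0// sqrtr_ge0.
have [Lu _] := HD A k _ _ A0 (kern_transpose (HA k)) Lb.
have [Lv _] := HD A j _ _ A0 (HA j) Lu.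
have iav := L2_integrable La Lv.
have [mb boo] := Lb; have [ma aoo] := La.
have ab0 y := absE_ge0 b y; have mab := measurable_absE mb.
pose Y := convw n.+1 j (absE b); pose Xk := convw n.+1 k (absE b); pose X := convw n.+1 j Xk.
have Y0 x : (0 <= Y x)%E by exact: convw_ge0.
have Xk0 x : (0 <= Xk x)%E by exact: convw_ge0.
have X0 x : (0 <= X x)%E by exact: convw_ge0.
have mY : measurable_fun setT Y by exact: measurable_convw.
have mXk : measurable_fun setT Xk by exact: measurable_convw.
have mX : measurable_fun setT X by exact: measurable_convw.
have c0 : 0 <= K * rho ^+ m by rewrite mulr_ge0.
rewrite -lee_fin.
apply: (le_trans (fine_abs_le _)); apply: (le_trans (le_abse_integral mu measurableT (measurable_int _ iav))).
have s0 x : (0 <= (a x ^+ 2)%:E)%E by rewrite lee_fin sqr_ge0.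
have ms : measurable_fun setT (fun x => (a x ^+ 2)%:E) by apply/measurable_EFinP; exact: measurable_funX.
have mX2 : measurable_fun setT (fun x => X x `^ 2)%E by exact: measurable_poweR_comp.
have mY2 : measurable_fun setT (fun x => Y x `^ 2)%E by exact: measurable_poweR_comp.
apply: (@le_trans _ _ (\int[mu]_x ((K * rho ^+ m)%:E * ((a x ^+ 2)%:E + X x `^ 2 + Y x `^ 2)))%E).
  apply: ge0_le_integralT => // x.
  rewrite /= normrM EFinM; apply: (le_trans (lee_wpmul2l _ (HK j m b x Lb))) => //.
  rewrite muleCA -/k -/Xk -/X -/Y; apply: lee_wpmul2l => //.
  case: (X x) (X0 x) => [s| |]// s1; last first.
    rewrite [(+oo `^ 2)%E]poweRyr ?pnatr_eq0// addey// [X in (_ <= X)%E]addye ?leey//.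
    by rewrite -ltNye (lt_le_trans _ (poweR_ge0 _ _)).
  case: (Y x) (Y0 x) => [t| |]// t1; last by rewrite poweRyr ?pnatr_eq0// addey ?leey.
  rewrite !poweR_EFin !powR_mulrn// -!EFinD -EFinM lee_fin -(real_normK (num_real (a x))).
  rewrite !lee_fin in s1 t1.
  have := sqr_ge0 (`|a x| - s - t); have := sqr_ge0 (s - t); have := normr_ge0 (a x).
  have := sqr_ge0 (`|a x| - s); have := sqr_ge0 (`|a x| - t); nra.
rewrite ge0_integralZl//; last 2 first.
- by apply: emeasurable_funD => //; exact: emeasurable_funD.
- by move=> x _; rewrite !adde_ge0 ?poweR_ge0.
rewrite ge0_integralD//; last 3 first.
- by move=> x _; rewrite adde_ge0 ?poweR_ge0.
- exact: emeasurable_funD.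
- by move=> x _; exact: poweR_ge0.
rewrite ge0_integralD//; last by move=> x _; exact: poweR_ge0.
rewrite -ipE//.
have bE : (\int[mu]_y (absE b y `^ 2) = (ip b b)%:E)%E.
  by rewrite ipE//; apply: eq_integral => y _; exact: absE_sqr.
have hY : (\int[mu]_x (Y x `^ 2) <= (C * ip b b)%:E)%E.
  by apply: (le_trans (HC j _ mab ab0)); rewrite bE -EFinM.
have hX : (\int[mu]_x (X x `^ 2) <= (C * (C * ip b b))%:E)%E.
  apply: (le_trans (HC j _ mXk Xk0)); rewrite [leRHS]EFinM; apply: lee_wpmul2l; first by rewrite lee_fin ltW.
  by apply: (le_trans (HC k _ mab ab0)); rewrite bE -EFinM.
apply: (le_trans (lee_wpmul2l _ (leeD (leeD (lexx _) hX) hY))); first by rewrite lee_fin.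
rewrite -!EFinD -EFinM lee_fin.
have a0 := ip_ge0 mu a; have b0 := ip_ge0 mu b.
have i1 : ip a a + C * (C * ip b b) + C * ip b b <= (1 + C * C + C) * (ip a a + ip b b).
  have := mulr_ge0 (mulr_ge0 (ltW C0) (ltW C0)) a0; have := mulr_ge0 (ltW C0) a0; nra.
rewrite [leRHS](_ : _ = (K + 1) * rho ^+ m * ((1 + C * C + C) * (ip a a + ip b b))); last by ring.
apply: ler_pM => //; last by rewrite ler_wpM2r// lerDl.
by have := mulr_ge0 (ltW C0) b0; have := mulr_ge0 (mulr_ge0 (ltW C0) (ltW C0)) b0; nra.
Qed.

Lemma sum_rho_le : exists2 W : R, 0 < W & forall J j : nat,
  \sum_(k < J) rho ^+ `|(j%:Z - k%:Z)%R|%N <= W.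
Proof.
have [W W0 HW] := esum_geometric_int rho_itv.
have r0 m : 0 <= rho ^+ m by rewrite exprn_ge0// sqrtr_ge0.
exists W => // J j; rewrite -lee_fin -sumEFin.
apply: le_trans (HW j%:Z).
apply: (@le_trans _ _ (\esum_(k in [set: nat]) (rho ^+ `|(j%:Z - k%:Z)%R|%N)%:E)%E).
  rewrite -nneseries_esumT => [|k]; last by rewrite lee_fin.
  rewrite -(big_mkord xpredT (fun k => (rho ^+ `|(j%:Z - k%:Z)%R|%N)%:E)).
  by apply: nneseries_lim_ge => k _ _; rewrite lee_fin.
have -> : (\esum_(k in [set: nat]) (rho ^+ `|(j%:Z - k%:Z)%R|%N)%:E =
  \esum_(k in [set: nat]) (fun i : int => (rho ^+ `|(i - j%:Z)%R|%N)%:E) k%:Z)%E.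
  by apply: eq_esum => k _; rewrite distnC.
apply: (@esum_le_inj _ _ _ (fun k : nat => k%:Z)) => [k l|i]; first by case.
by rewrite lee_fin.
Qed.

(** With h_j = T_j g, u_j = T_j^t h_j and S = sum ||h_j||^2 one has <g, sum
    u_j> = S and ||sum u_j||^2 <= L S by almost orthogonality. Expanding 0 <=
    ||L g - sum u_j||^2 yields S <= L ||g||^2. *)
Lemma littlewood_paley : exists2 D : R, 0 < D & forall g, L2 g ->
  (\esum_(j in [set: nat]) \int[mu]_x (ip (ckern j x) g ^+ 2)%:E <=
   D%:E * \int[mu]_x (g x ^+ 2)%:E)%E.
Proof.
have [K K0 HK] := ckern_orthogonal; have [W W0 HW] := sum_rho_le.
have [A A0 HA] := ckern_kern; have [D D0 HD] := @op_L2 R n.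
pose L := 2 * K * W; have L0 : 0 < L by rewrite !mulr_gt0.
exists L => // g Lg.
pose h j x := ip (ckern j x) g; pose u j y := ip ((ckern j)^~ y) (h j).
have Lh j : L2 (h j) by have [] := HD A j _ _ A0 (HA j) Lg.
have Lu j : L2 (u j) by have [] := HD A j _ _ A0 (kern_transpose (HA j)) (Lh j).
pose s j := ip (h j) (h j); have s0 j : 0 <= s j by exact: ip_ge0.
have gu j : ip g (u j) = s j by rewrite /s {2}/h (ip_adjoint A0 (HA j) (Lh j) Lg).
have uu j k : ip (u j) (u k) = ip (h j) (fun x => ip (ckern j x) (u k)).
  by rewrite ipC {1}/u (ip_adjoint A0 (kern_transpose (HA j)) (Lu k) (Lh j)).
have key j k : ip (u j) (u k) <= K * rho ^+ `|(j%:Z - k%:Z)%R|%N * (s j + s k).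
  wlog jk : j k / (j <= k)%N.
    move=> H; have [|/ltnW] := leqP j k; first exact: H.
    by move=> kj; rewrite ipC distnC [s j + _]addrC; exact: H.
  have [m ->] : exists m, k = (j + m)%N by exists (k - j)%N; rewrite subnKC.
  rewrite (_ : `|(j%:Z - (j + m)%:Z)%R|%N = m); last by lia.
  by rewrite uu; apply: le_trans (ler_norm _) _; exact: HK.
have fin J : \sum_(j < J) s j <= L * ip g g.
  pose U x := \sum_(j < J) u j x.
  have LU : L2 U by exact: L2_sum.
  set S := \sum_(j < J) s j.
  have gU : ip g U = S by rewrite ipC ip_suml//; apply: eq_bigr => j _; rewrite ipC.
  have UU : ip U U <= L * S.
    rewrite /U ip_suml//.
    apply: (@le_trans _ _ (\sum_(j < J) \sum_(k < J) K * rho ^+ `|(j%:Z - k%:Z)%R|%N * (s j + s k))).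
      by apply: ler_sum => j _; rewrite ipC ip_suml//; apply: ler_sum => k _; rewrite ipC.
    have csym (j k : nat) : K * rho ^+ `|(j%:Z - k%:Z)%R|%N = K * rho ^+ `|(k%:Z - j%:Z)%R|%N.
      by rewrite distnC.
    have /= -> := @symmetric_double_sum R J (fun j k => K * rho ^+ `|(j%:Z - k%:Z)%R|%N) s csym.
    rewrite /L -!mulrA ler_wpM2l// mulrA mulr_sumr; apply: ler_sum => j _.
    rewrite -mulr_suml -mulr_sumr ler_wpM2r// ler_wpM2l ?(ltW K0)//; exact: HW.
  have := ip_ge0 mu (fun x => - L * g x + U x).
  rewrite ip_expand// gU => pos.
  rewrite -(ler_pM2l L0); move: pos UU; rewrite sqrrN expr2; nra.
rewrite -nneseries_esumT; last by move=> j; apply: integral_ge0 => x _; rewrite lee_fin sqr_ge0.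
apply: lime_le.
  by apply: is_cvg_nneseries => j _ _; apply: integral_ge0 => x _; rewrite lee_fin sqr_ge0.
apply: nearW => J; rewrite big_mkord -ipE// -EFinM.
rewrite (eq_bigr (fun j : 'I_J => (s j)%:E)); last by move=> j _; rewrite /s ipE.
by rewrite sumEFin lee_fin; exact: fin.
Qed.

End almost_orthogonality.

(** * The square integrable case and the theorem *)

Section square_case.
Context {R : realType} {n : nat}.
Hypothesis n_gt0 : (0 < n)%N.
Local Notation C := R[i].
Local Notation E := 'rV[R]_n.
Local Notation mu := (lebesgue_rV R n).
Local Notation L2 := (@L2 _ _ R mu).
Local Notation ip := (@ip _ _ R mu).
Implicit Types (x y z : E) (a b g h : E -> R) (f : E -> C) (j k : nat).

(** The kernels of all frequencies in one family: the lowest one is not of the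
    form of the others. *)
Definition lp_kernel a j : E -> E -> R :=
  if j is 0 then ckern a 0 else ckern (halve a) j.

Lemma lp_kernel_kern a : profile a -> exists2 A : R, 0 <= A & forall j, kern A j (lp_kernel a j).
Proof.
move=> pa; have [A A0 HA] := ckern_kern pa.
have [B B0 HB] := ckern_kern (profile_halve pa).
exists (A + B) => [|[|j]]; first exact: addr_ge0.
- have [m h] := HA 0%N; split=> // x y; apply: (le_trans (h x y)).
  by rewrite ler_wpM2r ?wker_ge0// lerDl.
- have [m h] := HB j.+1; split=> // x y; apply: (le_trans (h x y)).
  by rewrite ler_wpM2r ?wker_ge0// lerDr.
Qed.

Lemma lp_kernel_square a : profile a -> exists2 D : R, 0 < D & forall g, L2 g ->
  (\esum_(j in [set: nat]) \int[mu]_x (ip (lp_kernel a j x) g ^+ 2)%:E <=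
   D%:E * \int[mu]_x (g x ^+ 2)%:E)%E.
Proof.
move=> pa; have [A A0 HA] := ckern_kern pa.
have [D D0 HD] := littlewood_paley n_gt0 (profile_halve pa) (Rintegral_halve pa).
have [C C0 HC] := @op_L2 R n.
exists (A ^+ 2 * C + D) => [|g Lg]; first by rewrite ltr_wpDl// mulr_ge0 ?sqr_ge0// ltW.
have sq (u : E -> R) : (0 <= \int[mu]_x (u x ^+ 2)%:E)%E.
  by apply: integral_ge0 => x _; rewrite lee_fin sqr_ge0.
have X0 : (0 <= \int[mu]_x (ip (ckern a 0 x) g ^+ 2)%:E)%E by exact: (sq (fun x => ip (ckern a 0 x) g)).
have G0 j : (0 <= \int[mu]_x (ip (ckern (halve a) j x) g ^+ 2)%:E)%E.
  exact: (sq (fun x => ip (ckern (halve a) j x) g)).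
have AC0 : 0 <= A ^+ 2 * C by rewrite mulr_ge0 ?sqr_ge0// ltW.
have split0 (F G : nat -> \bar R) (X : \bar R) : (0 <= X)%E -> (forall j, 0 <= G j)%E ->
    F 0%N = X -> (forall j, F j.+1 = G j.+1) ->
    (\esum_(j in [set: nat]) F j <= X + \esum_(j in [set: nat]) G j)%E.
  move=> X_ge0 G_ge0 F0 FS.
  apply: (@le_trans _ _ (\esum_(j in [set: nat]) ((if j == 0%N then X else 0) + G j))%E).
    apply: le_esum => -[|j] _; first by rewrite F0 leeDl.
    by rewrite FS add0e.
  rewrite esumD//; last by move=> j _; case: ifP.
  apply: leeD => //; rewrite (esumID [set 0%N])//=; last by move=> j _; case: ifP.
  by rewrite setTI esum_set1//= esum1 ?adde0// => j [_ /= /eqP/negbTE ->].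
apply: (le_trans (split0 (fun j => \int[mu]_x (ip (lp_kernel a j x) g ^+ 2)%:E)%E
  (fun j => \int[mu]_x (ip (ckern (halve a) j x) g ^+ 2)%:E)%E _ X0 G0 _ _)) => //.
rewrite EFinD ge0_muleDl ?lee_fin ?(ltW D0)//.
apply: leeD; last exact: HD.
by have [] := HC A 0%N _ g A0 (HA 0%N) Lg.
Qed.

(** The annuli cover everything but the origin. *)
Lemma herz_square f : cmeasurable f ->
  (\esum_(k in [set: int]) (herz_term 0 2 (fun x => (cmod (f x))%:E) k `^ 2) =
   \int[mu]_x (cmod (f x) ^+ 2)%:E)%E.
Proof.
move=> mf; have mc := measurable_cmod mf.
have two : (0 : R) < 2 by [].
transitivity (\int[mu]_x ((cmod (f x))%:E `^ 2))%E; last first.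
  by apply: eq_integral => x _; rewrite poweR_EFin powR_mulrn// cmod_ge0.
rewrite (integral_cut n_gt0); last 2 first.
- by apply: measurable_poweR_comp; exact/measurable_EFinP.
- by move=> x; exact: poweR_ge0.
apply: eq_esum => k _.
rewrite /herz_term mulr0 powRr0 mul1e poweRVK//; last exact: cut_int_ge0.
by apply: eq_integral => x _; rewrite cut_poweR// muleC.
Qed.

Variable phi0 : E -> C.
Hypothesis gen : is_resolution_generator phi0.

(** The real and imaginary parts of the kernel and of the function are
    separated, and lp_kernel_square bounds each of the four resulting terms.
    *)
Lemma square_convolution : exists2 D : R, 0 < D & forall f, cmeasurable f ->
  (\int[mu]_x (cmod (f x) ^+ 2)%:E < +oo)%E ->
  (\esum_(j in [set: nat]) \int[mu]_x
     (cmod (convolution (inv_fourier (resolution phi0 j)) (distribution_of f) x) ^+ 2)%:E <=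
   D%:E * \int[mu]_x (cmod (f x) ^+ 2)%:E)%E.
Proof.
have [a [b [pa pb e0 e1]]] := resolution_kernel n_gt0 gen.
have [A A0 HA] := lp_kernel_square pa; have [B B0 HB] := lp_kernel_square pb.
have [Ka Ka0 HKa] := lp_kernel_kern pa; have [Kb Kb0 HKb] := lp_kernel_kern pb.
have [CC CC0 HCC] := @op_L2 R n.
exists (4 * (A + B)) => [|f [mf1 mf2] foo]; first by rewrite mulr_gt0// addr_gt0.
pose f1 x := complex.Re (f x); pose f2 x := complex.Im (f x).
set I := (\int[mu]_x (cmod (f x) ^+ 2)%:E)%E in foo *.
have le1 : (\int[mu]_x (f1 x ^+ 2)%:E <= I)%E.
  apply: ge0_le_integralT => x; rewrite lee_fin ?sqr_ge0//.
  by rewrite -real_normK ?num_real// lerXn2r ?nnegrE ?cmod_ge0// Re_le_cmod.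
have le2 : (\int[mu]_x (f2 x ^+ 2)%:E <= I)%E.
  apply: ge0_le_integralT => x; rewrite lee_fin ?sqr_ge0//.
  by rewrite -real_normK ?num_real// lerXn2r ?nnegrE ?cmod_ge0// Im_le_cmod.
have L1 : L2 f1 by split=> //; exact: le_lt_trans foo.
have L2' : L2 f2 by split=> //; exact: le_lt_trans foo.
have psiE j x y : inv_fourier (resolution phi0 j) (x - y) = (lp_kernel a j x y +i* lp_kernel b j x y)%C.
  case: j => [|j]; last by rewrite e1.
  by rewrite e0 /= /ckern /dilate mul0n expr0 !mul1r scale1r.
pose q u g j x := ip (lp_kernel u j x) g ^+ 2.
have convE j x : cmod (convolution (inv_fourier (resolution phi0 j)) (distribution_of f) x) ^+ 2 <=
    2 * (q a f1 j x + q b f2 j x + q b f1 j x + q a f2 j x).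
  have La := L2_kern x (HKa j); have Lb := L2_kern x (HKb j).
  rewrite /convolution /distribution_of /cintegral.
  have -> : \int[mu]_y complex.Re (f y * inv_fourier (resolution phi0 j) (x - y)) =
      ip (lp_kernel a j x) f1 - ip (lp_kernel b j x) f2.
    rewrite /ip -RintegralB//; try exact: L2_integrable.
    apply: eq_Rintegral => y _; rewrite psiE /f1 /f2; case: (f y) => u v /=.
    by rewrite [u * _]mulrC [v * _]mulrC.
  have -> : \int[mu]_y complex.Im (f y * inv_fourier (resolution phi0 j) (x - y)) =
      ip (lp_kernel b j x) f1 + ip (lp_kernel a j x) f2.
    rewrite /ip -RintegralD//; try exact: L2_integrable.
    apply: eq_Rintegral => y _; rewrite psiE /f1 /f2; case: (f y) => u v /=.
    by rewrite [u * _]mulrC [v * _]mulrC.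
  rewrite /cmod /= sqr_sqrtr ?addr_ge0 ?sqr_ge0// /q.
  set s := ip _ f1; set t := ip _ f2; set s' := ip _ f1; set t' := ip _ f2.
  have := sqr_ge0 (s + t); have := sqr_ge0 (s' - t'); nra.
have mq u K j g : (kern K j (lp_kernel u j)) -> L2 g -> measurable_fun setT (fun x => (q u g j x)%:E).
  move=> kK Lg; apply/measurable_EFinP; apply: measurable_funX; exact: measurable_op kK Lg.
have q0 u g j x : (0 <= (q u g j x)%:E)%E by rewrite lee_fin sqr_ge0.
pose Q u g j := (\int[mu]_x (q u g j x)%:E)%E.
have Q0 u g j : (0 <= Q u g j)%E by apply: integral_ge0.
have intE j : (\int[mu]_x
     (cmod (convolution (inv_fourier (resolution phi0 j)) (distribution_of f) x) ^+ 2)%:E <=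
     2%:E * (Q a f1 j + Q b f2 j + Q b f1 j + Q a f2 j))%E.
  have m1 := mq a _ _ _ (HKa j) L1; have m2 := mq b _ _ _ (HKb j) L2'.
  have m3 := mq b _ _ _ (HKb j) L1; have m4 := mq a _ _ _ (HKa j) L2'.
  have m12 := emeasurable_funD m1 m2; have m123 := emeasurable_funD m12 m3.
  rewrite /Q -ge0_integralD// -ge0_integralD//; last by move=> x _; rewrite adde_ge0.
  rewrite -ge0_integralD//; last by move=> x _; rewrite !adde_ge0.
  rewrite -ge0_integralZl//; last 2 first.
  - exact: (emeasurable_funD m123 m4).
  - by move=> x _; rewrite !adde_ge0.
  apply: ge0_le_integralT => x; first by rewrite lee_fin sqr_ge0.
  by rewrite -!EFinD -EFinM lee_fin.
apply: (le_trans (le_esum (fun j _ => intE j))).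
have Q2 j : (0 <= Q a f1 j + Q b f2 j)%E := adde_ge0 (Q0 _ _ _) (Q0 _ _ _).
have Q3 j : (0 <= Q a f1 j + Q b f2 j + Q b f1 j)%E := adde_ge0 (Q2 j) (Q0 _ _ _).
have Q4 j : (0 <= Q a f1 j + Q b f2 j + Q b f1 j + Q a f2 j)%E := adde_ge0 (Q3 j) (Q0 _ _ _).
rewrite (esumZ (ler0n R 2) Q4).
rewrite (esumD (fun j _ => Q3 j) (fun j _ => Q0 _ _ j)).
rewrite (esumD (fun j _ => Q2 j) (fun j _ => Q0 _ _ j)).
rewrite (esumD (fun j _ => Q0 _ _ j) (fun j _ => Q0 _ _ j)).
have I0 : (0 <= I)%E by apply: integral_ge0 => x _; rewrite lee_fin sqr_ge0.
have bnd u g (D : R) : 0 < D -> (\esum_(j in [set: nat]) Q u g j <= D%:E * \int[mu]_x (g x ^+ 2)%:E)%E ->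
    (\int[mu]_x (g x ^+ 2)%:E <= I)%E -> (\esum_(j in [set: nat]) Q u g j <= D%:E * I)%E.
  by move=> D0 h1 h2; apply: (le_trans h1); apply: lee_wpmul2l => //; rewrite lee_fin ltW.
have B1 := bnd _ _ _ A0 (HA _ L1) le1; have B2 := bnd _ _ _ B0 (HB _ L2') le2.
have B3 := bnd _ _ _ B0 (HB _ L1) le1; have B4 := bnd _ _ _ A0 (HA _ L2') le2.
apply: (le_trans (lee_wpmul2l _ (leeD (leeD (leeD B1 B2) B3) B4))) => //.
have Ifin : I \is a fin_num by rewrite ge0_fin_numE.
move: (I) Ifin => [t| |]// _.
rewrite [leLHS](_ : _ = (2 * (A * t + B * t + B * t + A * t))%:E)// -EFinM lee_fin.
by rewrite le_eqVlt; apply/orP; left; apply/eqP; ring.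
Qed.

Lemma besov_norm_le_square : exists c : R, forall f, herz_space 0 2%:E 2%:E f ->
  (besov_norm phi0 0 2%:E 2%:E (distribution_of f) <= c%:E * herz_norm 0 2%:E 2%:E f)%E.
Proof.
have [D D0 HD] := square_convolution.
have two : (0 : R) < 2 by [].
exists (D `^ 2^-1) => f [[mf _] foo].
have I0 : (0 <= \int[mu]_x (cmod (f x) ^+ 2)%:E)%E.
  by apply: integral_ge0 => x _; rewrite lee_fin sqr_ge0.
rewrite herz_normE// herz_square// in foo *.
have Ifin : (\int[mu]_x (cmod (f x) ^+ 2)%:E < +oo)%E.
  rewrite ltey; apply: contraTneq foo => ->.
  by rewrite poweRyr ?ltxx// invr_eq0 pnatr_eq0.
rewrite -poweR_EFin -poweRM ?lee_fin ?(ltW D0)//.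
rewrite /besov_norm /ell_norm; apply: le_poweR; first by rewrite invr_ge0.
  by apply: esum_ge0 => j _; exact: poweR_ge0.
apply: le_trans (HD f mf Ifin); apply: le_esum => j _.
rewrite mulr0 powRr0 mul1e /Lp_norm unlock.
have -> : (\int[mu]_x (`|(cmod (convolution (inv_fourier (resolution phi0 j)) (distribution_of f) x))%:E| `^ 2) =
  \int[mu]_x (cmod (convolution (inv_fourier (resolution phi0 j)) (distribution_of f) x) ^+ 2)%:E)%E.
  by apply: eq_integral => x _; rewrite gee0_abs ?lee_fin ?cmod_ge0// poweR_EFin powR_mulrn// cmod_ge0.
by rewrite poweRVK// integral_ge0// => x _; rewrite lee_fin sqr_ge0.
Qed.

End square_case.

Theorem theorem4 (R : realType) (n : nat) (phi0 : 'rV[R]_n -> R[i])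
    (alpha s1 : R) (s : \bar R) (r q : R)
    (hn : (0 < n)%N)
    (hphi0 : is_resolution_generator phi0)
    (hs : (0 < s)%E) (hr : 1 < r) (hq : 1 < q)
    (halpha : 0 <= alpha < n%:R - n%:R / q)
    (hbalance : dim_over n s - s1 = alpha + n%:R / q)
    (hcase :
      [/\ (q%:E < s)%E, q <= r & 0 < alpha] \/
      [/\ (q%:E < s)%E, q <= r, (r%:E <= s)%E & alpha = 0] \/
      ((s <= q%:E)%E /\ dim_over n s - n%:R / q < alpha) \/
      [/\ (s <= q%:E)%E, q <= r, (r%:E <= s)%E,
          alpha = dim_over n s - n%:R / q & r = 2]) :
  herz_embeds_in_besov alpha r%:E q%:E phi0 s1 s r%:E.
Proof.
have /andP[al0 al1] := halpha; have r0 : 0 < r by exact: lt_trans hr.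
have reg (f : 'rV[R]_n -> R[i]) : herz_space alpha r%:E q%:E f -> regular_tempered f.
  move=> hf; exact: (herz_regular hn hq r0 al0 al1 hf).
have [c Hc] : exists c : R, forall f : 'rV[R]_n -> R[i], herz_space alpha r%:E q%:E f ->
    (besov_norm phi0 s1 s r%:E (distribution_of f) <= c%:E * herz_norm alpha r%:E q%:E f)%E.
  have pos : conv_cases (n := n) s alpha q r -> exists c : R, forall f : 'rV[R]_n -> R[i], herz_space alpha r%:E q%:E f ->
    (besov_norm phi0 s1 s r%:E (distribution_of f) <= c%:E * herz_norm alpha r%:E q%:E f)%E.
    move=> cc; have [N [nN [D D0 HD]]] := positive_embedding hn hq r0 hs al0 al1 hbalance cc.
    have [c Hc] := besov_norm_le hn hphi0 hq r0 hs D0 HD.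
    by exists c => f [[mf _] _]; exact: Hc.
  case: hcase => [[qs qr a0]|[[qs qr rs a0]|[[sq a0]|[sq qr rs a0 r2]]]].
  - by apply: pos; apply: Or31.
  - by apply: pos; apply: Or32.
  - by apply: pos; apply: Or33.
  move: s sq rs a0 hs hbalance {pos} => -[t| |]//=; rewrite !lee_fin => tq rt a0 t0 bal.
  have q2 : q = 2 by apply/eqP; rewrite eq_le; apply/andP; split; lra.
  have t2 : t = 2 by apply/eqP; rewrite eq_le; apply/andP; split; lra.
  have al : alpha = 0 by rewrite a0 t2 q2 subrr.
  have s10 : s1 = 0 by move: bal; rewrite al t2 q2; lra.
  by rewrite al s10 t2 q2 r2; exact: besov_norm_le_square.
split; last by exists c.
move=> f hf; have rf := reg f hf; split=> //; split; first by case: rf.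
apply: (le_lt_trans (Hc f hf)); case: hf => _.
have : (0 <= herz_norm alpha r%:E q%:E f)%E by exact: poweR_ge0.
by case: (herz_norm _ _ _ _) => [t| |]//= _ _; rewrite -EFinM ltry.
Qed.
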